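(* Let $\omega\subset\mathbb{R}^2$ be an open, bounded, smooth domain. Fix integers $N,K\ge 4$ and an exponent $\gamma\in(0,1)$. Then there exists $l_0\in(0,1)$ depending only on $\omega$, and there exists $\sigma_0\ge 1$ depending on $\omega,\gamma,N,K$, such that the following holds. Let $\beta>0$ and let $l,\lambda,\mathcal{M}$ be positive constants, and let $v\in\mathcal{C}^2(\bar\omega+\bar B_{2l}(0),\mathbb{R}^3)$, $w\in\mathcal{C}^2(\bar\omega+\bar B_{2l}(0),\mathbb{R}^2)$, $A\in\mathcal{C}^{0,\beta}(\bar\omega+\bar B_{2l}(0),\mathbb{R}^{2\times2}_{\mathrm{sym}})$, with $$l\le l_0,\qquad \lambda^{1-\gamma}l\ge\sigma_0,\qquad \mathcal{M}\ge\max\{\|v\|_2,\|w\|_2,1\}.$$ Then there exist $\tilde v\in\mathcal{C}^2(\bar\omega+\bar B_l(0),\mathbb{R}^3)$ and $\tilde w\in\mathcal{C}^2(\bar\omega+\bar B_l(0),\mathbb{R}^2)$ such that, with $$\mathcal{D}=A-\Big(\frac12(\nabla v)^T\nabla v+\mathrm{sym}\nabla w\Big),\qquad \tilde{\mathcal{D}}=A-\Big(\frac12(\nabla\tilde v)^T\nabla\tilde v+\mathrm{sym}\nabla\tilde w\Big),$$ and writing $J=(F_{K+1}-2)+(F_{K+1}-1)N/2$, the following bounds hold: $$\|\tilde v-v\|_1\le C\lambda^{\gamma/2}\big(\|\mathcal{D}\|_0^{1/2}+l\mathcal{M}\big),$$ $$\|\tilde w-w\|_1\le C\lambda^{\gamma}\big(\|\mathcal{D}\|_0^{1/2}+l\mathcal{M}\big)\big(1+\|\mathcal{D}\|_0^{1/2}+l\mathcal{M}+\|\nabla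 v\|_0\big),$$ $$\|\nabla^2\tilde v\|_0\le C\frac{(\lambda l)^{J}\lambda^{\gamma/2}}{l}\big(\|\mathcal{D}\|_0^{1/2}+l\mathcal{M}\big),$$ $$\|\nabla^2\tilde w\|_0\le C\frac{(\lambda l)^{J}\lambda^{\gamma}}{l}\big(\|\mathcal{D}\|_0^{1/2}+l\mathcal{M}\big)\big(1+\|\mathcal{D}\|_0^{1/2}+l\mathcal{M}+\|\nabla v\|_0\big),$$ $$\|\tilde{\mathcal{D}}\|_0\le C\Big(l^\beta\|A\|_{0,\beta}+\frac{\lambda^\gamma}{(\lambda l)^{2(F_K-1)N}}\big(\|\mathcal{D}\|_0+(l\mathcal{M})^2\big)\Big),$$ where the constants $C$ depend only on $\omega,\gamma,N,K$.
   Context: $\{F_k\}_{k\ge0}$ is the Fibonacci sequence $F_0=F_1=1$, $F_{k+2}=F_k+F_{k+1}$. $\bar\omega+\bar B_r(0)$ is the closed $r$-neighbourhood of $\omega$. Norms of $v,w,A,\mathcal{D}$ are taken on $\bar\omega+\bar B_{2l}(0)$ and norms of $\tilde v,\tilde w,\tilde{\mathcal{D}}$ on $\bar\omega+\bar B_l(0)$. $\|f\|_m$ is the $\mathcal{C}^m$ norm (sup of all derivatives up to order $m$), $\|f\|_{0,\beta}$ the Hölder norm $\|f\|_0+\sup_{x\ne y}|f(x)-f(y)|/|x-y|^\beta$. $\mathrm{sym}\nabla w=\frac12(\nabla w+(\nabla w)^T)$, $\mathbb{R}^{2\times2}_{\mathrm{sym}}$ the symmetric $2\times2$ matrices. *)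

(* Defs.v *)
From Stdlib Require Import Reals Lra List.
From Coquelicot Require Import Coquelicot.
Open Scope R_scope.

Definition pt := (R * R)%type.
Definition dist2 (x y : pt) : R :=
  sqrt ((fst x - fst y) ^ 2 + (snd x - snd y) ^ 2).

Fixpoint fib (k : nat) : nat :=
  match k with
  | O => 1%nat
  | S k' => match k' with O => 1%nat | S k'' => (fib k'' + fib k')%nat end
  end.

Definition closure2 (U : pt -> Prop) (x : pt) : Prop :=
  forall eps, 0 < eps -> exists y, U y /\ dist2 x y < eps.
Definition interior2 (S : pt -> Prop) (x : pt) : Prop :=
  exists eps, 0 < eps /\ forall y, dist2 x y < eps -> S y.
Definition is_open2 (U : pt -> Prop) : Prop := forall x, U x -> interior2 U x.
Definition bounded2 (U : pt -> Prop) : Prop :=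
  exists B, forall x, U x -> Rabs (fst x) <= B /\ Rabs (snd x) <= B.
Definition connected2 (U : pt -> Prop) : Prop :=
  ~ exists V W : pt -> Prop,
      is_open2 V /\ is_open2 W /\
      (forall x, U x -> V x \/ W x) /\
      (exists x, U x /\ V x) /\ (exists x, U x /\ W x) /\
      (forall x, U x -> V x -> W x -> False).

Definition smooth1 (h : R -> R) : Prop := forall n s, ex_derive (Derive_n h n) s.

Definition rot (th : R) (z : pt) : pt :=
  (cos th * fst z + sin th * snd z, - sin th * fst z + cos th * snd z).

Definition smooth_boundary (U : pt -> Prop) : Prop :=
  forall p, closure2 U p -> ~ U p ->
    exists th r h, 0 < r /\ smooth1 h /\
      forall x, dist2 x p < r ->
        (U x <-> let z := rot th (fst x - fst p, snd x - snd p) in snd z < h (fst z)).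

Definition smooth_domain (U : pt -> Prop) : Prop :=
  is_open2 U /\ bounded2 U /\ connected2 U /\ smooth_boundary U.

Definition nbhd (U : pt -> Prop) (r : R) (x : pt) : Prop :=
  exists y, closure2 U y /\ dist2 x y <= r.

Definition pd (a : nat) (g : pt -> R) (x : pt) : R :=
  match a with
  | O => Derive (fun t => g (t, snd x)) (fst x)
  | _ => Derive (fun t => g (fst x, t)) (snd x)
  end.
Definition ex_pd (a : nat) (g : pt -> R) (x : pt) : Prop :=
  match a with
  | O => ex_derive (fun t => g (t, snd x)) (fst x)
  | _ => ex_derive (fun t => g (fst x, t)) (snd x)
  end.

Definition cont_on (S : pt -> Prop) (g : pt -> R) : Prop :=
  forall x, S x -> forall eps, 0 < eps -> exists del, 0 < del /\
    forall y, S y -> dist2 x y < del -> Rabs (g y - g x) < eps.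
Definition unif_cont_on (S : pt -> Prop) (g : pt -> R) : Prop :=
  forall eps, 0 < eps -> exists del, 0 < del /\
    forall x y, S x -> S y -> dist2 x y < del -> Rabs (g y - g x) < eps.

Fixpoint Ck_open (k : nat) (U : pt -> Prop) (g : pt -> R) : Prop :=
  cont_on U g /\
  match k with
  | O => True
  | S k' => forall a, (a < 2)%nat ->
      (forall x, U x -> ex_pd a g x) /\ Ck_open k' U (pd a g)
  end.

(** C^2 on a closed set S (= closure2 of its interior2, here): continuous on S,
    C^2 in the interior2, and all partial derivatives up to order 2 extend
    continuously to S (equivalently, for bounded2 S: are uniformly continuous
    on the interior2). *)
Definition C2_closed (S : pt -> Prop) (g : pt -> R) : Prop :=
  cont_on S g /\ Ck_open 2 (interior2 S) g /\
  unif_cont_on (interior2 S) g /\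
  (forall a, (a < 2)%nat -> unif_cont_on (interior2 S) (pd a g)) /\
  (forall a b, (a < 2)%nat -> (b < 2)%nat ->
     unif_cont_on (interior2 S) (pd b (pd a g))).

Definition holder_on (beta : R) (S : pt -> Prop) (g : pt -> R) : Prop :=
  exists H, forall x z, S x -> S z -> x <> z ->
    Rabs (g x - g z) / Rpower (dist2 x z) beta <= H.

Definition supn (S : pt -> Prop) (h : pt -> R) : R :=
  real (Lub_Rbar (fun y => exists x, S x /\ y = Rabs (h x))).
Definition holder_semi (beta : R) (S : pt -> Prop) (g : pt -> R) : R :=
  real (Lub_Rbar (fun y => exists x z, S x /\ S z /\ x <> z /\
          y = Rabs (g x - g z) / Rpower (dist2 x z) beta)).

Definition maxR (n : nat) (f : nat -> R) : R :=
  fold_right Rmax 0 (map f (seq 0 n)).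

(** Norms of vector-valued maps v with n components v 0, ..., v (n-1) on S.
    Derivatives (values of continuous extensions) are sup'ed over the interior2. *)
Definition norm0 (n : nat) (S : pt -> Prop) (v : nat -> pt -> R) : R :=
  maxR n (fun i => supn S (v i)).
Definition grad0 (n : nat) (S : pt -> Prop) (v : nat -> pt -> R) : R :=
  maxR n (fun i => maxR 2 (fun a => supn (interior2 S) (pd a (v i)))).
Definition hess0 (n : nat) (S : pt -> Prop) (v : nat -> pt -> R) : R :=
  maxR n (fun i => maxR 2 (fun a => maxR 2 (fun b =>
    supn (interior2 S) (pd b (pd a (v i)))))).
Definition norm1 (n : nat) (S : pt -> Prop) (v : nat -> pt -> R) : R :=
  Rmax (norm0 n S v) (grad0 n S v).
Definition norm2 (n : nat) (S : pt -> Prop) (v : nat -> pt -> R) : R :=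
  Rmax (norm1 n S v) (hess0 n S v).

Definition mnorm0 (S : pt -> Prop) (D : nat -> nat -> pt -> R) : R :=
  maxR 2 (fun a => maxR 2 (fun b => supn S (D a b))).
Definition mholder (beta : R) (S : pt -> Prop) (A : nat -> nat -> pt -> R) : R :=
  maxR 2 (fun a => maxR 2 (fun b => supn S (A a b) + holder_semi beta S (A a b))).

Definition defect (A : nat -> nat -> pt -> R) (v w : nat -> pt -> R)
  (a b : nat) (x : pt) : R :=
  A a b x -
  (/2 * (pd a (v 0%nat) x * pd b (v 0%nat) x + pd a (v 1%nat) x * pd b (v 1%nat) x
         + pd a (v 2%nat) x * pd b (v 2%nat) x)
   + /2 * (pd a (w b) x + pd b (w a) x)).

Definition Jexp (N K : nat) : R :=
  (INR (fib (K + 1)) - 2) + (INR (fib (K + 1)) - 1) * INR N / 2.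

Definition vdiff (f g : nat -> pt -> R) : nat -> pt -> R := fun i x => f i x - g i x.

(* Main.v *)
(** The metric [D] still missing from [A] is written as the sum of three primitive metrics
    [f_i n_i (x) n_i] with the constant covectors [n_i = (1,0), (0,1), (1,1)] (a large multiple of
    [sum_i n_i (x) n_i] is added to make the [f_i] positive; it is undone by a linear change of [w]),
    and the i-th one is realised by a corrugation of the i-th component of [v] only.  Since every
    codimension oscillates in a single direction [n_i], the second derivative of [v_i] along the kernel of
    [n_i] never meets the fast phase and stays bounded along the iteration.  In the error of the
    corrugation, [(a / Lam) sin(Lam x.n) Hess v_i], the part in [n_i (x) n_i] and [n_i (.) z_i] is absorbed into [w]
    by one or two integrations by parts, and the remaining part carries that harmless second
    derivative.  With frequencies growing by a factor [rho] per stage the deficit then drops by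
    [rho^2], while the Hessian of [v] stays at [rho^2 e / l], [e = |D|^(1/2) + l M].  Three stages with
    [rho^2 = (lam l)^J] reach [(lam l)^(-3J)], which beats the exponent [2 (F_K - 1) N]; no elliptic
    decomposition of [D] is used, hence no factor [lam^gam] is ever lost.

    To keep constants uniform, every estimate is made for functions depending on a parameter
    that ranges over all admissible data. *)
Require Import Defs.
From Stdlib Require Import Reals Lra Lia Psatz List Classical ClassicalEpsilon FunctionalExtensionality.
From Coquelicot Require Import Coquelicot.
Open Scope R_scope.

(** * Partial derivatives *)

(** What lets several stages share one Hessian bound is that a step turns the root [s] of the
    deficit into [s / rho] and the frequency [L] into [L * rho], so that [s * L * rho] is invariant:
    a further stage costs derivatives but no Hessian. In the basis adapted to its covector each
    component has second derivatives of the sizes [s L rho], [s L], [s L / rho], just those of a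
    wave made one step earlier, so the pattern reproduces itself. The given data must fit it too.
    The smallest entry asks for [M <= e L / rho], while only [M <= e / l] is known; hence the
    initial frequency is [rho / l] and not the mollification scale [1 / l], and the Hessian ends at
    [rho^2 e / l]. The error of a step contains second derivatives of amplitudes, so each stage uses
    up two orders of regularity, and three stages ending in [C^2] fix beforehand that ten
    derivatives suffice. A mollifier gaining finitely many derivatives is therefore enough, and
    iterated averages over segments need only one-dimensional integrals. Three is the number of
    stages because [2 F_(K+1) >= 3 F_K] gives [3 J >= 2 (F_K - 1) N]. *)

Definition line (a : nat) (x : pt) (t : R) : pt :=
  match a with O => (t, snd x) | _ => (fst x, t) end.
(** Every index other than 0 stands for the second coordinate, as in [pd]; most identities below can
    therefore be stated for all indices. *)
Definition coord (a : nat) (x : pt) : R := match a with O => fst x | _ => snd x end.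
Definition shift (a : nat) (s : R) (x : pt) : pt := line a x (coord a x + s).

Lemma line_coord a x : line a x (coord a x) = x.
Proof. destruct x, a; reflexivity. Qed.

Lemma pdE a g x : pd a g x = Derive (fun t => g (line a x t)) (coord a x).
Proof. destruct a; reflexivity. Qed.

Lemma ex_pdE a g x : ex_pd a g x = ex_derive (fun t => g (line a x t)) (coord a x).
Proof. destruct a; reflexivity. Qed.

(** A relation beside the total function [pd]: the value can stay an existential variable while the
    rules below assemble it along the expression, and existence of the derivative comes with it. *)
Definition is_pd (a : nat) (g : pt -> R) (x : pt) (d : R) : Prop :=
  is_derive (fun t => g (line a x t)) (coord a x) d.

Lemma is_pd_unique a g x d : is_pd a g x d -> pd a g x = d.
Proof. intros H; rewrite pdE; exact (is_derive_unique _ _ _ H). Qed.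

Lemma is_pd_ex a g x d : is_pd a g x d -> ex_pd a g x.
Proof. intros H; rewrite ex_pdE; exists d; exact H. Qed.

Lemma pd_correct a g x : ex_pd a g x -> is_pd a g x (pd a g x).
Proof. rewrite ex_pdE, pdE; intros H; apply Derive_correct, H. Qed.

Lemma is_pd_const a c x : is_pd a (fun _ => c) x 0.
Proof. exact (is_derive_const (K:=R_AbsRing) (V:=R_NormedModule) c (coord a x)). Qed.

Lemma is_pd_plus a f g x df dg :
  is_pd a f x df -> is_pd a g x dg -> is_pd a (fun y => f y + g y) x (df + dg).
Proof. intros; apply @is_derive_plus; assumption. Qed.

Lemma is_pd_minus a f g x df dg :
  is_pd a f x df -> is_pd a g x dg -> is_pd a (fun y => f y - g y) x (df - dg).
Proof. intros; apply @is_derive_minus; assumption. Qed.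

Lemma is_pd_opp a f x df : is_pd a f x df -> is_pd a (fun y => - f y) x (- df).
Proof. intros; apply @is_derive_opp; assumption. Qed.

Lemma is_pd_mult a f g x df dg :
  is_pd a f x df -> is_pd a g x dg ->
  is_pd a (fun y => f y * g y) x (df * g x + f x * dg).
Proof.
  intros Hf Hg; unfold is_pd in *.
  rewrite <- (line_coord a x) at 2 3.
  exact (is_derive_mult _ _ _ _ _ Hf Hg Rmult_comm).
Qed.

Lemma is_pd_comp a (F : R -> R) f x df dF :
  is_derive F (f x) dF -> is_pd a f x df -> is_pd a (fun y => F (f y)) x (dF * df).
Proof.
  intros HF Hf; unfold is_pd in *.
  rewrite Rmult_comm.
  apply (is_derive_comp F (fun t => f (line a x t))); [ rewrite line_coord; exact HF | exact Hf ].
Qed.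

Definition delta (a b : nat) : R :=
  match a, b with O, O => 1 | S _, S _ => 1 | _, _ => 0 end.

Lemma is_pd_coord a b x : is_pd a (coord b) x (delta a b).
Proof.
  unfold is_pd; destruct a, b; simpl; auto_derive; trivial; ring.
Qed.

(** * Neighbourhoods, Euclidean distance and continuity in the plane *)

Lemma locally_box (x : pt) (Q : pt -> Prop) :
  locally x Q <-> exists d, 0 < d /\
    forall y, Rabs (fst y - fst x) < d -> Rabs (snd y - snd x) < d -> Q y.
Proof.
  split.
  - intros [d Hd]; exists d; split; [ apply cond_pos | ].
    intros y H1 H2; apply Hd; split; assumption.
  - intros [d [Hd H]]; exists (mkposreal d Hd); intros y [H1 H2]; apply H; assumption.
Qed.

Lemma dist2_coord x y : Rabs (fst x - fst y) <= dist2 x y /\ Rabs (snd x - snd y) <= dist2 x y.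
Proof.
  unfold dist2; split.
  - rewrite <- sqrt_Rsqr_abs; apply sqrt_le_1_alt; unfold Rsqr.
    assert (T := pow2_ge_0 (snd x - snd y)); lra.
  - rewrite <- sqrt_Rsqr_abs; apply sqrt_le_1_alt; unfold Rsqr.
    assert (T := pow2_ge_0 (fst x - fst y)); lra.
Qed.

Lemma dist2_le_sum x y : dist2 x y <= Rabs (fst x - fst y) + Rabs (snd x - snd y).
Proof.
  unfold dist2.
  assert (H1 := Rabs_pos (fst x - fst y)); assert (H2 := Rabs_pos (snd x - snd y)).
  rewrite <- (sqrt_Rsqr (Rabs (fst x - fst y) + Rabs (snd x - snd y))) by lra.
  apply sqrt_le_1_alt; unfold Rsqr.
  rewrite <- (pow2_abs (fst x - fst y)), <- (pow2_abs (snd x - snd y)); nra.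
Qed.

Lemma dist2_sym x y : dist2 x y = dist2 y x.
Proof. unfold dist2; f_equal; ring. Qed.

Lemma dist2_triangle x y z : dist2 x z <= dist2 x y + dist2 y z.
Proof.
  destruct x as [x1 x2], y as [y1 y2], z as [z1 z2]; unfold dist2; simpl fst; simpl snd.
  set (a := x1 - y1); set (b := x2 - y2); set (c := y1 - z1); set (d := y2 - z2).
  replace (x1 - z1) with (a + c) by (unfold a, c; ring).
  replace (x2 - z2) with (b + d) by (unfold b, d; ring).
  assert (H1 := sqrt_pos (a ^ 2 + b ^ 2)); assert (H2 := sqrt_pos (c ^ 2 + d ^ 2)).
  apply Rsqr_incr_0_var; [ | lra ].
  assert (Hp : forall u v : R, 0 <= u ^ 2 + v ^ 2)
    by (intros u v; assert (T := pow2_ge_0 u); assert (T' := pow2_ge_0 v); lra).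
  rewrite Rsqr_plus, !Rsqr_sqrt by apply Hp.
  enough (a * c + b * d <= sqrt (a ^ 2 + b ^ 2) * sqrt (c ^ 2 + d ^ 2)) by nra.
  rewrite <- sqrt_mult by apply Hp.
  apply Rle_trans with (1 := Rle_abs _); rewrite <- sqrt_Rsqr_abs.
  apply sqrt_le_1_alt; unfold Rsqr.
  (* Lagrange's identity: the two radicands differ by this square, which is Cauchy-Schwarz. *)
  assert (T := pow2_ge_0 (a * d - b * c)); lra.
Qed.

Lemma locally_dist2 (x : pt) (Q : pt -> Prop) :
  locally x Q <-> exists d, 0 < d /\ forall y, dist2 y x < d -> Q y.
Proof.
  rewrite locally_box; split.
  - intros [d [Hd H]]; exists d; split; trivial; intros y Hy.
    destruct (dist2_coord y x); apply H; lra.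
  - intros [d [Hd H]]; exists (d / 2); split; [ lra | ]; intros y H1 H2.
    apply H; assert (T := dist2_le_sum y x); lra.
Qed.

Lemma open_locally U x : is_open2 U -> U x -> locally x U.
Proof.
  intros HU Hx; destruct (HU x Hx) as [d [Hd H]].
  apply locally_dist2; exists d; split; trivial; intros y Hy; apply H; rewrite dist2_sym; exact Hy.
Qed.

Lemma locally_line a x (Q : pt -> Prop) :
  locally x Q -> locally (coord a x) (fun t => Q (line a x t)).
Proof.
  rewrite locally_box; intros [d [Hd H]]; exists (mkposreal d Hd); intros t Ht.
  change (Rabs (t - coord a x) < d) in Ht.
  apply H; destruct a; simpl in *; try exact Ht; rewrite Rminus_diag, Rabs_R0; exact Hd.
Qed.

Lemma is_pd_ext_loc a f g x d :
  locally x (fun y => f y = g y) -> is_pd a f x d -> is_pd a g x d.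
Proof.
  intros H Hf; unfold is_pd in *; eapply is_derive_ext_loc; [ | exact Hf ].
  exact (locally_line a x _ H).
Qed.

Lemma continuous_eps (f : pt -> R) x :
  continuous f x <-> forall eps, 0 < eps -> locally x (fun y => Rabs (f y - f x) < eps).
Proof.
  split.
  - intros H eps He; apply (H (fun z => Rabs (z - f x) < eps)).
    exists (mkposreal eps He); intros z Hz; exact Hz.
  - intros H Q [eps HQ]; unfold filtermap.
    eapply filter_imp; [ | apply (H eps (cond_pos eps)) ].
    intros y Hy; apply HQ; exact Hy.
Qed.

Lemma cont_on_continuous U f :
  is_open2 U -> cont_on U f -> forall x, U x -> continuous f x.
Proof.
  intros HU H x Hx; apply continuous_eps; intros eps He.
  destruct (H x Hx eps He) as [d [Hd H']].
  assert (L : locally x (fun y => dist2 y x < d)).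
  { apply locally_dist2; exists d; split; trivial. }
  generalize (filter_and _ _ (open_locally U x HU Hx) L); apply filter_imp; intros y [Hy1 Hy2].
  apply H'; trivial; rewrite dist2_sym; exact Hy2.
Qed.

Lemma continuous_cont_on (U : pt -> Prop) f : (forall x, U x -> continuous f x) -> cont_on U f.
Proof.
  intros H x Hx eps He.
  destruct (proj1 (locally_dist2 _ _) (proj1 (continuous_eps f x) (H x Hx) eps He)) as [d [Hd H']].
  exists d; split; trivial; intros y _ Hy; apply H'; rewrite dist2_sym; exact Hy.
Qed.

Lemma continuous_pair {T : UniformSpace} (f g : T -> R) x :
  continuous f x -> continuous g x -> continuous (fun y => (f y, g y) : pt) x.
Proof.
  intros Hf Hg; apply (continuous_comp_2 f g (fun a b => (a, b) : pt)); trivial.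
  apply (continuous_ext (fun z : pt => z)); [ intros [u v]; reflexivity | apply continuous_id ].
Qed.

Lemma continuous_shift a s x : continuous (shift a s) x.
Proof.
  destruct a; unfold shift; simpl; apply continuous_pair; destruct x;
  try apply continuous_fst; try apply continuous_snd;
  apply @continuous_plus; try apply continuous_const;
  try apply continuous_fst; apply continuous_snd.
Qed.

(** * Symbol classes *)
(* On [U p] the derivatives of [f p] of order [j <= k] are [O (A p * L p ^ j)], uniformly in [p]:
   the index type [P] collects all data on which constants must not depend. *)
Fixpoint symb {P : Type} (U : P -> pt -> Prop) (k : nat) (f : P -> pt -> R) (A L : P -> R) : Prop :=
  (forall p x, U p x -> continuous (f p) x) /\
  (exists C, forall p x, U p x -> Rabs (f p x) <= C * A p) /\
  match k with
  | O => True
  | S k' => forall a,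
      (forall p x, U p x -> ex_pd a (f p) x) /\
      symb U k' (fun p => pd a (f p)) (fun p => A p * L p) L
  end.

Definition openf {P : Type} (U : P -> pt -> Prop) := forall p x, U p x -> locally x (U p).

Section Sym.
Context {P : Type} (U : P -> pt -> Prop) (HU : openf U).

Lemma symb_cont k f A L p x : symb U k f A L -> U p x -> continuous (f p) x.
Proof. destruct k; intros H; apply (proj1 H). Qed.

Lemma symb_bound k f A L : symb U k f A L -> exists C, 0 <= C /\ forall p x, U p x -> Rabs (f p x) <= C * Rabs (A p).
Proof.
  destruct k; intros [_ [[C H] _]]; exists (Rabs C); (split; [ apply Rabs_pos | ]); intros p x Hx;
  rewrite <- Rabs_mult; apply Rle_trans with (1 := H p x Hx), Rle_abs.
Qed.

Lemma symb_is_pd k f A L a p x : symb U (S k) f A L -> U p x -> is_pd a (f p) x (pd a (f p) x).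
Proof. intros H Hx; apply pd_correct, H; exact Hx. Qed.

Lemma symb_pd k f A L a : symb U (S k) f A L -> symb U k (fun p => pd a (f p)) (fun p => A p * L p) L.
Proof. intros H; apply H. Qed.

(** Derivatives see only nearby values, so agreement on the open sets [U p] transfers the whole
    class, whatever the functions do elsewhere. *)
Lemma symb_ext k : forall f g A L,
  (forall p x, U p x -> f p x = g p x) -> symb U k f A L -> symb U k g A L.
Proof.
  induction k as [ | k IH]; intros f g A L E [H1 [[C H2] H3]];
  assert (EL : forall p x, U p x -> locally x (fun y => f p y = g p y))
    by (intros p x Hx; generalize (HU p x Hx); apply filter_imp; intros y; apply E);
  assert (H1' : forall p x, U p x -> continuous (g p) x)
    by (intros p x Hx; eapply (continuous_ext_loc _ (f p)); [ | apply H1, Hx ];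
        generalize (EL p x Hx); apply filter_imp; intros; congruence).
  - split; [ exact H1' | split; trivial; exists C; intros p x Hx; rewrite <- E; auto ].
  - split; [ exact H1' | split; [ exists C; intros p x Hx; rewrite <- E; auto | ] ].
    assert (I : forall a p x, U p x -> is_pd a (g p) x (pd a (f p) x)).
    { intros a p x Hx; eapply is_pd_ext_loc; [ apply EL, Hx | ]; apply pd_correct, H3, Hx. }
    intros a; split.
    + intros p x Hx; eapply is_pd_ex, I, Hx.
    + apply (IH (fun p => pd a (f p))); [ | apply H3 ].
      intros p x Hx; symmetry; apply is_pd_unique, I, Hx.
Qed.

(** Lets the derivatives be given by formulas valid on [U], so that membership follows from closure
    properties of these formulas. *)
Lemma symb_intro k f A L (d : nat -> P -> pt -> R) :
  (forall p x, U p x -> continuous (f p) x) ->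
  (exists C, forall p x, U p x -> Rabs (f p x) <= C * A p) ->
  (forall a p x, U p x -> is_pd a (f p) x (d a p x)) ->
  (forall a, symb U k (d a) (fun p => A p * L p) L) ->
  symb U (S k) f A L.
Proof.
  intros H1 H2 H3 H4; split; [ exact H1 | split; [ exact H2 | ] ]; intros a; split.
  - intros p x Hx; eapply is_pd_ex, H3, Hx.
  - eapply symb_ext; [ | apply H4 ]; intros p x Hx; symmetry; apply is_pd_unique, H3, Hx.
Qed.

Lemma symb_S k : forall f A L, symb U (S k) f A L -> symb U k f A L.
Proof.
  induction k as [ | k IH]; intros f A L H.
  - destruct H as [H1 [H2 _]]; split; [ exact H1 | split; trivial ].
  - destruct H as [H1 [H2 H3]]; split; [ exact H1 | split; [ exact H2 | ] ].
    intros a; destruct (H3 a) as [H4 H5]; split; [ exact H4 | ]; apply IH, H5.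
Qed.

Lemma symb_le k k' f A L : (k' <= k)%nat -> symb U k f A L -> symb U k' f A L.
Proof. induction 1; trivial; intros H'; apply IHle, symb_S, H'. Qed.

(** Each derivative multiplies the constant by another [d], which is harmless because a class
    chooses its constants order by order. *)
Lemma symb_mono k : forall f A A' L L' c d,
  (forall p, 0 <= A p <= c * A' p) -> (forall p, 0 <= L p <= d * L' p) ->
  symb U k f A L -> symb U k f A' L'.
Proof.
  induction k as [ | k IH]; intros f A A' L L' c d HA HL [H1 [[C H2] H3]];
  (split; [ exact H1 | split ]);
  try (exists (Rabs C * c); intros p x Hx; apply Rle_trans with (1 := H2 p x Hx);
    destruct (HA p); assert (T := Rabs_pos C); assert (T' := Rle_abs C);
    apply Rle_trans with (Rabs C * A p); nra); trivial.
  intros a; split; [ apply H3 | ].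
  eapply (IH _ _ _ _ _ (c * d) d); [ | exact HL | apply H3 ].
  intros p; destruct (HA p), (HL p); split; [ apply Rmult_le_pos; trivial | ].
  replace (c * d * (A' p * L' p)) with ((c * A' p) * (d * L' p)) by ring.
  apply Rmult_le_compat; trivial.
Qed.

Lemma symb_plus k : forall f g A L,
  symb U k f A L -> symb U k g A L -> symb U k (fun p x => f p x + g p x) A L.
Proof.
  induction k as [ | k IH]; intros f g A L Hf Hg.
  - destruct Hf as [H1 [[C H2] _]], Hg as [K1 [[D K2] _]]; split; [ | split; trivial ].
    + intros p x Hx; apply @continuous_plus; auto.
    + exists (C + D); intros p x Hx; apply Rle_trans with (1 := Rabs_triang _ _).
      rewrite Rmult_plus_distr_r; apply Rplus_le_compat; auto.
  - apply (symb_intro _ _ _ _ (fun a p x => pd a (f p) x + pd a (g p) x)).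
    + intros p x Hx; apply @continuous_plus; eapply symb_cont; eauto.
    + destruct Hf as [_ [[C H2] _]], Hg as [_ [[D K2] _]].
      exists (C + D); intros p x Hx; apply Rle_trans with (1 := Rabs_triang _ _).
      rewrite Rmult_plus_distr_r; apply Rplus_le_compat; auto.
    + intros a p x Hx; apply is_pd_plus; eapply symb_is_pd; eauto.
    + intros a; apply IH; [ apply Hf | apply Hg ].
Qed.

Lemma symb_amp k f A A' L : (forall p, A p = A' p) -> symb U k f A L -> symb U k f A' L.
Proof. intros E; replace A' with A by (apply functional_extensionality, E); trivial. Qed.

(** Both terms of the Leibniz rule have amplitude [A B L], so amplitudes multiply and the frequency
    is kept. *)
Lemma symb_mult k : forall f g A B L,
  symb U k f A L -> symb U k g B L -> symb U k (fun p x => f p x * g p x) (fun p => A p * B p) L.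
Proof.
  assert (Hb : forall f g A B, (exists C, forall p x, U p x -> Rabs (f p x) <= C * A p) ->
    (exists C, forall p x, U p x -> Rabs (g p x) <= C * B p) ->
    exists C, forall p x, U p x -> Rabs (f p x * g p x) <= C * (A p * B p)).
  { intros f g A B [C H2] [D K2]; exists (C * D); intros p x Hx; rewrite Rabs_mult.
    replace (C * D * (A p * B p)) with ((C * A p) * (D * B p)) by ring.
    apply Rmult_le_compat; auto using Rabs_pos. }
  induction k as [ | k IH]; intros f g A B L Hf Hg.
  - split; [ | split; trivial ].
    + intros p x Hx; apply @continuous_mult; [ apply Hf | apply Hg ]; trivial.
    + apply Hb; [ apply Hf | apply Hg ].
  - apply (symb_intro _ _ _ _ (fun a p x => pd a (f p) x * g p x + f p x * pd a (g p) x)).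
    + intros p x Hx; apply @continuous_mult; eapply symb_cont; eauto.
    + apply Hb; [ apply Hf | apply Hg ].
    + intros a p x Hx; apply is_pd_mult; eapply symb_is_pd; eauto.
    + intros a; apply symb_plus; eapply symb_amp; try (apply IH).
      2: apply symb_pd, Hf. 2: apply symb_S, Hg. 3: apply symb_S, Hf. 3: apply symb_pd, Hg.
      all: intros p; simpl; ring.
Qed.

Lemma symb_const k (c : P -> R) A L :
  (forall p, 0 <= L p) -> (exists C, forall p, Rabs (c p) <= C * A p) ->
  symb U k (fun p _ => c p) A L.
Proof.
  intros HL; revert c A; induction k as [ | k IH]; intros c A [C HA].
  - split; [ intros; apply continuous_const | split; trivial; exists C; auto ].
  - apply (symb_intro _ _ _ _ (fun _ _ _ => 0)).
    + intros; apply continuous_const.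
    + exists C; auto.
    + intros; apply is_pd_const.
    + intros a; apply (IH (fun _ => 0)); exists C; intros p; rewrite Rabs_R0.
      rewrite <- Rmult_assoc; apply Rmult_le_pos; trivial.
      apply Rle_trans with (2 := HA p), Rabs_pos.
Qed.

Lemma symb_scal k (c : P -> R) f A B L :
  (forall p, 0 <= L p) -> (exists C, forall p, Rabs (c p) <= C * B p) ->
  symb U k f A L -> symb U k (fun p x => c p * f p x) (fun p => B p * A p) L.
Proof. intros HL Hc Hf; apply symb_mult; [ apply symb_const; trivial | exact Hf ]. Qed.

Lemma symb_scalR k (c : R) f A L :
  (forall p, 0 <= L p) ->
  symb U k f A L -> symb U k (fun p x => c * f p x) A L.
Proof.
  intros HL Hf; eapply symb_amp; [ | apply (symb_scal k (fun _ => c) f A (fun _ => 1) L); trivial ].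
  - intros p; simpl; ring.
  - exists (Rabs c); intros; lra.
Qed.

Lemma symb_opp k f A L : (forall p, 0 <= L p) -> symb U k f A L -> symb U k (fun p x => - f p x) A L.
Proof.
  intros HL Hf; apply (symb_ext k (fun p x => (-1) * f p x)); [ intros; ring | apply symb_scalR; trivial ].
Qed.

Lemma symb_minus k f g A L : (forall p, 0 <= L p) ->
  symb U k f A L -> symb U k g A L -> symb U k (fun p x => f p x - g p x) A L.
Proof. intros HL Hf Hg; apply symb_plus, symb_opp; trivial. Qed.

(** * Phase functions and square roots as symbols *)

Definition dot (u w : pt) : R := fst u * fst w + snd u * snd w.

Lemma is_pd_linear a (n : pt) c x :
  is_pd a (fun y => c * dot n y) x (c * coord a n).
Proof. unfold is_pd, dot; destruct a; simpl; auto_derive; trivial; ring. Qed.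

Lemma continuous_linear (n : pt) c (x : pt) :
  continuous (fun y : pt => c * dot n y) x.
Proof.
  destruct x as [u v]; unfold dot.
  apply @continuous_scal; [ apply continuous_const | ].
  apply @continuous_plus; apply @continuous_scal; try apply continuous_const;
    [ apply continuous_fst | apply continuous_snd ].
Qed.

Lemma is_pd_sin a (n : pt) c x :
  is_pd a (fun y => sin (c * dot n y)) x
    (cos (c * dot n x) * (c * coord a n)).
Proof. apply (is_pd_comp a sin); [ apply is_derive_sin | apply is_pd_linear ]. Qed.

Lemma is_pd_cos a (n : pt) c x :
  is_pd a (fun y => cos (c * dot n y)) x
    (- sin (c * dot n x) * (c * coord a n)).
Proof. apply (is_pd_comp a cos); [ apply is_derive_cos | apply is_pd_linear ]. Qed.

(** Sine and cosine go through one induction because each is, up to sign and the factor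
    [L p * coord a n], the derivative of the other. *)
Lemma symb_trig k (n : pt) (L : P -> R) : (forall p, 0 <= L p) ->
  symb U k (fun p x => sin (L p * dot n x)) (fun _ => 1) L /\
  symb U k (fun p x => cos (L p * dot n x)) (fun _ => 1) L.
Proof.
  intros HL.
  assert (B1 : forall t, Rabs (sin t) <= 1 * 1) by (intros t; apply Rabs_le; assert (T := SIN_bound t); lra).
  assert (B2 : forall t, Rabs (cos t) <= 1 * 1) by (intros t; apply Rabs_le; assert (T := COS_bound t); lra).
  assert (C1 : forall p x, continuous (fun x : pt => sin (L p * dot n x)) x).
  { intros p x; apply (continuous_comp _ sin); [ apply continuous_linear | apply continuous_sin ]. }
  assert (C2 : forall p x, continuous (fun x : pt => cos (L p * dot n x)) x).
  { intros p x; apply (continuous_comp _ cos); [ apply continuous_linear | apply continuous_cos ]. }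
  assert (CL : forall k a, symb U k (fun p _ => L p * coord a n) L L).
  { intros j a; apply symb_const; trivial; exists (Rabs (coord a n)); intros p.
    rewrite Rabs_mult, (Rabs_pos_eq (L p)) by trivial; lra. }
  induction k as [ | k [IH1 IH2]].
  - split; (split; [ auto | split; trivial; exists 1; auto ]).
  - split.
    + apply (symb_intro _ _ _ _ (fun a p x => cos (L p * dot n x) * (L p * coord a n))); auto.
      * exists 1; auto.
      * intros a p x _; apply is_pd_sin.
      * intros a; apply symb_mult; trivial.
    + apply (symb_intro _ _ _ _ (fun a p x => (- sin (L p * dot n x)) * (L p * coord a n))); auto.
      * exists 1; auto.
      * intros a p x _; apply is_pd_cos.
      * intros a; apply symb_mult; [ apply symb_opp; trivial | trivial ].
Qed.

Lemma symb_wk k f A A' L L' c :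
  (forall p, 0 <= A p) -> (forall p, A p <= c * A' p) -> (forall p, 0 <= L p <= L' p) ->
  symb U k f A L -> symb U k f A' L'.
Proof.
  intros H1 H2 H3; apply symb_mono with (c := c) (d := 1).
  - intros p; split; auto.
  - intros p; destruct (H3 p); lra.
Qed.

(** The reciprocal root comes first: its derivative is [- 1/2] times its own cube times the
    derivative of [f], so the induction closes on itself. The root is then [f] times the reciprocal
    root. The lower bound [s^2 <= f] is what gives the reciprocal the amplitude [/ s]. *)
Lemma symb_sqrt k f (s L : P -> R) :
  (forall p, 0 <= L p) -> (forall p, 0 < s p) -> (forall p x, U p x -> s p ^ 2 <= f p x) ->
  symb U k f (fun p => s p ^ 2) L ->
  symb U k (fun p x => sqrt (f p x)) s L.
Proof.
  intros HL Hs Hf Sf.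
  assert (Q : forall p x, U p x -> s p <= sqrt (f p x)).
  { intros p x Hx; rewrite <- (sqrt_pow2 (s p)) by (left; apply Hs); apply sqrt_le_1_alt, Hf, Hx. }
  assert (F : forall p x, U p x -> 0 < f p x).
  { intros p x Hx; apply Rlt_le_trans with (2 := Hf p x Hx), pow_lt, Hs. }
  assert (I : symb U k (fun p x => / sqrt (f p x)) (fun p => / s p) L).
  { assert (B : exists C, forall p x, U p x -> Rabs (/ sqrt (f p x)) <= C * / s p).
    { exists 1; intros p x Hx; rewrite Rmult_1_l, Rabs_pos_eq.
      - apply Rinv_le_contravar; auto.
      - left; apply Rinv_0_lt_compat, sqrt_lt_R0; auto. }
    assert (D : forall p x, U p x -> is_derive (fun t => / sqrt t) (f p x) (- / 2 * (/ sqrt (f p x) * / sqrt (f p x) * / sqrt (f p x)))).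
    { intros p x Hx; assert (T := F p x Hx); assert (T' := sqrt_lt_R0 _ T); auto_derive.
      - split; trivial; split; trivial; lra.
      - field; lra. }
    assert (Cc : forall p x, U p x -> continuous (fun x => / sqrt (f p x)) x).
    { intros p x Hx; apply (continuous_comp (f p) (fun t => / sqrt t)).
      - eapply symb_cont; eauto.
      - apply @ex_derive_continuous; eexists; apply D, Hx. }
    induction k as [ | k IH].
    - split; [ exact Cc | split; trivial ].
    - apply (symb_intro _ _ _ _ (fun a p x => (- / 2 * (/ sqrt (f p x) * / sqrt (f p x) * / sqrt (f p x))) * pd a (f p) x)); trivial.
      + intros a p x Hx; apply (is_pd_comp a (fun t => / sqrt t)); [ apply D, Hx | ].
        eapply symb_is_pd; eauto.
      + intros a.
        assert (S1 := IH (symb_S _ _ _ _ Sf)).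
        assert (S2 := symb_mult _ _ _ _ _ _ (symb_mult _ _ _ _ _ _ S1 S1) S1).
        assert (S3 := symb_mult _ _ _ _ _ _ (symb_scalR _ (- / 2) _ _ _ HL S2) (symb_pd _ _ _ _ a Sf)).
        eapply symb_amp; [ | exact S3 ]; intros p; simpl; assert (T := Hs p); field; lra. }
  apply (symb_ext k (fun p x => f p x * / sqrt (f p x))).
  - intros p x Hx; assert (T := F p x Hx); assert (T' := sqrt_lt_R0 _ T).
    rewrite <- (sqrt_sqrt (f p x)) at 1 by lra; field; lra.
  - eapply symb_amp; [ | apply (symb_mult _ _ _ _ _ _ Sf I) ].
    intros p; simpl; assert (T := Hs p); field; lra.
Qed.
End Sym.

(* Localisation: uniform estimates near every point, with the centre added to the parameters. *)
Lemma symb_local {P : Type} (U : P -> pt -> Prop) (W : {p : P & {x : pt | U p x}} -> pt -> Prop) k :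
  (forall q, W q (proj1_sig (projT2 q))) -> openf W ->
  forall (f : P -> pt -> R) A L,
  symb W k (fun q => f (projT1 q)) (fun q => A (projT1 q)) (fun q => L (projT1 q)) -> symb U k f A L.
Proof.
  intros HW OW.
  assert (At : forall (Q : P -> pt -> Prop), (forall q x, W q x -> Q (projT1 q) x) -> forall p x, U p x -> Q p x).
  { intros Q HQ p x Hx; exact (HQ (existT _ p (exist _ x Hx)) x (HW (existT _ p (exist _ x Hx)))). }
  induction k as [ | k IH]; intros f A L [H1 [[C H2] H3]].
  - split; [ | split; trivial; exists C ].
    + exact (At _ H1).
    + exact (At (fun p x => Rabs (f p x) <= C * A p) H2).
  - split; [ | split; [ exists C | ] ].
    + exact (At _ H1).
    + exact (At (fun p x => Rabs (f p x) <= C * A p) H2).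
    + intros a; split.
      * exact (At (fun p x => ex_pd a (f p) x) (proj1 (H3 a))).
      * apply (IH (fun p => pd a (f p)) (fun p => A p * L p) L), H3.
Qed.

Lemma symb_Ck_open {P : Type} (U : P -> pt -> Prop) k : openf U ->
  forall f A L, symb U k f A L -> forall p, Ck_open k (U p) (f p).
Proof.
  intros HU; induction k as [ | k IH]; intros f A L H p.
  - split; trivial; apply continuous_cont_on; apply H.
  - split; [ apply continuous_cont_on; intros x Hx; eapply symb_cont; eauto | ].
    intros a _; split.
    + intros x Hx; apply H; exact Hx.
    + apply (IH (fun p => pd a (f p)) _ _ (symb_pd _ _ _ _ _ a H)).
Qed.

(** * Mollification by iterated box averages *)
Definition avg (a : nat) (h : R) (f : pt -> R) (x : pt) : R :=
  / h * RInt (fun s => f (shift a s x)) 0 h.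

(** Compactness of the segment: radii that work locally, for a property stable under shrinking the
    radius, have a common positive lower bound that works throughout. *)
Lemma segment_uniform h (Q : R -> R -> Prop) :
  (forall d d' s, 0 < d' <= d -> Q d s -> Q d' s) ->
  (forall s, 0 <= s <= h -> exists d, 0 < d /\ forall s', 0 <= s' <= h -> Rabs (s' - s) < d -> Q d s') ->
  exists d, 0 < d /\ forall s, 0 <= s <= h -> Q d s.
Proof.
  intros Hm HQ.
  assert (HQ' : forall s, exists d : posreal, 0 <= s <= h -> forall s', 0 <= s' <= h -> Rabs (s' - s) < d -> Q d s').
  { intros s; destruct (classic (0 <= s <= h)) as [Hs | Hs].
    - destruct (HQ s Hs) as [d [Hd H]]; exists (mkposreal d Hd); intros _; exact H.
    (* The compactness lemma asks for a radius at every real number; off the segment a dummy value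
       is supplied. *)
    - exists (mkposreal 1 Rlt_0_1); intros; contradiction. }
  set (dl := fun s => proj1_sig (constructive_indefinite_description _ (HQ' s))).
  assert (Hdl : forall s, 0 <= s <= h -> forall s', 0 <= s' <= h -> Rabs (s' - s) < dl s -> Q (dl s) s')
    by (intros s; exact (proj2_sig (constructive_indefinite_description _ (HQ' s)))).
  destruct (compactness_value_1d 0 h dl) as [d Hd].
  exists d; split; [ apply cond_pos | ]; intros s Hs.
  destruct (NNPP _ (Hd s Hs)) as [t [Ht [H1 H2]]].
  apply Hm with (dl t); [ split; [ apply cond_pos | exact H2 ] | apply Hdl; trivial ].
Qed.

Lemma shift_box a s s' d x y :
  Rabs (fst y - fst x) < d -> Rabs (snd y - snd x) < d -> Rabs (s' - s) < d ->
  Rabs (fst (shift a s' y) - fst (shift a s x)) < 2 * d /\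
  Rabs (snd (shift a s' y) - snd (shift a s x)) < 2 * d.
Proof.
  intros H1 H2 H3; unfold Rabs in *.
  destruct a; unfold shift; simpl; repeat destruct Rcase_abs; lra.
Qed.

Lemma shift_line_eq a s x t : shift a s (line a x t) = line a x (t + s).
Proof. destruct a; reflexivity. Qed.

Lemma is_pd_shift a s b f x d :
  is_pd b f (shift a s x) d -> is_pd b (fun y => f (shift a s y)) x d.
Proof.
  intros H; unfold is_pd in *.
  assert (T : forall (g : R -> R) t, is_derive g (t + s) d -> is_derive (fun z => g (z + s)) t d).
  { intros g t Hg; replace d with (scal 1 d) by (unfold scal; simpl; unfold mult; simpl; ring).
    apply (is_derive_comp g (fun z => z + s)); trivial; auto_derive; trivial. }
  destruct a, b; try exact H; [ exact (T (fun t => f (t, snd x)) _ H) | exact (T (fun t => f (fst x, t)) _ H) ].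
Qed.

Section Avg.
Context (V W : pt -> Prop) (a : nat) (h : R).
Context (Hh : 0 < h) (HV : forall x, V x -> locally x V) (HW : forall x, W x -> locally x W).
Context (HVW : forall x s, W x -> 0 <= s <= h -> V (shift a s x)).

Lemma continuous_line b x t (f : pt -> R) :
  continuous f (line b x t) -> continuous (fun t => f (line b x t)) t.
Proof.
  intros H; apply (continuous_comp (line b x) f); trivial.
  destruct b; apply continuous_pair; try apply continuous_const; apply continuous_id.
Qed.

Lemma avg_ex_RInt f x : (forall y, V y -> continuous f y) -> W x ->
  ex_RInt (fun s => f (shift a s x) : R) 0 h.
Proof.
  intros Hf Hx; apply @ex_RInt_continuous; intros s Hs.
  rewrite Rmin_left, Rmax_right in Hs by lra.
  apply (continuous_comp (fun s => coord a x + s) (fun t => f (line a x t))).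
  - apply @continuous_plus; [ apply continuous_const | apply continuous_id ].
  - apply continuous_line, Hf, HVW; trivial.
Qed.

Lemma avg_ext f g x : (forall y, V y -> f y = g y) -> W x -> avg a h f x = avg a h g x.
Proof.
  intros E Hx; unfold avg; f_equal; apply RInt_ext; intros s Hs.
  rewrite Rmin_left, Rmax_right in Hs by lra; apply E, HVW; trivial; lra.
Qed.

Lemma avg_const c x : avg a h (fun _ => c) x = c.
Proof. unfold avg; rewrite RInt_const; unfold scal; simpl; unfold mult; simpl; field; lra. Qed.

Lemma avg_plus f g x : (forall y, V y -> continuous f y) -> (forall y, V y -> continuous g y) -> W x ->
  avg a h (fun y => f y + g y) x = avg a h f x + avg a h g x.
Proof.
  intros Hf Hg Hx; unfold avg; rewrite <- Rmult_plus_distr_l; f_equal.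
  apply (RInt_plus (fun s => f (shift a s x)) (fun s => g (shift a s x))); apply avg_ex_RInt; trivial.
Qed.

Lemma avg_scal c f x : (forall y, V y -> continuous f y) -> W x ->
  avg a h (fun y => c * f y) x = c * avg a h f x.
Proof.
  intros Hf Hx; unfold avg.
  assert (E : RInt (fun s => c * f (shift a s x)) 0 h = c * RInt (fun s => f (shift a s x)) 0 h)
    by (apply (RInt_scal (fun s => f (shift a s x))); apply avg_ex_RInt; trivial).
  rewrite E; ring.
Qed.

Lemma avg_bound f x c B : (forall y, V y -> continuous f y) -> W x ->
  (forall s, 0 <= s <= h -> Rabs (f (shift a s x) - c) <= B) -> Rabs (avg a h f x - c) <= B.
Proof.
  intros Hf Hx HB.
  assert (E : avg a h (fun y => f y - c) x = avg a h f x - c).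
  { unfold Rminus; rewrite avg_plus, avg_const; trivial; intros; apply continuous_const. }
  rewrite <- E; unfold avg; rewrite Rabs_mult, Rabs_pos_eq by (left; apply Rinv_0_lt_compat, Hh).
  apply Rmult_le_reg_l with h; trivial; rewrite <- Rmult_assoc, Rinv_r, Rmult_1_l by lra.
  replace h with (h - 0) at 2 by ring.
  apply abs_RInt_le_const; [ lra | | exact HB ].
  apply (avg_ex_RInt (fun y => f y - c)); trivial.
  intros y Hy; apply @continuous_minus; [ apply Hf, Hy | apply continuous_const ].
Qed.

Lemma avg_continuous f x : (forall y, V y -> continuous f y) -> W x -> continuous (avg a h f) x.
Proof.
  intros Hf Hx; apply continuous_eps; intros eps He.
  destruct (segment_uniform h (fun d s => forall y, Rabs (fst y - fst x) < d -> Rabs (snd y - snd x) < d ->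
    Rabs (f (shift a s y) - f (shift a s x)) <= eps / 2)) as [d [Hd H]].
  { intros d d' s Hd H y H1 H2; apply H; lra. }
  { intros s Hs.
    (* A quarter of [eps], because [f (shift a s' y)] and [f (shift a s' x)] are both compared with
       [f (shift a s x)]. *)
    destruct (proj1 (locally_box _ _) (proj1 (continuous_eps f _) (Hf _ (HVW x s Hx Hs)) (eps / 4) ltac:(lra)))
      as [d [Hd H]].
    exists (d / 2); split; [ lra | ]; intros s' Hs' Hss y H1 H2.
    assert (Hxx : Rabs (fst x - fst x) < d / 2 /\ Rabs (snd x - snd x) < d / 2)
      by (rewrite !Rminus_diag, Rabs_R0; lra).
    destruct (shift_box a s s' (d / 2) x y) as [T1 T2]; trivial.
    destruct (shift_box a s s' (d / 2) x x) as [T3 T4]; try apply Hxx; trivial.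
    assert (U1 := H (shift a s' y) ltac:(lra) ltac:(lra)).
    assert (U2 := H (shift a s' x) ltac:(lra) ltac:(lra)).
    apply Rabs_def2 in U1; apply Rabs_def2 in U2; apply Rabs_le; lra. }
  assert (L : locally x (fun y => Rabs (fst y - fst x) < d /\ Rabs (snd y - snd x) < d))
    by (apply locally_box; exists d; auto).
  generalize (filter_and _ _ (HW x Hx) L); apply filter_imp; intros y [Hy [H1 H2]].
  apply Rle_lt_trans with (eps / 2); [ | lra ].
  assert (E : avg a h f y - avg a h f x = / h * RInt (fun s => f (shift a s y) - f (shift a s x)) 0 h).
  { unfold avg; rewrite <- Rmult_minus_distr_l; f_equal; symmetry.
    apply (RInt_minus (fun s => f (shift a s y)) (fun s => f (shift a s x))); apply avg_ex_RInt; trivial. }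
  rewrite E, Rabs_mult, Rabs_pos_eq by (left; apply Rinv_0_lt_compat, Hh).
  apply Rmult_le_reg_l with h; trivial; rewrite <- Rmult_assoc, Rinv_r, Rmult_1_l by lra.
  replace h with (h - 0) at 2 by ring.
  apply abs_RInt_le_const; [ lra | | intros s Hs; apply H; trivial ].
  apply @ex_RInt_minus; apply avg_ex_RInt; trivial.
Qed.

Lemma avg_is_pd b f x :
  (forall y, V y -> continuous f y) -> (forall y, V y -> ex_pd b f y) ->
  (forall y, V y -> continuous (pd b f) y) -> W x ->
  is_pd b (avg a h f) x (avg a h (pd b f) x).
Proof.
  intros Hf Hd Hc Hx; unfold is_pd, avg.
  assert (DD : forall s u, V (shift a s (line b x u)) ->
     is_derive (fun z => f (shift a s (line b x z))) u (pd b f (shift a s (line b x u)))).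
  { intros s u Hu; assert (T := is_pd_shift a s b f (line b x u) _ (pd_correct _ _ _ (Hd _ Hu))).
    destruct b; exact T. }
  apply @is_derive_scal.
  assert (EQ : RInt (fun s => pd b f (shift a s x)) 0 h =
     RInt (fun s => Derive (fun z => f (shift a s (line b x z))) (coord b x)) 0 h).
  { apply RInt_ext; intros s Hs; rewrite Rmin_left, Rmax_right in Hs by lra.
    symmetry; apply is_derive_unique.
    replace (pd b f (shift a s x)) with (pd b f (shift a s (line b x (coord b x)))) by (rewrite line_coord; trivial).
    apply DD; rewrite line_coord; apply HVW; trivial; lra. }
  rewrite EQ.
  assert (LW := locally_line b x W (HW x Hx)).
  apply (is_derive_RInt_param (fun z s => f (shift a s (line b x z)))).
  - revert LW; apply filter_imp; intros u Hu s Hs; rewrite Rmin_left, Rmax_right in Hs by lra.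
    eexists; apply DD, HVW; trivial.
  - intros s Hs; rewrite Rmin_left, Rmax_right in Hs by lra.
    assert (Vx : V (shift a s (line b x (coord b x)))) by (rewrite line_coord; apply HVW; trivial).
    (* The derivative of the integrand is known to equal [pd b f] only where the shifted point lies
       in [V]; continuity is proved for [pd b f] and transferred locally. *)
    apply continuity_2d_pt_ext_loc with (fun u s => pd b f (shift a s (line b x u))).
    + destruct (proj1 (locally_box _ _) (HV _ Vx)) as [d [Hd0 H]].
      assert (Hd2 : 0 < d / 2) by lra.
      exists (mkposreal _ Hd2); simpl; intros u s' Hu Hs'.
      symmetry; apply is_derive_unique, DD, H;
        destruct (shift_box a s s' (d / 2) (line b x (coord b x)) (line b x u)) as [T1 T2]; trivial; try lra;
        destruct b; simpl; trivial; rewrite Rminus_diag, Rabs_R0; lra.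
    + intros eps.
      destruct (proj1 (locally_box _ _) (proj1 (continuous_eps _ _) (Hc _ Vx) eps (cond_pos eps))) as [d [Hd0 H]].
      assert (Hd2 : 0 < d / 2) by lra.
      exists (mkposreal _ Hd2); simpl; intros u s' Hu Hs'; apply H;
        destruct (shift_box a s s' (d / 2) (line b x (coord b x)) (line b x u)) as [T1 T2]; trivial; try lra;
        destruct b; simpl; trivial; rewrite Rminus_diag, Rabs_R0; lra.
  - revert LW; apply filter_imp; intros u Hu; apply avg_ex_RInt; trivial.
Qed.

(** Along its own direction the average is a moving integral, so the fundamental theorem gives a
    difference quotient for [f] merely continuous. This is the source of all smoothing. *)
Lemma avg_is_pd_same f x :
  (forall y, V y -> continuous f y) -> W x ->
  is_pd a (avg a h f) x (/ h * (f (shift a h x) - f x)).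
Proof.
  intros Hf Hx; unfold is_pd.
  set (g := fun t => f (line a x t)); set (c := coord a x).
  assert (Vs : forall s, 0 <= s <= h -> V (line a x (c + s))) by (intros s Hs; apply (HVW x s Hx Hs)).
  assert (G : forall s, 0 <= s <= h -> locally (c + s) (fun t => continuous g t)).
  { intros s Hs; assert (T := locally_line a _ _ (HV _ (Vs s Hs))).
    replace (coord a (line a x (c + s))) with (c + s) in T by (destruct a; reflexivity).
    revert T; apply filter_imp; intros t Ht; apply continuous_line, Hf.
    revert Ht; destruct a; trivial. }
  destruct (G 0 ltac:(lra)) as [e1 G1]; destruct (G h ltac:(lra)) as [e2 G2].
  (* The window [[t, t + h]] leaves [[c, c + h]] as [t] moves, so continuity is needed slightly
     beyond both ends; openness of [V] provides the margin [e]. *)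
  set (e := Rmin e1 e2).
  assert (He : 0 < e) by (apply Rmin_glb_lt; apply cond_pos).
  assert (GG : forall t, c - e < t < c + h + e -> continuous g t).
  { intros t Ht; assert (M1 := Rmin_l e1 e2); assert (M2 := Rmin_r e1 e2); fold e in M1, M2.
    destruct (Rlt_le_dec t c) as [H | H]; [ | destruct (Rlt_le_dec (c + h) t) as [H' | H'] ].
    - apply G1; change (Rabs (t - (c + 0)) < e1); apply Rabs_def1; lra.
    - apply G2; change (Rabs (t - (c + h)) < e2); apply Rabs_def1; lra.
    - replace t with (c + (t - c)) by ring.
      apply (locally_singleton _ _ (G (t - c) ltac:(lra))). }
  assert (EX : forall u v, c - e < u < c + h + e -> c - e < v < c + h + e -> ex_RInt g u v).
  { intros u v Hu Hv; apply @ex_RInt_continuous; intros z Hz; apply GG; split.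
    - apply Rlt_le_trans with (2 := proj1 Hz), Rmin_glb_lt; lra.
    - apply Rle_lt_trans with (1 := proj2 Hz), Rmax_lub_lt; lra. }
  apply (is_derive_ext_loc (fun t => / h * RInt g t (t + h))).
  { exists (mkposreal e He); intros t Ht; change (Rabs (t - c) < e) in Ht; apply Rabs_def2 in Ht.
    unfold avg; f_equal.
    assert (E := RInt_comp_lin g 1 t 0 h).
    rewrite !Rmult_1_l, Rplus_0_l, (Rplus_comm h t) in E.
    rewrite <- E by (apply EX; lra); apply RInt_ext; intros s _.
    rewrite shift_line_eq; unfold g, scal; simpl; unfold mult; simpl.
    rewrite !Rmult_1_l, Rplus_comm; reflexivity. }
  apply @is_derive_scal.
  evar (D : R); replace (f (shift a h x) - f x) with D; unfold D.
  - apply (is_derive_RInt_bound_comp g (fun u v => RInt g u v) (fun t => t) (fun t => t + h) 1 1 c).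
    + exists (mkposreal e He); intros [u v] [Hu Hv].
      change (Rabs (u - c) < e) in Hu; change (Rabs (v - (c + h)) < e) in Hv.
      apply Rabs_def2 in Hu; apply Rabs_def2 in Hv; simpl.
      apply (@RInt_correct R_CompleteNormedModule), EX; lra.
    + apply GG; lra.
    + apply GG; lra.
    + apply (is_derive_id (K := R_AbsRing)).
    + auto_derive; trivial.
  - unfold minus, plus, opp, scal; simpl; unfold mult; simpl; unfold g, shift; fold c.
    unfold c at 2; rewrite line_coord; ring.
Qed.
End Avg.

Fixpoint mol (n : nat) (h : R) (f : pt -> R) : pt -> R :=
  match n with O => f | S n' => avg 0 h (avg 1 h (mol n' h f)) end.

(** Counts the single averages inside [mol n]. The recursion makes [dbl (S n)] compute to two
    successors, one for each of the two averages added. *)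
Fixpoint dbl (n : nat) : nat := match n with O => O | S n' => S (S (dbl n')) end.

(** An average looks up to [h] ahead, so it is controlled on a smaller set only: [V i] is the domain
    left after [i] averages, and it shrinks as [i] grows. *)
Definition chain (h : R) (V : nat -> pt -> Prop) : Prop :=
  0 < h /\ (forall i x, V i x -> locally x (V i)) /\
  (forall i a x s, V (S i) x -> 0 <= s <= h -> V i (shift a s x)).

Lemma shift0 a x : shift a 0 x = x.
Proof. unfold shift; rewrite Rplus_0_r; apply line_coord. Qed.

Section Mol.
Context (h : R) (V : nat -> pt -> Prop) (HC : chain h V).

Lemma chain_incl i x : V (S i) x -> V i x.
Proof.
  destruct HC as [Hh [_ H]]; intros Hx; rewrite <- (shift0 0 x); apply H; trivial; lra.
Qed.

Lemma avg2_cont i g : (forall x, V i x -> continuous g x) ->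
  (forall x, V (S i) x -> continuous (avg 1 h g) x) /\
  (forall x, V (S (S i)) x -> continuous (avg 0 h (avg 1 h g)) x).
Proof.
  destruct HC as [Hh [HO HS]]; intros Hg.
  assert (H1 : forall x, V (S i) x -> continuous (avg 1 h g) x)
    by (intros x Hx; apply (avg_continuous (V i) (V (S i))); auto).
  split; trivial; intros x Hx; apply (avg_continuous (V (S i)) (V (S (S i)))); auto.
Qed.

Lemma mol_continuous n f : (forall y, V 0%nat y -> continuous f y) ->
  forall x, V (dbl n) x -> continuous (mol n h f) x.
Proof.
  intros Hf; induction n as [ | n IH]; simpl; trivial; apply avg2_cont, IH.
Qed.

Lemma mol_ext n f g : (forall y, V 0%nat y -> f y = g y) ->
  forall x, V (dbl n) x -> mol n h f x = mol n h g x.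
Proof.
  destruct HC as [Hh [HO HS]]; intros Hf; induction n as [ | n IH]; simpl; trivial.
  intros x Hx; apply (avg_ext (V (S (dbl n))) (V (S (S (dbl n))))); auto.
  intros y Hy; apply (avg_ext (V (dbl n)) (V (S (dbl n)))); auto.
Qed.

Lemma mol_const n c x : mol n h (fun _ => c) x = c.
Proof.
  destruct HC as [Hh _]; revert x; induction n as [ | n IH]; simpl; trivial; intros x.
  replace (mol n h (fun _ => c)) with (fun _ : pt => c) by (apply functional_extensionality; auto).
  replace (avg 1 h (fun _ => c)) with (fun _ : pt => c)
    by (apply functional_extensionality; intros; rewrite avg_const; trivial).
  apply avg_const; trivial.
Qed.

Lemma mol_plus n f g : (forall y, V 0%nat y -> continuous f y) -> (forall y, V 0%nat y -> continuous g y) ->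
  forall x, V (dbl n) x -> mol n h (fun y => f y + g y) x = mol n h f x + mol n h g x.
Proof.
  intros Hf Hg; assert (HC' := HC); destruct HC' as [Hh [HO HS]].
  induction n as [ | n IH]; simpl; trivial; intros x Hx.
  assert (Cf := mol_continuous n f Hf); assert (Cg := mol_continuous n g Hg).
  rewrite <- (avg_plus (V (S (dbl n))) (V (S (S (dbl n)))));
    try (apply avg2_cont); auto.
  apply (avg_ext (V (S (dbl n))) (V (S (S (dbl n))))); auto.
  intros y Hy; rewrite <- (avg_plus (V (dbl n)) (V (S (dbl n)))); auto.
  apply (avg_ext (V (dbl n)) (V (S (dbl n)))); auto.
Qed.

Lemma mol_scal n c f : (forall y, V 0%nat y -> continuous f y) ->
  forall x, V (dbl n) x -> mol n h (fun y => c * f y) x = c * mol n h f x.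
Proof.
  intros Hf; assert (HC' := HC); destruct HC' as [Hh [HO HS]].
  induction n as [ | n IH]; simpl; trivial; intros x Hx.
  assert (Cf := mol_continuous n f Hf).
  rewrite <- (avg_scal (V (S (dbl n))) (V (S (S (dbl n)))));
    try (apply avg2_cont); auto.
  apply (avg_ext (V (S (dbl n))) (V (S (S (dbl n))))); auto.
  intros y Hy; rewrite <- (avg_scal (V (dbl n)) (V (S (dbl n)))); auto.
  apply (avg_ext (V (dbl n)) (V (S (dbl n)))); auto.
Qed.

(* Every box shift moves a coordinate by at most [h], so only values of [f] near [x] matter. *)
Lemma mol_bound n f c B x : (forall y, V 0%nat y -> continuous f y) ->
  V (dbl n) x ->
  (forall y, V 0%nat y -> Rabs (fst y - fst x) <= INR n * h -> Rabs (snd y - snd x) <= INR n * h ->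
     Rabs (f y - c) <= B) -> Rabs (mol n h f x - c) <= B.
Proof.
  intros Hf; assert (HC' := HC); destruct HC' as [Hh [HO HS]].
  revert x; induction n as [ | n IH]; intros x Hx H.
  - apply H; simpl; trivial; rewrite Rmult_0_l, Rminus_diag, Rabs_R0; lra.
  - simpl mol; simpl dbl in Hx.
    assert (Cf := mol_continuous n f Hf).
    apply (avg_bound (V (S (dbl n))) (V (S (S (dbl n))))); try (apply avg2_cont); auto.
    intros s Hs; apply (avg_bound (V (dbl n)) (V (S (dbl n)))); auto.
    intros t Ht; apply IH; auto.
    rewrite S_INR in H; intros y Hy H1 H2; apply H; trivial.
    + replace (fst y - fst x) with ((fst y - fst (shift 1 t (shift 0 s x))) + s) by (simpl; ring).
      apply Rle_trans with (1 := Rabs_triang _ _); rewrite (Rabs_pos_eq s); lra.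
    + replace (snd y - snd x) with ((snd y - snd (shift 1 t (shift 0 s x))) + t) by (simpl; ring).
      apply Rle_trans with (1 := Rabs_triang _ _); rewrite (Rabs_pos_eq t); lra.
Qed.

Lemma mol_is_pd n b f :
  (forall y, V 0%nat y -> continuous f y) -> (forall y, V 0%nat y -> ex_pd b f y) ->
  (forall y, V 0%nat y -> continuous (pd b f) y) ->
  forall x, V (dbl n) x -> is_pd b (mol n h f) x (mol n h (pd b f) x).
Proof.
  intros Hf Hd Hc; assert (HC' := HC); destruct HC' as [Hh [HO HS]].
  induction n as [ | n IH]; simpl; intros x Hx; [ apply pd_correct, Hd, Hx | ].
  assert (Cf := mol_continuous n f Hf); assert (Cd := mol_continuous n _ Hc).
  assert (step : forall a i g d, (forall y, V i y -> continuous g y) -> (forall y, V i y -> continuous d y) ->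
    (forall y, V i y -> is_pd b g y (d y)) -> forall y, V (S i) y -> is_pd b (avg a h g) y (avg a h d y)).
  { intros a i g d Cg Cdd Hg y Hy.
    assert (E : forall y, V i y -> pd b g y = d y) by (intros z Hz; apply is_pd_unique, Hg, Hz).
    rewrite <- (avg_ext (V i) (V (S i)) a h Hh (HS i a) (pd b g) d y); auto.
    apply (avg_is_pd (V i) (V (S i))); auto.
    - intros z Hz; eapply is_pd_ex, Hg, Hz.
    - intros z Hz; apply (continuous_ext_loc _ d); auto.
      generalize (HO i z Hz); apply filter_imp; intros; symmetry; auto. }
  apply (step 0%nat (S (dbl n))); trivial; try (apply avg2_cont; auto).
  apply (step 1%nat (dbl n)); auto.
Qed.
End Mol.

Section MolSymb.
Context {P : Type} (h : P -> R) (V : nat -> P -> pt -> Prop) (HC : forall p, chain (h p) (fun i => V i p)).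

Lemma chain_openf i : openf (V i).
Proof. intros p x Hx; apply (HC p), Hx. Qed.

Lemma chain_inv p : 0 <= / h p.
Proof. left; apply Rinv_0_lt_compat, (HC p). Qed.

Lemma symb_incl (U W : P -> pt -> Prop) k : (forall p x, W p x -> U p x) ->
  forall f A L, symb U k f A L -> symb W k f A L.
Proof.
  intros HI; induction k as [ | k IH]; intros f A L [H1 [[C H2] H3]];
  (split; [ auto | split; [ exists C; auto | ] ]); trivial.
  intros a; split; [ intros p x Hx; apply H3; auto | apply IH, H3 ].
Qed.

Lemma symb_shift (U W : P -> pt -> Prop) (a : nat) (s : P -> R) k :
  openf W -> (forall p x, W p x -> U p (shift a (s p) x)) ->
  forall f A L, symb U k f A L -> symb W k (fun p x => f p (shift a (s p) x)) A L.
Proof.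
  intros OW HI; induction k as [ | k IH]; intros f A L H.
  - destruct H as [H1 [[C H2] H3]]; split; [ | split; [ exists C; auto | trivial ] ].
    intros p x Hx; apply (continuous_comp (shift a (s p)) (f p)); [ apply continuous_shift | auto ].
  - apply (symb_intro W OW _ _ _ _ (fun b p x => pd b (f p) (shift a (s p) x))).
    + intros p x Hx; apply (continuous_comp (shift a (s p)) (f p)); [ apply continuous_shift | ].
      apply H; auto.
    + destruct H as [_ [[C H] _]]; exists C; auto.
    + intros b p x Hx; apply is_pd_shift; eapply symb_is_pd; eauto.
    + intros b; apply (IH (fun p => pd b (f p))), H.
Qed.

Lemma avg_symb i a k : forall f A L,
  symb (V i) k f A L -> symb (V (S i)) k (fun p => avg a (h p) (f p)) A L.
Proof.
  assert (Hb : forall (f : P -> pt -> R) A, (forall p x, V i p x -> continuous (f p) x) ->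
    (exists C, forall p x, V i p x -> Rabs (f p x) <= C * A p) ->
    exists C, forall p x, V (S i) p x -> Rabs (avg a (h p) (f p) x) <= C * A p).
  { intros f A Hc [C H]; exists C; intros p x Hx; destruct (HC p) as [Hh [HO HS]].
    rewrite <- (Rminus_0_r (avg _ _ _ _)).
    apply (avg_bound (V i p) (V (S i) p)); auto.
    intros s Hs; rewrite Rminus_0_r; auto. }
  assert (Hcont : forall (f : P -> pt -> R), (forall p x, V i p x -> continuous (f p) x) ->
    forall p x, V (S i) p x -> continuous (avg a (h p) (f p)) x).
  { intros f Hf p x Hx; destruct (HC p) as [Hh [HO HS]].
    apply (avg_continuous (V i p) (V (S i) p)); auto. }
  induction k as [ | k IH]; intros f A L H.
  - split; [ apply Hcont, H | split; trivial; apply Hb; apply H ].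
  - apply (symb_intro _ (chain_openf (S i)) _ _ _ _ (fun b p => avg a (h p) (pd b (f p)))).
    + apply Hcont; intros; eapply symb_cont; eauto.
    + apply Hb; [ intros; eapply symb_cont; eauto | apply H ].
    + intros b p x Hx; destruct (HC p) as [Hh [HO HS]].
      apply (avg_is_pd (V i p) (V (S i) p)); auto.
      * intros y Hy; eapply symb_cont; eauto.
      * intros y Hy; eapply is_pd_ex, symb_is_pd; eauto.
      * intros y Hy; apply (symb_cont _ _ _ _ _ p y (symb_pd _ _ _ _ _ b H) Hy).
    + intros b; apply IH, H.
Qed.

(** A difference quotient of step [h] has the size of one derivative at frequency [/ h], by the
    triangle inequality alone, so no order of regularity is spent. *)
Lemma avg_gain i f A k :
  symb (V i) k f A (fun p => / h p) ->
  symb (V (S i)) k (fun p x => / h p * (f p (shift 0 (h p) x) - f p x)) (fun p => A p * / h p) (fun p => / h p) /\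
  symb (V (S i)) k (fun p x => / h p * (f p (shift 1 (h p) x) - f p x)) (fun p => A p * / h p) (fun p => / h p).
Proof.
  intros H; split; (eapply symb_amp; [ | apply symb_scal with (B := fun p => / h p) (A := A) ];
    [ intros; simpl; ring | apply chain_openf | apply chain_inv
    | exists 1; intros p; rewrite (Rabs_pos_eq _ (chain_inv p)); lra | ];
    apply symb_minus; [ apply chain_openf | apply chain_inv | | ];
    [ apply (symb_shift (V i)); [ apply chain_openf | | exact H ] | eapply symb_incl; [ | exact H ] ];
    intros p x Hx; [ destruct (HC p) as [Hh [HO HS]]; apply HS; trivial; lra
                   | apply (chain_incl (h p) (fun i => V i p)); trivial ]).
Qed.

(** Averaging once in each direction gains one order: any first derivative falls on an averaged
    direction and becomes a difference quotient, and the other average preserves the class. *)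
Lemma avg2_symb i k f A :
  symb (V i) k f A (fun p => / h p) ->
  symb (V (S (S i))) (S k) (fun p => avg 0 (h p) (avg 1 (h p) (f p))) A (fun p => / h p).
Proof.
  intros H.
  assert (H1 := avg_symb _ 1 _ _ _ _ H); assert (H2 := avg_symb _ 0 _ _ _ _ H1).
  apply (symb_intro _ (chain_openf _) _ _ _ _ (fun b p x => match b with
    | O => / h p * (avg 1 (h p) (f p) (shift 0 (h p) x) - avg 1 (h p) (f p) x)
    | _ => avg 0 (h p) (fun x => / h p * (f p (shift 1 (h p) x) - f p x)) x end)).
  - intros p x Hx; apply (symb_cont _ _ _ _ _ p x H2 Hx).
  - destruct k; apply H2.
  - assert (Cf : forall p y, V i p y -> continuous (f p) y) by (intros p y Hy; eapply symb_cont; eauto).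
    assert (C1 : forall p y, V (S i) p y -> continuous (avg 1 (h p) (f p)) y)
      by (intros p y Hy; apply (symb_cont _ _ _ _ _ p y H1 Hy)).
    intros b p x Hx; destruct (HC p) as [Hh [HO HS]]; destruct b as [ | b].
    + apply (avg_is_pd_same (V (S i) p) (V (S (S i)) p)); auto.
    + assert (D1 : forall y, V (S i) p y -> is_pd 1 (avg 1 (h p) (f p)) y (/ h p * (f p (shift 1 (h p) y) - f p y)))
        by (intros y Hy; apply (avg_is_pd_same (V i p) (V (S i) p)); auto).
      assert (E : forall y, V (S i) p y -> pd 1 (avg 1 (h p) (f p)) y = / h p * (f p (shift 1 (h p) y) - f p y))
        by (intros y Hy; apply is_pd_unique, D1, Hy).
      change (is_pd 1 (avg 0 (h p) (avg 1 (h p) (f p))) x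
        (avg 0 (h p) (fun x => / h p * (f p (shift 1 (h p) x) - f p x)) x)).
      rewrite <- (avg_ext (V (S i) p) (V (S (S i)) p) 0 (h p) Hh (HS _ 0%nat) _ _ x E Hx).
      apply (avg_is_pd (V (S i) p) (V (S (S i)) p)); auto.
      * intros y Hy; eapply is_pd_ex, D1, Hy.
      * intros y Hy; apply (continuous_ext_loc _ (fun y => / h p * (f p (shift 1 (h p) y) - f p y))).
        -- generalize (HO _ y Hy); apply filter_imp; intros z Hz; symmetry; auto.
        -- apply (symb_cont _ _ _ _ _ p y (proj2 (avg_gain _ _ _ _ H)) Hy).
  - intros b; destruct b as [ | b].
    + exact (proj1 (avg_gain _ _ _ _ H1)).
    + exact (avg_symb _ 0 _ _ _ _ (proj2 (avg_gain _ _ _ _ H))).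
Qed.

Lemma mol_symb n f A :
  symb (V 0) 0 f A (fun p => / h p) ->
  symb (V (dbl n)) n (fun p => mol n (h p) (f p)) A (fun p => / h p).
Proof. intros H; induction n as [ | n IH]; simpl; trivial; apply avg2_symb, IH. Qed.
End MolSymb.

(** * Adding one primitive metric in one codimension *)
Definition hpd (f : pt -> R) (a b : nat) (x : pt) : R := pd b (pd a f) x.

(** The symmetrised Hessian as a bilinear form on directions. Symmetrising replaces any appeal to
    the equality of mixed partial derivatives. *)
Definition hquad (f : pt -> R) (u v : pt) (x : pt) : R :=
  fst u * fst v * hpd f 0 0 x + / 2 * (fst u * snd v + snd u * fst v) * (hpd f 0 1 x + hpd f 1 0 x)
  + snd u * snd v * hpd f 1 1 x.

Ltac pd_rules :=
  match goal with
  | |- is_pd _ (fun y => _ + _) _ _ => eapply is_pd_plus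
  | |- is_pd _ (fun y => _ - _) _ _ => eapply is_pd_minus
  | |- is_pd _ (fun y => - _) _ _ => eapply is_pd_opp
  | |- is_pd _ (fun y => sin _) _ _ => apply is_pd_sin
  | |- is_pd _ (fun y => cos _) _ _ => apply is_pd_cos
  | |- is_pd _ (fun y => _ * _) _ _ => eapply is_pd_mult
  | |- is_pd _ (fun y => ?c) _ _ => apply is_pd_const
  | _ => solve [eauto]
  end.

(** The hypotheses say that [n (x) m + z (x) k] is the identity; inserting it on both sides of the
    symmetrised Hessian expands that Hessian in the covectors [n] and [z]. *)
Lemma hess_split f (n m z k : pt) a b x :
  fst n * fst m + fst z * fst k = 1 -> fst n * snd m + fst z * snd k = 0 ->
  snd n * fst m + snd z * fst k = 0 -> snd n * snd m + snd z * snd k = 1 ->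
  hpd f a b x + hpd f b a x =
  2 * (coord a n * coord b n * hquad f m m x + (coord a n * coord b z + coord a z * coord b n) * hquad f m k x
       + coord a z * coord b z * hquad f k k x).
Proof.
  intros H1 H2 H3 H4.
  set (T := fun i j => match i, j with O, O => hpd f 0 0 x | O, S _ => / 2 * (hpd f 0 1 x + hpd f 1 0 x)
     | S _, O => / 2 * (hpd f 0 1 x + hpd f 1 0 x) | _, _ => hpd f 1 1 x end).
  set (M := fun (a c : nat) => coord a n * coord c m + coord a z * coord c k).
  assert (HM : forall i j, M i j = delta i j) by (intros [|i] [|j]; unfold M; simpl; assumption).
  transitivity (2 * (M a 0%nat * M b 0%nat * T 0%nat 0%nat + M a 0%nat * M b 1%nat * T 0%nat 1%nat
    + M a 1%nat * M b 0%nat * T 1%nat 0%nat + M a 1%nat * M b 1%nat * T 1%nat 1%nat)).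
  - rewrite !HM; destruct a, b; unfold T, hpd; simpl; try field.
  - unfold M, T, hquad; simpl; field.
Qed.

Section Prim.
Context {P : Type} (U : P -> pt -> Prop) (HU : openf U) (L s G rho : P -> R).
Context (HL : forall p, 1 <= L p) (Hs : forall p, 0 < s p) (HG : forall p, s p <= G p) (Hrho : forall p, 1 <= rho p).
Context (n m z k : pt).
Context (D00 : fst n * fst m + fst z * fst k = 1) (D01 : fst n * snd m + fst z * snd k = 0)
  (D10 : snd n * fst m + snd z * fst k = 0) (D11 : snd n * snd m + snd z * snd k = 1)
  (Dk : fst n * fst k + snd n * snd k = 0) (Dm : fst n * fst m + snd n * snd m = 1).
Context (K : nat) (v f : P -> pt -> R) (X : P -> R).
Context (Sv : symb U (S (S (S (S K)))) v X L).
Context (Sg : forall a, symb U (S (S (S K))) (fun p => pd a (v p)) G L).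
Context (Sh : forall a b, symb U (S (S K)) (fun p => hpd (v p) a b) (fun p => s p * L p * rho p) L).
Context (Sq : symb U (S (S K)) (fun p => hquad (v p) m k) (fun p => s p * L p) L).
Context (Sr : symb U (S (S K)) (fun p => hquad (v p) k k) (fun p => s p * L p * / rho p) L).
Context (Sf : symb U (S (S K)) f (fun p => s p ^ 2) L) (Hf : forall p x, U p x -> s p ^ 2 <= f p x).

(** The sizes assumed above for the full Hessian of [v] and for its [m k] and [k k] entries are
    those of a wave with phase frequency [L] whose profile has size [s * rho] and frequency
    [L / rho], that is, of the outcome of a previous step. The new phase is faster than [L] by the
    factor [rho]. *)
Definition freq (p : P) : R := L p * rho p.
Definition ampl (p : P) (x : pt) : R := sqrt (f p x).
(** The factor 2 normalises the mean: half the square of the leading gradient [2 a cos] averages to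
    [a^2 = f]. *)
Definition wave (p : P) (x : pt) : R := 2 * / freq p * (ampl p x * sin (freq p * dot n x)).
(** [tang] has size [s^2], no smaller than [f] itself, so two integrations by parts are needed to
    reach [(s / rho)^2]; [mixd] already has size [s^2 / rho] and needs one; the [k k] entry of the
    Hessian gives [(s / rho)^2] at once. *)
Definition tang (p : P) (x : pt) : R := 2 * / freq p * (ampl p x * hquad (v p) m m x).
Definition mixd (p : P) (x : pt) : R := 2 * / freq p * (ampl p x * hquad (v p) m k x).

(* The oscillating errors are integrated by parts: the second and third line absorb the part of
   [grad wave (x) grad wave / 2] that is not [f n (x) n], the last three the components of
   [wave * Hess v] along [n (x) n] (coefficient [tang]) and [n (.) z] (coefficient [mixd]). *)
Definition corr (b : nat) (p : P) (x : pt) : R :=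
  let S := fun x : pt => sin (freq p * dot n x) in
  let C := fun x : pt => cos (freq p * dot n x) in
  - (wave p x * pd b (v p) x)
  - / freq p * coord b n * (f p x * (S x * C x))
  + / 4 * / freq p * / freq p * ((1 - 2 * (S x * S x)) * pd b (f p) x)
  - / freq p * coord b n * (tang p x * C x)
  + / freq p * / freq p * (S x * pd b (tang p) x)
  - 2 * / freq p * coord b z * (mixd p x * C x).

Definition rest (a b : nat) (p : P) (x : pt) : R :=
  let S := fun x : pt => sin (freq p * dot n x) in
  let C := fun x : pt => cos (freq p * dot n x) in
  2 * / freq p * / freq p * (S x * S x * (pd a (ampl p) x * pd b (ampl p) x))
  + / 8 * / freq p * / freq p * ((1 - 2 * (S x * S x)) * (hpd (f p) a b x + hpd (f p) b a x))
  - 2 * coord a z * coord b z * / freq p * (ampl p x * hquad (v p) k k x * S x)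
  + / 2 * / freq p * / freq p * (S x * (hpd (tang p) a b x + hpd (tang p) b a x))
  - / freq p * (C x * (coord b z * pd a (mixd p) x + coord a z * pd b (mixd p) x)).

Lemma freq_pos p : 0 < freq p.
Proof. unfold freq; assert (H := HL p); assert (H' := Hrho p); nra. Qed.

Lemma L_le_freq p : 0 <= L p <= freq p.
Proof. unfold freq; assert (H := HL p); assert (H' := Hrho p); nra. Qed.

Lemma freq_ge1 p : 1 <= freq p.
Proof. assert (H := HL p); destruct (L_le_freq p); lra. Qed.

Lemma symb_ampl : symb U (S (S K)) ampl s L.
Proof.
  apply symb_sqrt; trivial; intros p; destruct (L_le_freq p); trivial.
Qed.

Lemma symb_invfreq j L' : (forall p, 0 <= L' p) -> symb U j (fun p _ => / freq p) (fun p => / freq p) L'.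
Proof.
  intros HL'; apply symb_const; trivial; exists 1; intros p; rewrite Rabs_pos_eq; [ lra | ].
  left; apply Rinv_0_lt_compat, freq_pos.
Qed.

Lemma symb_num j c L' : (forall p, 0 <= L' p) -> symb U j (fun p _ => c) (fun _ => 1) L'.
Proof. intros HL'; apply symb_const; trivial; exists (Rabs c); intros; lra. Qed.

Lemma symb_hquad j g A L' u w : (forall p, 0 <= L' p) ->
  (forall a b, symb U j (fun p => hpd (g p) a b) A L') -> symb U j (fun p => hquad (g p) u w) A L'.
Proof.
  intros HL' H; unfold hquad; repeat apply symb_plus; trivial; apply symb_scalR; trivial.
  apply symb_plus; trivial.
Qed.

Lemma freq_nonneg p : 0 <= freq p. Proof. left; apply freq_pos. Qed.
Lemma L_nonneg p : 0 <= L p. Proof. apply L_le_freq. Qed.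

Lemma symb_tang : symb U (S (S K)) tang (fun p => s p ^ 2) L.
Proof.
  unfold tang; eapply symb_amp; [ | repeat apply symb_mult; trivial ].
  2: apply (symb_num _ 2), L_nonneg.
  2: apply symb_invfreq, L_nonneg.
  2: apply symb_ampl.
  2: apply symb_hquad; [ apply L_nonneg | exact Sh ].
  intros p; unfold freq; assert (H := HL p); assert (H' := Hrho p); field; lra.
Qed.

Lemma symb_mixd : symb U (S (S K)) mixd (fun p => s p ^ 2 * / rho p) L.
Proof.
  unfold mixd; eapply symb_amp; [ | repeat apply symb_mult; trivial ].
  2: apply (symb_num _ 2), L_nonneg.
  2: apply symb_invfreq, L_nonneg.
  2: apply symb_ampl.
  2: exact Sq.
  intros p; unfold freq; assert (H := HL p); assert (H' := Hrho p); simpl; field; lra.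
Qed.

Lemma to_freq j i g A : (forall p, 0 <= A p) -> (j <= i)%nat -> symb U i g A L -> symb U j g A freq.
Proof.
  intros HA Hj H; apply symb_wk with (A := A) (L := L) (c := 1); trivial.
  - intros; lra.
  - exact L_le_freq.
  - apply symb_le with i; trivial.
Qed.

Lemma pos_s p : 0 <= s p. Proof. left; apply Hs. Qed.

Lemma pos_s2 p : 0 <= s p ^ 2. Proof. apply pow2_ge_0. Qed.

Lemma symb_wave : symb U (S (S K)) wave (fun p => s p * / freq p) freq.
Proof.
  unfold wave; eapply symb_amp; [ | repeat apply symb_mult; trivial ].
  2: apply (symb_num _ 2), freq_nonneg.
  2: apply symb_invfreq, freq_nonneg.
  2: eapply to_freq; [ | apply le_n | apply symb_ampl ]; apply pos_s.
  2: apply symb_trig; [ exact HU | apply freq_nonneg ].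
  intros p; simpl; ring.
Qed.

Lemma Uis_pd a p x j g A L' : symb U (S j) g A L' -> U p x -> is_pd a (g p) x (pd a (g p) x).
Proof. intros; eapply symb_is_pd; eauto. Qed.

(** Half the square of the leading gradient is [f + f cos (2 theta)], with [theta] the phase. In
    [corr] the products [S C] and [1 - 2 S^2] are half of [sin (2 theta)] and all of
    [cos (2 theta)], so the terms in [f] integrate the double-frequency part twice. The term
    [wave * grad v] trades the cross terms for [- wave * Hess v]. *)
Lemma prim_identity a b p x : U p x ->
  let vn := fun y => v p y + wave p y in
  / 2 * (pd a vn x * pd b vn x) - / 2 * (pd a (v p) x * pd b (v p) x)
  + / 2 * (pd a (corr b p) x + pd b (corr a p) x)
  = f p x * coord a n * coord b n + rest a b p x.
Proof.
  intros Hx vn.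
  assert (Iv : forall a, is_pd a (v p) x (pd a (v p) x)) by (intros; eapply Uis_pd; eauto).
  assert (If : forall a, is_pd a (f p) x (pd a (f p) x)) by (intros; eapply Uis_pd; eauto).
  assert (Ia : forall a, is_pd a (ampl p) x (pd a (ampl p) x)) by (intros; eapply Uis_pd; eauto using symb_ampl).
  assert (It : forall a, is_pd a (tang p) x (pd a (tang p) x)) by (intros; eapply Uis_pd; eauto using symb_tang).
  assert (Im : forall a, is_pd a (mixd p) x (pd a (mixd p) x)) by (intros; eapply Uis_pd; eauto using symb_mixd).
  assert (Iw : forall a, is_pd a (wave p) x (2 * / freq p * (pd a (ampl p) x * sin (freq p * dot n x)
      + ampl p x * (cos (freq p * dot n x) * (freq p * coord a n))))).
  { intros c; evar (d : R); replace (2 * / freq p * _) with d; [ unfold wave; repeat pd_rules | unfold d; ring ]. }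
  assert (Igv : forall a b, is_pd a (pd b (v p)) x (hpd (v p) b a x))
    by (intros c d; apply (Uis_pd c p x _ _ _ _ (Sg d) Hx)).
  assert (Igf : forall a b, is_pd a (pd b (f p)) x (hpd (f p) b a x))
    by (intros c d; apply (Uis_pd c p x _ _ _ _ (symb_pd _ _ _ _ _ d Sf) Hx)).
  assert (Igt : forall a b, is_pd a (pd b (tang p)) x (hpd (tang p) b a x))
    by (intros c d; apply (Uis_pd c p x _ _ _ _ (symb_pd _ _ _ _ _ d symb_tang) Hx)).
  assert (Ef : f p x = ampl p x * ampl p x).
  { unfold ampl; rewrite sqrt_sqrt; trivial; apply Rle_trans with (2 := Hf p x Hx), pos_s2. }
  assert (Edf : forall c, pd c (f p) x = 2 * ampl p x * pd c (ampl p) x).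
  { intros c; apply is_pd_unique.
    apply is_pd_ext_loc with (fun y => ampl p y * ampl p y).
    - generalize (HU p x Hx); apply filter_imp; intros y Hy; unfold ampl; apply sqrt_sqrt.
      apply Rle_trans with (2 := Hf p y Hy), pos_s2.
    - evar (d : R); replace (2 * ampl p x * pd c (ampl p) x) with d; [ apply is_pd_mult; auto | unfold d; ring ]. }
  assert (Evn : forall c, pd c vn x = pd c (v p) x + 2 * / freq p * (pd c (ampl p) x * sin (freq p * dot n x)
      + ampl p x * (cos (freq p * dot n x) * (freq p * coord c n))))
    by (intros c; apply is_pd_unique, is_pd_plus; auto).
  evar (d1 : R); assert (E1 : pd a (corr b p) x = d1)
    by (apply is_pd_unique; cbv beta zeta delta [corr]; unfold d1; repeat pd_rules).
  evar (d2 : R); assert (E2 : pd b (corr a p) x = d2)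
    by (apply is_pd_unique; cbv beta zeta delta [corr]; unfold d2; repeat pd_rules).
  rewrite E1, E2, !Evn; unfold d1, d2; clear E1 E2 d1 d2.
  rewrite !Edf, Ef; unfold rest.
  assert (Et : tang p x = 2 * / freq p * (ampl p x * hquad (v p) m m x)) by reflexivity.
  assert (Em : mixd p x = 2 * / freq p * (ampl p x * hquad (v p) m k x)) by reflexivity.
  assert (Ew : wave p x = 2 * / freq p * (ampl p x * sin (freq p * dot n x))) by reflexivity.
  assert (EH : hpd (v p) a b x + hpd (v p) b a x =
     2 * (coord a n * coord b n * hquad (v p) m m x + (coord a n * coord b z + coord a z * coord b n) * hquad (v p) m k x
       + coord a z * coord b z * hquad (v p) k k x)).
  { apply hess_split; trivial. }
  assert (SC := sin2_cos2 (freq p * dot n x)); unfold Rsqr in SC.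
  rewrite Et, Em, Ew; clear Et Em Ew.
  assert (Fp := freq_pos p).
  clear Iw Evn Ef Edf.
  (* Eliminates one mixed derivative in favour of the other, so that the remaining quantities are
     independent atoms for [field]. *)
  assert (EH' : hpd (v p) b a x = 2 * (coord a n * coord b n * hquad (v p) m m x + (coord a n * coord b z + coord a z * coord b n) * hquad (v p) m k x
       + coord a z * coord b z * hquad (v p) k k x) - hpd (v p) a b x) by lra.
  rewrite EH'; clear EH EH'.
  apply Rminus_diag_uniq.
  (* The two sides agree except for this multiple of [sin^2 + cos^2 - 1]. *)
  transitivity (ampl p x * ampl p x * coord a n * coord b n *
    (sin (freq p * dot n x) * sin (freq p * dot n x)
     + cos (freq p * dot n x) * cos (freq p * dot n x) - 1)).
  - field; lra.
  - rewrite SC; ring.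
Qed.

Lemma fpos p : 0 < L p /\ 0 < rho p /\ 0 < s p /\ 0 < G p.
Proof. assert (T1 := HL p); assert (T2 := Hs p); assert (T3 := HG p); assert (T4 := Hrho p); lra. Qed.

Lemma symb_sin j : symb U j (fun p x => sin (freq p * dot n x)) (fun _ => 1) freq.
Proof. apply symb_trig; [ exact HU | apply freq_nonneg ]. Qed.

Lemma symb_cos j : symb U j (fun p x => cos (freq p * dot n x)) (fun _ => 1) freq.
Proof. apply symb_trig; [ exact HU | apply freq_nonneg ]. Qed.

Lemma symb_cos2 j : symb U j (fun p x => 1 - 2 * (sin (freq p * dot n x) * sin (freq p * dot n x)))
  (fun _ => 1) freq.
Proof.
  apply symb_minus; trivial; try apply freq_nonneg; [ apply symb_num, freq_nonneg | ].
  apply symb_scalR; trivial; try apply freq_nonneg.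
  eapply symb_amp; [ | apply symb_mult; trivial; apply symb_sin ]; intros; simpl; ring.
Qed.

Ltac factor :=
  first [ eassumption | apply symb_sin | apply symb_cos | apply symb_cos2
        | apply symb_invfreq, freq_nonneg | apply symb_num, freq_nonneg
        | apply symb_mult; [ exact HU | factor | factor ] ].

Ltac amp_field := intros p; destruct (fpos p) as [? [? [? ?]]]; unfold freq; simpl; field; lra.
Ltac nonneg := intros p; destruct (fpos p) as [? [? [? ?]]]; assert (Hfr := freq_pos p);
  assert (0 < / freq p) by (apply Rinv_0_lt_compat; exact Hfr);
  assert (0 < / rho p) by (apply Rinv_0_lt_compat; assumption);
  simpl; repeat (apply Rmult_le_pos); lra.

(** Each summand carries either two slow derivatives against [/ freq^2], or the small [k k] entry
    against [/ freq], or one slow derivative of [mixd] against [/ freq]; as [L / freq = / rho], all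
    come to [(s / rho)^2]. *)
Lemma symb_rest a b : symb U K (rest a b) (fun p => (s p * / rho p) ^ 2) freq.
Proof.
  assert (A1 : forall c, symb U K (fun p => pd c (ampl p)) (fun p => s p * L p) freq)
    by (intros c; eapply to_freq with (i := S K); [ nonneg | lia | apply symb_pd, symb_ampl ]).
  assert (A0 : symb U K ampl s freq) by (eapply to_freq; [ apply pos_s | | apply symb_ampl ]; lia).
  assert (F2 : forall c d, symb U K (fun p => hpd (f p) c d) (fun p => s p ^ 2 * L p * L p) freq)
    by (intros c d; eapply to_freq with (i := K); [ nonneg | lia | apply (symb_pd _ _ (fun p => pd c (f p))), symb_pd, Sf ]).
  assert (T2 : forall c d, symb U K (fun p => hpd (tang p) c d) (fun p => s p ^ 2 * L p * L p) freq)
    by (intros c d; eapply to_freq with (i := K); [ nonneg | lia | apply (symb_pd _ _ (fun p => pd c (tang p))), symb_pd, symb_tang ]).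
  assert (M1 : forall c, symb U K (fun p => pd c (mixd p)) (fun p => s p ^ 2 * / rho p * L p) freq)
    by (intros c; eapply to_freq with (i := S K); [ nonneg | lia | apply symb_pd, symb_mixd ]).
  assert (R0 : symb U K (fun p => hquad (v p) k k) (fun p => s p * L p * / rho p) freq)
    by (eapply to_freq; [ nonneg | | exact Sr ]; lia).
  assert (F2' : symb U K (fun p x => hpd (f p) a b x + hpd (f p) b a x) (fun p => s p ^ 2 * L p * L p) freq)
    by (apply symb_plus; auto).
  assert (T2' : symb U K (fun p x => hpd (tang p) a b x + hpd (tang p) b a x) (fun p => s p ^ 2 * L p * L p) freq)
    by (apply symb_plus; auto).
  assert (M1' : symb U K (fun p x => coord b z * pd a (mixd p) x + coord a z * pd b (mixd p) x) (fun p => s p ^ 2 * / rho p * L p) freq)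
    by (apply symb_plus; auto; apply symb_scalR; auto using freq_nonneg).
  assert (A1a := A1 a); assert (A1b := A1 b).
  unfold rest; apply symb_minus; auto using freq_nonneg;
    [ apply symb_plus; auto; [ apply symb_minus; auto using freq_nonneg; [ apply symb_plus; auto | ] | ] | ];
    (eapply symb_amp; [ | factor ]); amp_field.
Qed.

(** The product [wave * grad v] has size [s G / freq]; all other terms are at most [s^2 / freq] and
    are absorbed through [s <= G]. *)
Lemma symb_corr b : symb U (S K) (corr b) (fun p => s p * (1 + G p) * / freq p) freq.
Proof.
  assert (V1 : symb U (S K) (fun p => pd b (v p)) G freq)
    by (eapply to_freq with (i := S (S (S K))); [ nonneg | lia | apply Sg ]).
  assert (W0 : symb U (S K) wave (fun p => s p * / freq p) freq)
    by (apply symb_S, symb_wave).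
  assert (F0 : symb U (S K) f (fun p => s p ^ 2) freq)
    by (eapply to_freq; [ nonneg | | exact Sf ]; lia).
  assert (F1 : symb U (S K) (fun p => pd b (f p)) (fun p => s p ^ 2 * L p) freq)
    by (eapply to_freq; [ nonneg | | apply symb_pd, Sf ]; lia).
  assert (T0 : symb U (S K) tang (fun p => s p ^ 2) freq)
    by (eapply to_freq; [ nonneg | | exact symb_tang ]; lia).
  assert (T1 : symb U (S K) (fun p => pd b (tang p)) (fun p => s p ^ 2 * L p) freq)
    by (eapply to_freq; [ nonneg | | apply symb_pd, symb_tang ]; lia).
  assert (M0 : symb U (S K) mixd (fun p => s p ^ 2 * / rho p) freq)
    by (eapply to_freq; [ nonneg | | exact symb_mixd ]; lia).
  assert (B : forall p, s p * G p * / freq p <= 1 * (s p * (1 + G p) * / freq p)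
     /\ s p ^ 2 * / freq p <= 1 * (s p * (1 + G p) * / freq p)
     /\ s p ^ 2 * / freq p * / rho p <= 1 * (s p * (1 + G p) * / freq p)).
  { intros p; destruct (fpos p) as [? [? [? ?]]]; assert (Hfr := freq_pos p); assert (T := HG p); assert (T' := Hrho p).
    assert (I : 0 < / freq p) by (apply Rinv_0_lt_compat; exact Hfr).
    assert (I2 : 0 < / rho p <= 1) by (split; [ apply Rinv_0_lt_compat; lra | rewrite <- Rinv_1; apply Rinv_le_contravar; lra ]).
    assert (Q : s p ^ 2 * / freq p <= s p * (1 + G p) * / freq p)
      by (apply Rmult_le_compat_r; [ lra | simpl; apply Rmult_le_compat_l; lra ]).
    assert (Q0 : 0 <= s p ^ 2 * / freq p) by (apply Rmult_le_pos; [ apply pow2_ge_0 | lra ]).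
    split; [ | split; [ lra | ] ].
    - rewrite Rmult_1_l; apply Rmult_le_compat_r; [ lra | apply Rmult_le_compat_l; lra ].
    - apply Rle_trans with (s p ^ 2 * / freq p * 1); [ apply Rmult_le_compat_l; lra | lra ]. }
  assert (W1 : forall g A, (forall p, 0 <= A p) -> (forall p, A p <= 1 * (s p * (1 + G p) * / freq p)) ->
     symb U (S K) g A freq -> symb U (S K) g (fun p => s p * (1 + G p) * / freq p) freq).
  { intros g A H1 H2 H3; apply symb_wk with (A := A) (L := freq) (c := 1); trivial.
    intros p; split; [ apply freq_nonneg | lra ]. }
  unfold corr; apply symb_minus; auto using freq_nonneg;
    [ apply symb_plus; auto; [ apply symb_minus; auto using freq_nonneg; [ apply symb_plus; auto;
      [ apply symb_minus; auto using freq_nonneg; [ apply symb_opp; auto using freq_nonneg | ] | ] | ] | ] | ].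
  - apply W1 with (fun p => s p * G p * / freq p); [ nonneg | apply B | ].
    eapply symb_amp; [ | factor ]; amp_field.
  - apply W1 with (fun p => s p ^ 2 * / freq p); [ nonneg | apply B | ].
    eapply symb_amp; [ | factor ]; amp_field.
  - apply W1 with (fun p => s p ^ 2 * / freq p * / rho p); [ nonneg | apply B | ].
    eapply symb_amp; [ | factor ]; amp_field.
  - apply W1 with (fun p => s p ^ 2 * / freq p); [ nonneg | apply B | ].
    eapply symb_amp; [ | factor ]; amp_field.
  - apply W1 with (fun p => s p ^ 2 * / freq p * / rho p); [ nonneg | apply B | ].
    eapply symb_amp; [ | factor ]; amp_field.
  - apply W1 with (fun p => s p ^ 2 * / freq p * / rho p); [ nonneg | apply B | ].
    eapply symb_amp; [ | factor ]; amp_field.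
Qed.

Definition newv (p : P) (x : pt) : R := v p x + wave p x.

Lemma is_pd_wave a p x : U p x -> is_pd a (wave p) x (2 * / freq p * (pd a (ampl p) x * sin (freq p * dot n x)
      + ampl p x * (cos (freq p * dot n x) * (freq p * coord a n)))).
Proof.
  intros Hx.
  assert (Ia : forall a, is_pd a (ampl p) x (pd a (ampl p) x)) by (intros; eapply Uis_pd; eauto using symb_ampl).
  evar (d : R); replace (2 * / freq p * _) with d; [ unfold wave; repeat pd_rules | unfold d; ring ].
Qed.

Lemma hpd_wave a b p x : U p x -> hpd (wave p) a b x =
  2 * / freq p * (hpd (ampl p) a b x * sin (freq p * dot n x)
    + (pd a (ampl p) x * coord b n + pd b (ampl p) x * coord a n) * (freq p * cos (freq p * dot n x))
    - ampl p x * sin (freq p * dot n x) * (freq p * coord a n) * (freq p * coord b n)).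
Proof.
  intros Hx; apply is_pd_unique; eapply is_pd_ext_loc.
  - generalize (HU p x Hx); apply filter_imp; intros y Hy; symmetry; apply is_pd_unique, is_pd_wave, Hy.
  - assert (Ia : forall a, is_pd a (ampl p) x (pd a (ampl p) x)) by (intros; eapply Uis_pd; eauto using symb_ampl).
    assert (Ia2 : forall a b, is_pd a (pd b (ampl p)) x (hpd (ampl p) b a x))
      by (intros c d; apply (Uis_pd c p x _ _ _ _ (symb_pd _ _ _ _ _ d symb_ampl) Hx)).
    evar (d : R); replace (2 * / freq p * _) with d; [ repeat pd_rules | unfold d; ring ].
Qed.

Lemma is_pd_newv a p x : U p x -> is_pd a (newv p) x (pd a (v p) x + pd a (wave p) x).
Proof.
  intros Hx; apply is_pd_plus; eapply Uis_pd; eauto using symb_wave.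
Qed.

Lemma hpd_newv a b p x : U p x -> hpd (newv p) a b x = hpd (v p) a b x + hpd (wave p) a b x.
Proof.
  intros Hx; apply is_pd_unique; eapply is_pd_ext_loc.
  - generalize (HU p x Hx); apply filter_imp; intros y Hy; symmetry; apply is_pd_unique, is_pd_newv, Hy.
  - apply is_pd_plus; [ apply (Uis_pd b p x _ _ _ _ (Sg a) Hx)
      | apply (Uis_pd b p x _ _ _ _ (symb_pd _ _ _ _ _ a symb_wave) Hx) ].
Qed.

Lemma symb_newv : (forall p, 0 <= X p) -> symb U (S (S K)) newv (fun p => X p + s p) freq.
Proof.
  intros HX; apply symb_plus; trivial.
  - apply symb_wk with (A := X) (L := L) (c := 1); trivial; [ | exact L_le_freq | eapply symb_le; [ | exact Sv ]; lia ].
    intros p; destruct (fpos p) as [? [? [? ?]]]; lra.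
  - apply symb_wk with (A := fun p => s p * / freq p) (L := freq) (c := 1); [ nonneg | | | exact symb_wave ].
    + intros p; assert (T := HX p); assert (T' := freq_ge1 p); destruct (fpos p) as [? [? [? ?]]].
      assert (/ freq p <= 1) by (rewrite <- Rinv_1; apply Rinv_le_contravar; lra).
      apply Rle_trans with (s p * 1); [ apply Rmult_le_compat_l; lra | lra ].
    + intros p; split; [ apply freq_nonneg | lra ].
Qed.

Lemma symb_grad_newv a : symb U (S K) (fun p => pd a (newv p)) G freq.
Proof.
  apply (symb_ext U HU _ (fun p x => pd a (v p) x + pd a (wave p) x)).
  - intros p x Hx; symmetry; apply is_pd_unique, is_pd_newv, Hx.
  - apply symb_plus; trivial.
    + eapply to_freq; [ nonneg | | apply Sg ]; lia.
    + apply symb_wk with (A := fun p => s p * / freq p * freq p) (L := freq) (c := 1).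
      * intros p; assert (T := freq_pos p); destruct (fpos p) as [? [? [? ?]]].
        rewrite Rmult_assoc, Rinv_l, Rmult_1_r; lra.
      * intros p; assert (T := freq_pos p); assert (T' := HG p); destruct (fpos p) as [? [? [? ?]]].
        rewrite Rmult_assoc, Rinv_l, Rmult_1_r; lra.
      * intros p; split; [ apply freq_nonneg | lra ].
      * apply symb_pd, symb_wave.
Qed.

(** Old Hessian and wave have the same size [s * freq]; it is written in the new quantities
    [s / rho] and [freq] so that the hypothesis of the next step appears literally. *)
Lemma symb_hess_newv a b : symb U K (fun p => hpd (newv p) a b) (fun p => s p * / rho p * freq p * rho p) freq.
Proof.
  apply (symb_ext U HU _ (fun p x => hpd (v p) a b x + hpd (wave p) a b x)).
  - intros p x Hx; symmetry; apply hpd_newv, Hx.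
  - apply symb_plus; trivial.
    + apply symb_amp with (fun p => s p * L p * rho p); [ amp_field | ].
      eapply to_freq; [ nonneg | | apply Sh ]; lia.
    + eapply symb_amp; [ | apply (symb_pd _ _ (fun p => pd a (wave p))), symb_pd, symb_wave ]; amp_field.
Qed.

Lemma hquad_newv u w p x : U p x -> hquad (newv p) u w x = hquad (v p) u w x + hquad (wave p) u w x.
Proof. intros Hx; unfold hquad; rewrite !hpd_newv by trivial; ring. Qed.

Lemma symb_ampl_hess a b : symb U K (fun p => hpd (ampl p) a b) (fun p => s p * L p * L p) freq.
Proof.
  eapply to_freq with (i := K); [ nonneg | lia | apply (symb_pd _ _ (fun p => pd a (ampl p))), symb_pd, symb_ampl ].
Qed.

(* [k] is orthogonal to [n], so the second derivative along [k] never hits the phase. *)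
Lemma symb_rr_newv : symb U K (fun p => hquad (newv p) k k) (fun p => s p * / rho p * freq p * / rho p) freq.
Proof.
  apply (symb_ext U HU _ (fun p x => hquad (v p) k k x + 2 * / freq p * (hquad (ampl p) k k x * sin (freq p * dot n x)))).
  - intros p x Hx; rewrite hquad_newv by trivial; f_equal.
    unfold hquad; rewrite !hpd_wave by trivial; simpl coord.
    set (C := cos _); set (S := sin _).
    apply Rminus_diag_uniq.
    transitivity (2 * / freq p * (fst n * fst k + snd n * snd k) *
      (ampl p x * S * freq p * freq p * (fst n * fst k + snd n * snd k)
       - 2 * freq p * C * (fst k * pd 0 (ampl p) x + snd k * pd 1 (ampl p) x))); [ field | rewrite Dk; ring ].
    assert (T := freq_pos p); lra.
  - apply symb_plus; trivial.
    + apply symb_amp with (fun p => s p * L p * / rho p); [ amp_field | ].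
      eapply to_freq; [ nonneg | | apply Sr ]; lia.
    + assert (T := symb_hquad K ampl _ _ k k freq_nonneg symb_ampl_hess).
      eapply symb_amp; [ | factor ]; amp_field.
Qed.

(** Since [k] is orthogonal to [n], at most one of the two derivatives meets the phase; it
    contributes the cosine times the slow derivative of the amplitude along [k]. *)
Lemma symb_mixed_newv : symb U K (fun p => hquad (newv p) m k) (fun p => s p * / rho p * freq p) freq.
Proof.
  apply (symb_ext U HU _ (fun p x => hquad (v p) m k x
     + (2 * / freq p * (hquad (ampl p) m k x * sin (freq p * dot n x))
        + 2 * ((fst k * pd 0 (ampl p) x + snd k * pd 1 (ampl p) x) * cos (freq p * dot n x))))).
  - intros p x Hx; rewrite hquad_newv by trivial; f_equal.
    unfold hquad; rewrite !hpd_wave by trivial; simpl coord.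
    set (C := cos _); set (S := sin _).
    apply Rminus_diag_uniq.
    transitivity (2 * (fst n * fst k + snd n * snd k) *
      (ampl p x * S * freq p * (fst n * fst m + snd n * snd m)
       - C * (fst m * pd 0 (ampl p) x + snd m * pd 1 (ampl p) x))
      + 2 * C * (fst k * pd 0 (ampl p) x + snd k * pd 1 (ampl p) x) * (1 - (fst n * fst m + snd n * snd m)));
      [ field | rewrite Dk, Dm; ring ].
    assert (T := freq_pos p); lra.
  - assert (A1 : forall c, symb U K (fun p => pd c (ampl p)) (fun p => s p * L p) freq)
      by (intros c; eapply to_freq with (i := S K); [ nonneg | lia | apply symb_pd, symb_ampl ]).
    apply symb_amp with (fun p => s p * L p); [ amp_field | ].
    apply symb_plus; trivial; [ eapply to_freq; [ nonneg | | apply Sq ]; lia | ].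
    apply symb_plus; trivial.
    + assert (T := symb_hquad K ampl _ _ m k freq_nonneg symb_ampl_hess).
      apply symb_wk with (A := fun p => s p * L p * / rho p) (L := freq) (c := 1); [ nonneg | | | ].
      * intros p; destruct (fpos p) as [? [? [? ?]]]; assert (T' := Hrho p).
        assert (/ rho p <= 1) by (rewrite <- Rinv_1; apply Rinv_le_contravar; lra).
        apply Rmult_le_compat_l with (r := s p * L p) in H3; nra.
      * intros p; split; [ apply freq_nonneg | lra ].
      * eapply symb_amp; [ | factor ]; amp_field.
    + assert (A2 : symb U K (fun p x => fst k * pd 0 (ampl p) x + snd k * pd 1 (ampl p) x) (fun p => s p * L p) freq)
        by (apply symb_plus; trivial; apply symb_scalR; trivial using freq_nonneg).
      eapply symb_amp; [ | factor ]; amp_field.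
Qed.

(** Keeps the formulas of the correction and of the rest hidden from the later iteration. The bounds
    are the hypotheses of the section with [s] replaced by [s / rho] and [L] by [freq], two orders
    lower because the rest contains second derivatives of amplitudes. *)
Definition realises (vn : P -> pt -> R) (cr : nat -> P -> pt -> R) (rs : nat -> nat -> P -> pt -> R) : Prop :=
  (forall a b p x, U p x ->
     / 2 * (pd a (vn p) x * pd b (vn p) x) - / 2 * (pd a (v p) x * pd b (v p) x)
     + / 2 * (pd a (cr b p) x + pd b (cr a p) x) = f p x * coord a n * coord b n + rs a b p x) /\
  (forall a b, symb U K (rs a b) (fun p => (s p * / rho p) ^ 2) freq) /\
  (forall b, symb U (S K) (cr b) (fun p => s p * (1 + G p) * / freq p) freq) /\
  (exists X', (forall p, 0 <= X' p) /\ symb U (S (S K)) vn X' freq) /\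
  (forall a, symb U (S K) (fun p => pd a (vn p)) G freq) /\
  (forall a b, symb U K (fun p => hpd (vn p) a b) (fun p => s p * / rho p * freq p * rho p) freq) /\
  symb U K (fun p => hquad (vn p) m k) (fun p => s p * / rho p * freq p) freq /\
  symb U K (fun p => hquad (vn p) k k) (fun p => s p * / rho p * freq p * / rho p) freq /\
  symb U (S (S K)) (fun p x => vn p x - v p x) (fun p => s p * / freq p) freq.

Lemma primitive_step : (forall p, 0 <= X p) -> exists vn cr rs, realises vn cr rs.
Proof.
  intros HX; exists newv, corr, rest.
  split; [ exact prim_identity | ].
  split; [ exact symb_rest | ].
  split; [ exact symb_corr | ].
  split; [ exists (fun p => X p + s p); split; [ | apply symb_newv, HX ];
           intros p; assert (T := HX p); assert (T' := Hs p); lra | ].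
  split; [ exact symb_grad_newv | ].
  split; [ exact symb_hess_newv | ].
  split; [ exact symb_mixed_newv | ].
  split; [ exact symb_rr_newv | ].
  apply (symb_ext U HU _ wave); [ intros p x _; unfold newv; ring | exact symb_wave ].
Qed.
End Prim.

(** * One stage *)
(* The covectors (1,0), (0,1), (1,1), whose squares span the symmetric matrices, with completions
   [(dn, dz)] to bases and the dual bases [(dm, dk)]. *)
Definition dn (i : nat) : pt := match i with O => (1, 0) | 1%nat => (0, 1) | _ => (1, 1) end.
Definition dz (i : nat) : pt := match i with O => (0, 1) | _ => (1, 0) end.
Definition dm (i : nat) : pt := match i with O => (1, 0) | _ => (0, 1) end.
Definition dk (i : nat) : pt := match i with O => (0, 1) | 1%nat => (1, 0) | _ => (1, -1) end.

Lemma dual_basis i :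
  fst (dn i) * fst (dm i) + fst (dz i) * fst (dk i) = 1 /\
  fst (dn i) * snd (dm i) + fst (dz i) * snd (dk i) = 0 /\
  snd (dn i) * fst (dm i) + snd (dz i) * fst (dk i) = 0 /\
  snd (dn i) * snd (dm i) + snd (dz i) * snd (dk i) = 1 /\
  fst (dn i) * fst (dk i) + snd (dn i) * snd (dk i) = 0 /\
  fst (dn i) * fst (dm i) + snd (dn i) * snd (dm i) = 1.
Proof. destruct i as [ | [ | i]]; simpl; repeat split; ring. Qed.

(** The invariant of the iteration. The bounds [X] on [v] and [w] are merely qualitative and secure
    differentiability; the quantitative information sits in the gradient and Hessian of [v] and in
    the deficit. *)
Record stage {P : Type} (U : P -> pt -> Prop) (k : nat) (L s G rho : P -> R)
  (A : P -> nat -> nat -> pt -> R) (v w : P -> nat -> pt -> R) : Prop := Stage {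
  st_v : forall i, (i < 3)%nat -> exists X, (forall p, 0 <= X p) /\ symb U (S (S k)) (fun p => v p i) X L;
  st_w : forall b, (b < 2)%nat -> exists X, (forall p, 0 <= X p) /\ symb U (S k) (fun p => w p b) X L;
  st_grad : forall i a, (i < 3)%nat -> symb U (S k) (fun p => pd a (v p i)) G L;
  st_hess : forall i a b, (i < 3)%nat ->
    symb U k (fun p => hpd (v p i) a b) (fun p => s p * L p * rho p) L;
  st_mixed : forall i, (i < 3)%nat ->
    symb U k (fun p => hquad (v p i) (dm i) (dk i)) (fun p => s p * L p) L;
  st_ortho : forall i, (i < 3)%nat ->
    symb U k (fun p => hquad (v p i) (dk i) (dk i)) (fun p => s p * L p * / rho p) L;
  st_defect : forall a b, (a < 2)%nat -> (b < 2)%nat ->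
    symb U k (fun p => defect (A p) (v p) (w p) a b) (fun p => s p ^ 2) L }.

Section Step.
Context {P : Type} (U : P -> pt -> Prop) (HU : openf U) (L s G rho : P -> R) (A : P -> nat -> nat -> pt -> R).
Context (HL : forall p, 1 <= L p) (Hs : forall p, 0 < s p) (HG : forall p, s p <= G p) (Hrho : forall p, 1 <= rho p).
Context (HA : forall p x, U p x -> A p 0%nat 1%nat x = A p 1%nat 0%nat x).
Context (HB : exists B, 0 <= B /\ forall p x, U p x -> Rabs (fst x) <= B /\ Rabs (snd x) <= B).

Lemma stage_step K v w : stage U (S (S K)) L s G rho A v w ->
  exists vn wn, stage U K (freq L rho) (fun p => s p * / rho p) G rho A vn wn /\
    (forall i, (i < 3)%nat -> symb U (S (S K)) (fun p x => vn p i x - v p i x) (fun p => s p * / freq L rho p) (freq L rho)) /\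
    (forall b, (b < 2)%nat ->
       (exists C, forall p x, U p x -> Rabs (wn p b x - w p b x) <= C * (s p * (1 + G p))) /\
       forall a, symb U K (fun p => pd a (fun x => wn p b x - w p b x)) (fun p => s p * (1 + G p)) (freq L rho)).
Proof.
  intros [Hv Hw Hg Hh Hq Hr Hd].
  assert (Lf := L_le_freq L rho HL Hrho).
  assert (Fn : forall p, 0 <= freq L rho p) by (intros p; destruct (Lf p); lra).
  assert (F1 : forall p, 1 <= freq L rho p) by (intros p; assert (T := HL p); destruct (Lf p); lra).
  assert (Ln : forall p, 0 <= L p) by (intros p; destruct (Lf p); lra).
  set (D := fun a b p x => defect (A p) (v p) (w p) a b x).
  assert (HD : forall a b, (a < 2)%nat -> (b < 2)%nat -> exists C, 0 <= C /\ forall p x, U p x -> Rabs (D a b p x) <= C * s p ^ 2).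
  { intros a b Ha Hb; destruct (symb_bound U _ _ _ _ (Hd a b Ha Hb)) as [C [HC H]]; exists C; split; trivial.
    intros p x Hx; rewrite <- (Rabs_pos_eq (s p ^ 2)) by apply pow2_ge_0; apply H, Hx. }
  destruct (HD 0%nat 0%nat ltac:(lia) ltac:(lia)) as [C0 [HC0 B0]].
  destruct (HD 0%nat 1%nat ltac:(lia) ltac:(lia)) as [C1 [HC1 B1]].
  destruct (HD 1%nat 1%nat ltac:(lia) ltac:(lia)) as [C2 [HC2 B2]]; clear HD.
  (* The sum [C0 + C1 + C2] outweighs the entries of the deficit in each [f i], and the extra 1
     leaves the lower bound [s^2] on which the square root depends. *)
  set (Kc := C0 + C1 + C2 + 1).
  set (f := fun i p x => match i with
    | O => D 0%nat 0%nat p x - D 0%nat 1%nat p x + Kc * s p ^ 2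
    | 1%nat => D 1%nat 1%nat p x - D 0%nat 1%nat p x + Kc * s p ^ 2
    | _ => D 0%nat 1%nat p x + Kc * s p ^ 2 end).
  assert (Sf : forall i, symb U (S (S K)) (f i) (fun p => s p ^ 2) L).
  { assert (SK : symb U (S (S K)) (fun p _ => Kc * s p ^ 2) (fun p => s p ^ 2) L).
    { apply symb_const; trivial; exists (Rabs Kc); intros p; rewrite Rabs_mult, (Rabs_pos_eq (s p ^ 2)); [ lra | apply pow2_ge_0 ]. }
    assert (S0 := Hd 0%nat 0%nat ltac:(lia) ltac:(lia)).
    assert (S1 := Hd 0%nat 1%nat ltac:(lia) ltac:(lia)).
    assert (S2 := Hd 1%nat 1%nat ltac:(lia) ltac:(lia)).
    intros [ | [ | i]]; unfold f; cbv beta iota; apply symb_plus; trivial; apply symb_minus; trivial. }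
  assert (Hf : forall i p x, U p x -> s p ^ 2 <= f i p x).
  { intros i p x Hx; assert (T0 := B0 p x Hx); assert (T1 := B1 p x Hx); assert (T2 := B2 p x Hx).
    assert (T := pow2_ge_0 (s p)).
    apply Rabs_le_between in T0; apply Rabs_le_between in T1; apply Rabs_le_between in T2.
    assert (0 <= C0 * s p ^ 2) by (apply Rmult_le_pos; trivial).
    assert (0 <= C1 * s p ^ 2) by (apply Rmult_le_pos; trivial).
    assert (0 <= C2 * s p ^ 2) by (apply Rmult_le_pos; trivial).
    unfold f, Kc; destruct i as [ | [ | i]]; lra. }
  assert (PS : forall i, (i < 3)%nat -> exists vn cr rs,
    realises U L s G rho (dn i) (dm i) (dk i) K (fun p => v p i) (f i) vn cr rs).
  { intros i Hi; destruct (Hv i Hi) as [X [HX HvX]]; destruct (dual_basis i) as [E1 [E2 [E3 [E4 [E5 E6]]]]].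
    apply (primitive_step U HU L s G rho HL Hs HG Hrho (dn i) (dm i) (dz i) (dk i) E1 E2 E3 E4 E5 E6 K (fun p => v p i) (f i) X); auto. }
  destruct (PS 0%nat ltac:(lia)) as [v0 [c0 [r0 [I0 [R0 [Cr0 [X0 [G0 [H0 [Q0 [O0 W0]]]]]]]]]]].
  destruct (PS 1%nat ltac:(lia)) as [v1 [c1 [r1 [I1 [R1 [Cr1 [X1 [G1 [H1 [Q1 [O1 W1]]]]]]]]]]].
  destruct (PS 2%nat ltac:(lia)) as [v2 [c2 [r2 [I2 [R2 [Cr2 [X2 [G2 [H2 [Q2 [O2 W2]]]]]]]]]]]; clear PS.
  (* The added multiple of the three squares sums up to [Kc s^2] times the matrix with rows (2, 1)
     and (1, 2); this is the linear field with that gradient. *)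
  set (lin := fun (b : nat) (p : P) (x : pt) => Kc * s p ^ 2 * match b with O => 2 * coord 0 x + coord 1 x | _ => coord 0 x + 2 * coord 1 x end).
  set (cr := fun b p x => c0 b p x + c1 b p x + c2 b p x).
  set (z := fun b p x => cr b p x - lin b p x).
  exists (fun p i => match i with O => v0 p | 1%nat => v1 p | _ => v2 p end), (fun p b x => w p b x + z b p x).
  assert (Scr : forall b, symb U (S K) (cr b) (fun p => s p * (1 + G p) * / freq L rho p) (freq L rho))
    by (intros b; unfold cr; repeat apply symb_plus; auto).
  assert (Icr : forall a b p x, U p x -> is_pd a (cr b p) x (pd a (c0 b p) x + pd a (c1 b p) x + pd a (c2 b p) x)).
  { intros a b p x Hx; repeat apply is_pd_plus; eapply symb_is_pd; eauto. }
  set (dlin := fun a b p => Kc * s p ^ 2 * match a, b with O, O => 2 | O, S _ => 1 | S _, O => 1 | _, _ => 2 end : R).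
  assert (Ilin : forall a b p x, is_pd a (lin b p) x (dlin a b p)).
  { intros a b p x; unfold lin.
    assert (Q0' := is_pd_coord a 0 x); assert (Q1' := is_pd_coord a 1 x).
    destruct b as [ | b]; (evar (d : R); replace (dlin a _ p) with d;
      [ eapply is_pd_mult; [ apply is_pd_const | eapply is_pd_plus;
         [ first [ exact Q0' | eapply is_pd_mult; [ apply is_pd_const | exact Q0' ] ]
         | first [ exact Q1' | eapply is_pd_mult; [ apply is_pd_const | exact Q1' ] ] ] ] | ]);
      unfold d, dlin; destruct a; simpl; ring. }
  assert (Iz : forall a b p x, U p x -> is_pd a (z b p) x (pd a (cr b p) x - dlin a b p)).
  { intros a b p x Hx; apply is_pd_minus; [ | apply Ilin ].
    apply pd_correct; eapply is_pd_ex, Icr; trivial. }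
  assert (Sz1 : forall a b, symb U K (fun p => pd a (z b p)) (fun p => s p * (1 + G p)) (freq L rho)).
  { intros a b; apply (symb_ext U HU _ (fun p x => pd a (cr b p) x - dlin a b p)).
    { intros p x Hx; symmetry; apply is_pd_unique, Iz, Hx. }
    apply symb_minus; trivial.
    - eapply symb_amp; [ | apply (symb_pd _ _ _ _ _ a (Scr b)) ].
      intros p; simpl; assert (T := F1 p); field; lra.
    - apply symb_const; trivial; exists (Rabs Kc * 2); intros p; unfold dlin.
      rewrite !Rabs_mult, (Rabs_pos_eq (s p ^ 2)) by apply pow2_ge_0.
      assert (T : s p ^ 2 <= s p * (1 + G p)) by (assert (T1 := Hs p); assert (T2 := HG p); simpl; apply Rmult_le_compat_l; lra).
      assert (T' := Rabs_pos Kc); assert (T2 := pow2_ge_0 (s p)).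
      apply Rle_trans with (Rabs Kc * s p ^ 2 * 2).
      + apply Rmult_le_compat_l; [ apply Rmult_le_pos; trivial | destruct a, b; rewrite Rabs_pos_eq; lra ].
      + replace (Rabs Kc * 2 * (s p * (1 + G p))) with (Rabs Kc * (s p * (1 + G p)) * 2) by ring.
        apply Rmult_le_compat_r; [ lra | apply Rmult_le_compat_l; trivial ]. }
  destruct HB as [B [HB0 HB1]].
  (* Unlike the correction, the linear field has no factor [/ freq]; its values are of order [s^2]
     because the domain is bounded. *)
  assert (Bz : forall b, exists C, forall p x, U p x -> Rabs (z b p x) <= C * (s p * (1 + G p))).
  { intros b; destruct (symb_bound U _ _ _ _ (Scr b)) as [C [HC H]].
    exists (C + Rabs Kc * (3 * B)); intros p x Hx.
    assert (T1 := Hs p); assert (T2 := HG p); assert (T3 := F1 p).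
    assert (T4 : / freq L rho p <= 1) by (rewrite <- Rinv_1; apply Rinv_le_contravar; lra).
    assert (T5 : 0 < / freq L rho p) by (apply Rinv_0_lt_compat; lra).
    assert (T6 : 0 <= s p * (1 + G p)) by (apply Rmult_le_pos; lra).
    unfold z, Rminus; apply Rle_trans with (1 := Rabs_triang _ _); rewrite Rabs_Ropp, Rmult_plus_distr_r.
    apply Rplus_le_compat.
    - apply Rle_trans with (1 := H p x Hx); apply Rmult_le_compat_l; trivial.
      rewrite Rabs_pos_eq by (apply Rmult_le_pos; lra).
      apply Rle_trans with (s p * (1 + G p) * 1); [ apply Rmult_le_compat_l; lra | lra ].
    - unfold lin; rewrite !Rabs_mult, (Rabs_pos_eq (s p ^ 2)) by apply pow2_ge_0.
      destruct (HB1 p x Hx) as [X1' X2'].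
      replace (Rabs Kc * (3 * B) * (s p * (1 + G p))) with (Rabs Kc * (s p * (1 + G p)) * (3 * B)) by ring.
      apply Rmult_le_compat; try apply Rabs_pos.
      + apply Rmult_le_pos; [ apply Rabs_pos | apply pow2_ge_0 ].
      + apply Rmult_le_compat_l; [ apply Rabs_pos | simpl; apply Rmult_le_compat_l; lra ].
      + apply Rabs_le_between in X1'; apply Rabs_le_between in X2'; apply Rabs_le.
        destruct b; simpl; lra. }
  assert (Iw : forall a b p x, (b < 2)%nat -> U p x -> is_pd a (w p b) x (pd a (w p b) x)).
  { intros a b p x Hb Hx; destruct (Hw b Hb) as [X [HX HwX]]; eapply (symb_is_pd U _ (fun p => w p b)); eauto. }
  split; [ split | split ].
  - intros [ | [ | [ | i]]] Hi; trivial; lia.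
  - intros b Hb; destruct (Hw b Hb) as [X [HX HwX]].
    exists (fun p => X p + s p * (1 + G p) * (1 + Rabs Kc)).
    assert (HXp : forall p, 0 <= s p * (1 + G p)) by (intros p; assert (T1 := Hs p); assert (T2 := HG p); apply Rmult_le_pos; lra).
    assert (HKp : forall p, 0 <= s p * (1 + G p) * (1 + Rabs Kc))
      by (intros p; apply Rmult_le_pos; [ auto | assert (T := Rabs_pos Kc); lra ]).
    split; [ intros p; assert (T := HX p); assert (T' := HKp p); lra | ].
    apply symb_plus; trivial.
    + apply symb_wk with (A := X) (L := L) (c := 1); trivial.
      * intros p; assert (T := HX p); assert (T' := HKp p); lra.
      * eapply symb_le; [ | exact HwX ]; lia.
    + apply (symb_intro U HU _ _ _ _ (fun a p => pd a (z b p))).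
      * intros p x Hx; apply @continuous_minus; [ eapply symb_cont; eauto | ].
        apply (continuous_ext (fun y => Kc * s p ^ 2 * dot (match b with O => (2, 1) | _ => (1, 2) end) y));
          [ | apply continuous_linear ].
        intros y; unfold lin, dot; destruct b; simpl; ring.
      * destruct (Bz b) as [C HC]; exists (Rabs C); intros p x Hx; apply Rle_trans with (1 := HC p x Hx).
        assert (T1 := Rabs_pos C); assert (T2 := Rle_abs C); assert (T3 := HX p); assert (T4 := HXp p); assert (T5 := Rabs_pos Kc).
        apply Rle_trans with (Rabs C * (s p * (1 + G p))); [ apply Rmult_le_compat_r; lra | ].
        apply Rmult_le_compat_l; trivial.
        apply Rle_trans with (s p * (1 + G p) * 1); [ lra | ].
        assert (s p * (1 + G p) * 1 <= s p * (1 + G p) * (1 + Rabs Kc)) by (apply Rmult_le_compat_l; lra).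
        lra.
      * intros a p x Hx; apply pd_correct; eapply is_pd_ex, Iz, Hx.
      * intros a; apply symb_wk with (A := fun p => s p * (1 + G p)) (L := freq L rho) (c := 1).
        -- trivial.
        -- intros p; assert (T1 := F1 p); assert (T2 := HX p); assert (T3 := HXp p); assert (T5 := Rabs_pos Kc).
           rewrite Rmult_1_l; apply Rle_trans with (s p * (1 + G p) * 1); [ lra | ].
           apply Rmult_le_compat; try lra.
           assert (s p * (1 + G p) * 1 <= s p * (1 + G p) * (1 + Rabs Kc)) by (apply Rmult_le_compat_l; lra).
           lra.
        -- intros p; split; [ trivial | lra ].
        -- apply Sz1.
  - intros [ | [ | [ | i]]] a Hi; trivial; lia.
  - intros [ | [ | [ | i]]] a b Hi; trivial; lia.
  - intros [ | [ | [ | i]]] Hi; trivial; lia.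
  - intros [ | [ | [ | i]]] Hi; trivial; lia.
  - intros a b Ha Hb.
    (* The i-th wave moves component [i] only, and the metric is a sum over components, so the three
       identities add without cross terms and only the rests survive. *)
    apply (symb_ext U HU _ (fun p x => - (r0 a b p x + r1 a b p x + r2 a b p x))).
    + intros p x Hx.
      assert (Ewn : forall a b, (b < 2)%nat -> pd a (fun x => w p b x + z b p x) x = pd a (w p b) x + (pd a (c0 b p) x + pd a (c1 b p) x + pd a (c2 b p) x - dlin a b p)).
      { intros a' b' Hb'; apply is_pd_unique, is_pd_plus; auto.
        rewrite <- (is_pd_unique _ _ _ _ (Icr a' b' p x Hx)); auto. }
      unfold defect; rewrite !Ewn by trivial.
      assert (J0 := I0 a b p x Hx); assert (J1 := I1 a b p x Hx); assert (J2 := I2 a b p x Hx).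
      assert (HAx := HA p x Hx).
      assert (ED : forall i, (i < 3)%nat -> f 0%nat p x * coord a (dn 0) * coord b (dn 0)
         + f 1%nat p x * coord a (dn 1) * coord b (dn 1) + f 2%nat p x * coord a (dn 2) * coord b (dn 2)
         = D a b p x + dlin a b p).
      { intros _ _; unfold f, dlin.
        assert (ES : D 1%nat 0%nat p x = D 0%nat 1%nat p x) by (unfold D, defect; rewrite HAx; ring).
        destruct a as [ | [ | a]], b as [ | [ | b]]; try lia; simpl; try rewrite ES; ring. }
      specialize (ED 0%nat ltac:(lia)); unfold D, defect in ED.
      assert (Edl : dlin b a p = dlin a b p) by (unfold dlin; destruct a, b; reflexivity).
      rewrite Edl; lra.
    + apply symb_opp; trivial; repeat apply symb_plus; trivial.
  - intros [ | [ | [ | i]]] Hi; trivial; lia.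
  - intros b Hb; split.
    + destruct (Bz b) as [C HC]; exists C; intros p x Hx; replace (w p b x + z b p x - w p b x) with (z b p x) by ring; auto.
    + intros a.
      replace (fun p => pd a (fun x => w p b x + z b p x - w p b x)) with (fun p => pd a (z b p)); [ apply Sz1 | ].
      apply functional_extensionality; intros p; f_equal; apply functional_extensionality; intros x; ring.
Qed.
End Step.

(** * Three stages *)
Section Iterate.
Context {P : Type} (U : P -> pt -> Prop) (HU : openf U) (G rho H : P -> R) (A : P -> nat -> nat -> pt -> R).
Context (Hrho : forall p, 1 <= rho p).
Context (HA : forall p x, U p x -> A p 0%nat 1%nat x = A p 1%nat 0%nat x).
Context (HB : exists B, 0 <= B /\ forall p x, U p x -> Rabs (fst x) <= B /\ Rabs (snd x) <= B).

(** Second derivatives are compared for [w] only: a stage bounds the Hessian of [v] directly but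
    records none for [w], whose Hessian has to be accumulated from the increments. *)
Definition close (s : P -> R) (v w v' w' : P -> nat -> pt -> R) : Prop :=
  exists C, 0 <= C /\ forall p x, U p x ->
    (forall i, (i < 3)%nat -> Rabs (v' p i x - v p i x) <= C * s p /\
       forall a, Rabs (pd a (v' p i) x - pd a (v p i) x) <= C * s p) /\
    (forall b, (b < 2)%nat -> Rabs (w' p b x - w p b x) <= C * (s p * (1 + G p)) /\
       (forall a, Rabs (pd a (w' p b) x - pd a (w p b) x) <= C * (s p * (1 + G p))) /\
       (forall a c, Rabs (hpd (w' p b) a c x - hpd (w p b) a c x) <= C * (H p * (1 + G p)))).

Lemma Rabs_chain a b c x y : Rabs (a - b) <= x -> Rabs (b - c) <= y -> Rabs (a - c) <= y + x.
Proof.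
  intros Hx Hy; replace (a - c) with ((a - b) + (b - c)) by ring.
  apply Rle_trans with (1 := Rabs_triang _ _); lra.
Qed.

(** The constants add because the sizes decrease from one stage to the next. *)
Lemma close_trans s s' v w v' w' v'' w'' :
  (forall p, 0 <= G p) -> (forall p, s' p <= s p) ->
  close s v w v' w' -> close s' v' w' v'' w'' -> close s v w v'' w''.
Proof.
  intros HG Hs [C [HC H1]] [D [HD H2]]; exists (C + D); split; [ lra | ].
  intros p x Hx; destruct (H1 p x Hx) as [K1 K2]; destruct (H2 p x Hx) as [K3 K4].
  assert (M : D * s' p <= D * s p) by (apply Rmult_le_compat_l; trivial).
  assert (M' : D * (s' p * (1 + G p)) <= D * (s p * (1 + G p)))
    by (apply Rmult_le_compat_l; trivial; apply Rmult_le_compat_r; trivial; assert (T := HG p); lra).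
  rewrite !Rmult_plus_distr_r; split.
  - intros i Hi; destruct (K1 i Hi) as [E1 E2]; destruct (K3 i Hi) as [E3 E4]; split.
    + eapply Rabs_chain; [ eapply Rle_trans; [ exact E3 | exact M ] | exact E1 ].
    + intros a; eapply Rabs_chain; [ eapply Rle_trans; [ apply E4 | exact M ] | apply E2 ].
  - intros b Hb; destruct (K2 b Hb) as [E1 [E2 E5]]; destruct (K4 b Hb) as [E3 [E4 E6]]; split; [ | split ].
    + eapply Rabs_chain; [ eapply Rle_trans; [ exact E3 | exact M' ] | exact E1 ].
    + intros a; eapply Rabs_chain; [ eapply Rle_trans; [ apply E4 | exact M' ] | apply E2 ].
    + intros a c; eapply Rabs_chain; [ apply E6 | apply E5 ].
Qed.

Lemma pd_minus_symb k g g' X X' L L' a p x : symb U (S k) g X L -> symb U (S k) g' X' L' -> U p x ->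
  pd a (fun y => g' p y - g p y) x = pd a (g' p) x - pd a (g p) x.
Proof. intros Hg Hg' Hx; apply is_pd_unique, is_pd_minus; eapply symb_is_pd; eauto. Qed.

Lemma hpd_minus_symb k g g' X X' L L' a c p x : symb U (S (S k)) g X L -> symb U (S (S k)) g' X' L' -> U p x ->
  hpd (fun y => g' p y - g p y) a c x = hpd (g' p) a c x - hpd (g p) a c x.
Proof.
  intros Hg Hg' Hx; apply is_pd_unique; eapply is_pd_ext_loc.
  - generalize (HU p x Hx); apply filter_imp; intros y Hy; symmetry; eapply pd_minus_symb; eauto.
  - apply is_pd_minus; [ apply (symb_is_pd U _ _ _ _ c p x (symb_pd _ _ _ _ _ a Hg') Hx)
      | apply (symb_is_pd U _ _ _ _ c p x (symb_pd _ _ _ _ _ a Hg) Hx) ].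
Qed.

(** The final order is [S K] and not [K] so that the gradient of the increment of [w] still has a
    derivative to estimate. *)
Lemma stage_close K L s v w :
  (forall p, 1 <= L p) -> (forall p, 0 < s p) -> (forall p, s p <= G p) ->
  (forall p, s p * L p * rho p = H p) ->
  stage U (S (S (S K))) L s G rho A v w ->
  exists vn wn, stage U (S K) (freq L rho) (fun p => s p * / rho p) G rho A vn wn /\ close s v w vn wn.
Proof.
  intros HL Hs HG HH St.
  destruct (stage_step U HU L s G rho A HL Hs HG Hrho HA HB (S K) v w St) as [vn [wn [St' [Cv Cw]]]].
  exists vn, wn; split; trivial.
  assert (F1 : forall p, 1 <= freq L rho p) by (intros p; apply freq_ge1; trivial).
  assert (Fi : forall p, 0 < / freq L rho p <= 1).
  { intros p; assert (T := F1 p); split; [ apply Rinv_0_lt_compat; lra | rewrite <- Rinv_1; apply Rinv_le_contravar; lra ]. }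
  assert (Gp : forall p, 0 < s p * (1 + G p)) by (intros p; assert (T := Hs p); assert (T' := HG p); apply Rmult_lt_0_compat; lra).
  assert (Bv : forall i, (i < 3)%nat -> exists C, 0 <= C /\ forall p x, U p x ->
     Rabs (vn p i x - v p i x) <= C * s p /\ forall a, Rabs (pd a (vn p i) x - pd a (v p i) x) <= C * s p).
  { intros i Hi; assert (S1 := Cv i Hi).
    destruct (st_v _ _ _ _ _ _ _ _ _ St i Hi) as [X [_ SX]]; destruct (st_v _ _ _ _ _ _ _ _ _ St' i Hi) as [X' [_ SX']].
    destruct (symb_bound U _ _ _ _ S1) as [C0 [HC0 B0]].
    destruct (symb_bound U _ _ _ _ (symb_pd _ _ _ _ _ 0%nat S1)) as [C1 [HC1 B1]].
    destruct (symb_bound U _ _ _ _ (symb_pd _ _ _ _ _ 1%nat S1)) as [C2 [HC2 B2]].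
    exists (C0 + C1 + C2); split; [ lra | ]; intros p x Hx.
    assert (Tf := F1 p); assert (Ti := Fi p); assert (Ts := Hs p).
    assert (Q0 : C0 * Rabs (s p * / freq L rho p) <= C0 * s p).
    { rewrite Rabs_pos_eq by (apply Rmult_le_pos; lra); apply Rmult_le_compat_l; trivial.
      apply Rle_trans with (s p * 1); [ apply Rmult_le_compat_l; lra | lra ]. }
    assert (Q1 : Rabs (s p * / freq L rho p * freq L rho p) = s p)
      by (rewrite Rmult_assoc, Rinv_l, Rmult_1_r by lra; apply Rabs_pos_eq; lra).
    assert (0 <= C0 * s p) by (apply Rmult_le_pos; lra).
    assert (0 <= C1 * s p) by (apply Rmult_le_pos; lra).
    assert (0 <= C2 * s p) by (apply Rmult_le_pos; lra).
    rewrite !Rmult_plus_distr_r; split.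
    - assert (T := B0 p x Hx); lra.
    - assert (SXl : symb U (S (S (S K))) (fun p => v p i) X L) by (eapply symb_le; [ | exact SX ]; lia).
      intros a; rewrite <- (pd_minus_symb _ _ _ _ _ _ _ a p x SXl SX' Hx).
      destruct a as [ | a]; [ assert (T := B1 p x Hx) | assert (T := B2 p x Hx) ]; rewrite Q1 in T;
        [ lra | change (pd (S a)) with (pd 1); lra ]. }
  assert (Bw : forall b, (b < 2)%nat -> exists C, 0 <= C /\ forall p x, U p x ->
     Rabs (wn p b x - w p b x) <= C * (s p * (1 + G p)) /\
       (forall a, Rabs (pd a (wn p b) x - pd a (w p b) x) <= C * (s p * (1 + G p))) /\
       (forall a c, Rabs (hpd (wn p b) a c x - hpd (w p b) a c x) <= C * (H p * (1 + G p)))).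
  { intros b Hb; destruct (Cw b Hb) as [[C0 B0] S1].
    destruct (st_w _ _ _ _ _ _ _ _ _ St b Hb) as [X [_ SX]]; destruct (st_w _ _ _ _ _ _ _ _ _ St' b Hb) as [X' [_ SX']].
    destruct (symb_bound U _ _ _ _ (S1 0%nat)) as [C1 [HC1 B1]].
    destruct (symb_bound U _ _ _ _ (S1 1%nat)) as [C2 [HC2 B2]].
    destruct (symb_bound U _ _ _ _ (symb_pd _ _ _ _ _ 0%nat (S1 0%nat))) as [C3 [HC3 B3]].
    destruct (symb_bound U _ _ _ _ (symb_pd _ _ _ _ _ 1%nat (S1 0%nat))) as [C4 [HC4 B4]].
    destruct (symb_bound U _ _ _ _ (symb_pd _ _ _ _ _ 0%nat (S1 1%nat))) as [C5 [HC5 B5]].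
    destruct (symb_bound U _ _ _ _ (symb_pd _ _ _ _ _ 1%nat (S1 1%nat))) as [C6 [HC6 B6]].
    assert (TC := Rabs_pos C0).
    exists (Rabs C0 + C1 + C2 + C3 + C4 + C5 + C6); split; [ lra | ]; intros p x Hx.
    assert (Tf := F1 p); assert (Tg := Gp p); assert (Ts := Hs p); assert (TG := HG p).
    assert (Q1 : Rabs (s p * (1 + G p)) = s p * (1 + G p)) by (apply Rabs_pos_eq; lra).
    (* One more derivative of the increment costs [freq], and [s * freq] is the invariant [H]. *)
    assert (QH : s p * (1 + G p) * freq L rho p = H p * (1 + G p)) by (rewrite <- HH; unfold freq; ring).
    assert (TH : 0 <= H p * (1 + G p)) by (rewrite <- QH; apply Rmult_le_pos; lra).
    assert (Q2 : Rabs (s p * (1 + G p) * freq L rho p) = H p * (1 + G p)) by (rewrite QH; apply Rabs_pos_eq; lra).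
    assert (SXl : symb U (S (S K)) (fun p => w p b) X L) by (eapply symb_le; [ | exact SX ]; lia).
    assert (Big : forall c, 0 <= c <= Rabs C0 + C1 + C2 + C3 + C4 + C5 + C6 -> forall y t, 0 <= t -> y <= c * t ->
       y <= (Rabs C0 + C1 + C2 + C3 + C4 + C5 + C6) * t).
    { intros c Hc y t Ht Hy; apply Rle_trans with (1 := Hy), Rmult_le_compat_r; lra. }
    split; [ | split ].
    - apply Big with (Rabs C0); try lra; apply Rle_trans with (1 := B0 p x Hx).
      apply Rmult_le_compat_r; [ lra | apply Rle_abs ].
    - intros a; rewrite <- (pd_minus_symb _ _ _ _ _ _ _ a p x SXl SX' Hx).
      destruct a as [ | a]; [ assert (T := B1 p x Hx) | assert (T := B2 p x Hx) ]; rewrite Q1 in T;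
        [ apply Big with C1; lra | change (pd (S a)) with (pd 1); apply Big with C2; lra ].
    - intros a c; rewrite <- (hpd_minus_symb _ _ _ _ _ _ _ a c p x SXl SX' Hx).
      change (fun p0 => pd 0 (pd 0 (fun x : pt => wn p0 b x - w p0 b x))) with (fun p0 => hpd (fun x : pt => wn p0 b x - w p0 b x) 0 0) in B3.
      assert (T3 := B3 p x Hx); assert (T4 := B4 p x Hx); assert (T5 := B5 p x Hx); assert (T6 := B6 p x Hx).
      cbv beta in T3, T4, T5, T6; rewrite Q2 in T3, T4, T5, T6; unfold hpd.
      destruct a as [ | a], c as [ | c]; [ apply Big with C3 | apply Big with C4 | apply Big with C5 | apply Big with C6 ]; try lra; trivial. }
  destruct (Bv 0%nat ltac:(lia)) as [E0 [P0 N0]]; destruct (Bv 1%nat ltac:(lia)) as [E1 [P1 N1]];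
    destruct (Bv 2%nat ltac:(lia)) as [E2 [P2 N2]]; destruct (Bw 0%nat ltac:(lia)) as [E3 [P3 N3]];
    destruct (Bw 1%nat ltac:(lia)) as [E4 [P4 N4]].
  exists (E0 + E1 + E2 + E3 + E4); split; [ lra | ]; intros p x Hx.
  assert (Ts := Hs p); assert (Tg := Gp p).
  assert (TH : 0 <= H p * (1 + G p)).
  { rewrite <- HH; assert (T1 := HL p); assert (T2 := Hrho p); assert (T3 := HG p); repeat apply Rmult_le_pos; lra. }
  assert (Big : forall c, 0 <= c <= E0 + E1 + E2 + E3 + E4 -> forall y t, 0 <= t -> y <= c * t -> y <= (E0 + E1 + E2 + E3 + E4) * t).
  { intros c Hc y t Ht Hy; apply Rle_trans with (1 := Hy), Rmult_le_compat_r; lra. }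
  split.
  - intros [ | [ | [ | i]]] Hi; try lia;
      [ destruct (N0 p x Hx) as [T1 T2] | destruct (N1 p x Hx) as [T1 T2] | destruct (N2 p x Hx) as [T1 T2] ];
      (split; [ | intros a; specialize (T2 a) ]); (eapply Big; [ | lra | eassumption ]); lra.
  - intros [ | [ | b]] Hi; try lia;
      [ destruct (N3 p x Hx) as [T1 [T2 T3]] | destruct (N4 p x Hx) as [T1 [T2 T3]] ];
      (split; [ | split; [ intros a; specialize (T2 a) | intros a c; specialize (T3 a c) ] ]);
      (eapply Big; [ | | eassumption ]); lra.
Qed.

(** The orders run through 8, 6, 4, 2. Order 2 still means four derivatives of [v] and three of [w],
    enough for second derivatives that are Lipschitz at small distances. *)
Lemma three_stages L s v w :
  (forall p, 1 <= L p) -> (forall p, 0 < s p) -> (forall p, s p <= G p) ->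
  (forall p, s p * L p * rho p = H p) ->
  stage U 8 L s G rho A v w ->
  exists vn wn, stage U 2 (fun p => L p * rho p ^ 3) (fun p => s p * / rho p ^ 3) G rho A vn wn /\ close s v w vn wn.
Proof.
  intros HL Hs HG HH St.
  assert (Ri : forall p, 0 < / rho p <= 1).
  { intros p; assert (T := Hrho p); split; [ apply Rinv_0_lt_compat; lra | rewrite <- Rinv_1; apply Rinv_le_contravar; lra ]. }
  set (D := fun s : P -> R => fun p => s p * / rho p).
  assert (Dpos : forall s, (forall p, 0 < s p) -> forall p, 0 < D s p) by (intros t Ht p; apply Rmult_lt_0_compat; [ auto | apply Ri ]).
  assert (Dle : forall s, (forall p, 0 < s p) -> forall p, D s p <= s p).
  { intros t Ht p; unfold D; assert (T := Ht p); assert (T' := Ri p).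
    apply Rle_trans with (t p * 1); [ apply Rmult_le_compat_l; lra | lra ]. }
  assert (DH : forall L s, (forall p, s p * L p * rho p = H p) -> forall p, D s p * freq L rho p * rho p = H p).
  { intros L' s' E p; rewrite <- E; unfold D, freq; assert (T := Hrho p); field; lra. }
  assert (G0 : forall p, 0 <= G p) by (intros p; assert (T := Hs p); assert (T' := HG p); lra).
  assert (F1 : forall L, (forall p, 1 <= L p) -> forall p, 1 <= freq L rho p) by (intros; apply freq_ge1; trivial).
  assert (D1 := Dpos s Hs); assert (D2 := Dpos _ D1).
  assert (L1 := Dle s Hs); assert (L2 := Dle _ D1).
  assert (G1 : forall p, D s p <= G p) by (intros p; apply Rle_trans with (1 := L1 p); trivial).
  assert (G2 : forall p, D (D s) p <= G p) by (intros p; apply Rle_trans with (1 := L2 p); trivial).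
  destruct (stage_close 5 L s v w HL Hs HG HH St) as [v1 [w1 [St1 C1]]].
  destruct (stage_close 3 _ (D s) v1 w1 (F1 _ HL) D1 G1 (DH _ _ HH) St1) as [v2 [w2 [St2 C2]]].
  destruct (stage_close 1 _ (D (D s)) v2 w2 (F1 _ (F1 _ HL)) D2 G2 (DH _ _ (DH _ _ HH)) St2) as [v3 [w3 [St3 C3]]].
  exists v3, w3; split.
  - replace (fun p => L p * rho p ^ 3) with (freq (freq (freq L rho) rho) rho)
      by (apply functional_extensionality; intros p; unfold freq; ring).
    replace (fun p => s p * / rho p ^ 3) with (D (D (D s)))
      by (apply functional_extensionality; intros p; unfold D; assert (T := Hrho p); field; lra).
    exact St3.
  - eapply close_trans; [ exact G0 | exact L1 | exact C1 | ].
    eapply close_trans; [ exact G0 | exact L2 | exact C2 | exact C3 ].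
Qed.
End Iterate.

(** * Mollification of the data *)
(** The open companion of [nbhd]: estimates live on these sets, whose radii between [l] and [2 l]
    leave room for the mollifier. *)
Definition thick (om : pt -> Prop) (r : R) (x : pt) : Prop := exists y, om y /\ dist2 x y < r.

Lemma thick_near om r d x y : thick om r x -> dist2 y x <= d -> thick om (r + d) y.
Proof.
  intros [z [Hz Hd]] H; exists z; split; trivial; assert (T := dist2_triangle y x z); lra.
Qed.

Lemma thick_mono om r r' x : r <= r' -> thick om r x -> thick om r' x.
Proof. intros H [z [Hz Hd]]; exists z; split; trivial; lra. Qed.

Lemma thick_open om r x : thick om r x -> locally x (thick om r).
Proof.
  intros [z [Hz Hd]]; apply (proj2 (locally_dist2 x _)); exists (r - dist2 x z); split; [ lra | ].
  intros y Hy; exists z; split; trivial; assert (T := dist2_triangle y x z); lra.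
Qed.

Lemma thick_box om r d x y : thick om r x -> Rabs (fst y - fst x) <= d -> Rabs (snd y - snd x) <= d ->
  thick om (r + 2 * d) y.
Proof.
  intros H H1 H2; apply thick_near with x; trivial.
  assert (T := dist2_le_sum y x); lra.
Qed.

(** First and second derivatives have separate bounds because the gradient of [v] enters the
    conclusion through its own norm and not through [M]. *)
Definition C2bd (W : pt -> Prop) (g : pt -> R) (B1 B2 : R) : Prop :=
  (forall x, W x -> continuous g x) /\
  forall a, (forall x, W x -> ex_pd a g x /\ continuous (pd a g) x /\ Rabs (pd a g x) <= B1) /\
    forall b x, W x -> ex_pd b (pd a g) x /\ continuous (hpd g a b) x /\ Rabs (hpd g a b x) <= B2.

Section C2bdFacts.
Context (W : pt -> Prop) (g : pt -> R) (B1 B2 : R) (H : C2bd W g B1 B2).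

Lemma C2bd_continuous x : W x -> continuous g x.
Proof. exact (proj1 H x). Qed.

Lemma C2bd_ex_pd a x : W x -> ex_pd a g x.
Proof. intros Hx; exact (proj1 (proj1 (proj2 H a) x Hx)). Qed.

Lemma C2bd_continuous_pd a x : W x -> continuous (pd a g) x.
Proof. intros Hx; exact (proj1 (proj2 (proj1 (proj2 H a) x Hx))). Qed.

Lemma C2bd_pd_le a x : W x -> Rabs (pd a g x) <= B1.
Proof. intros Hx; exact (proj2 (proj2 (proj1 (proj2 H a) x Hx))). Qed.

Lemma C2bd_ex_hpd a b x : W x -> ex_pd b (pd a g) x.
Proof. intros Hx; exact (proj1 (proj2 (proj2 H a) b x Hx)). Qed.

Lemma C2bd_continuous_hpd a b x : W x -> continuous (hpd g a b) x.
Proof. intros Hx; exact (proj1 (proj2 (proj2 (proj2 H a) b x Hx))). Qed.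

Lemma C2bd_hpd_le a b x : W x -> Rabs (hpd g a b x) <= B2.
Proof. intros Hx; exact (proj2 (proj2 (proj2 (proj2 H a) b x Hx))). Qed.
End C2bdFacts.

(** The path changes one coordinate at a time; its corner [(fst y, snd x)] stays in the box, which
    is all that has to lie in [W]. *)
Lemma box_lipschitz (W : pt -> Prop) g B d x y :
  (forall z, Rabs (fst z - fst x) <= d -> Rabs (snd z - snd x) <= d -> W z) ->
  (forall a z, W z -> ex_pd a g z /\ Rabs (pd a g z) <= B) ->
  Rabs (fst y - fst x) <= d -> Rabs (snd y - snd x) <= d ->
  Rabs (g y - g x) <= B * (2 * d).
Proof.
  intros HW Hg H1 H2.
  assert (Hd : 0 <= d) by (apply Rle_trans with (2 := H1), Rabs_pos).
  assert (B0 : 0 <= B).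
  { destruct (Hg 0%nat x) as [_ T]; [ | apply Rle_trans with (2 := T), Rabs_pos ].
    apply HW; rewrite Rminus_diag, Rabs_R0; trivial. }
  assert (E1 : Rabs (g (fst y, snd x) - g x) <= B * Rabs (fst y - fst x)).
  { replace (g x) with ((fun t => g (t, snd x)) (fst x)) by (destruct x; reflexivity).
    apply (bounded_variation (fun t => g (t, snd x)) (fun t => pd 0 g (t, snd x))); intros t Ht.
    destruct (Hg 0%nat (t, snd x)) as [T1 T2]; [ apply HW; simpl; [ lra | rewrite Rminus_diag, Rabs_R0; trivial ] | ].
    split; [ apply (pd_correct _ _ _ T1) | exact T2 ]. }
  assert (E2 : Rabs (g y - g (fst y, snd x)) <= B * Rabs (snd y - snd x)).
  { replace (g y) with ((fun t => g (fst y, t)) (snd y)) by (destruct y; reflexivity).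
    apply (bounded_variation (fun t => g (fst y, t)) (fun t => pd 1 g (fst y, t))); intros t Ht.
    destruct (Hg 1%nat (fst y, t)) as [T1 T2]; [ apply HW; simpl; [ trivial | lra ] | ].
    split; [ apply (pd_correct _ _ _ T1) | exact T2 ]. }
  replace (g y - g x) with ((g y - g (fst y, snd x)) + (g (fst y, snd x) - g x)) by ring.
  apply Rle_trans with (1 := Rabs_triang _ _).
  apply Rle_trans with (B * d + B * d); [ | lra ].
  apply Rplus_le_compat.
  - apply Rle_trans with (1 := E2), Rmult_le_compat_l; trivial.
  - apply Rle_trans with (1 := E1), Rmult_le_compat_l; trivial.
Qed.

Section Mollify.
Context {P : Type} (om : pt -> Prop) (l rho : P -> R) (Hl : forall p, 0 < l p) (Hrho : forall p, 1 <= rho p).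

Definition dilate (r : R) (p : P) : pt -> Prop := thick om (r * l p).
(** With ten averages per direction a coordinate moves by at most [l / 16], and the twenty single
    averages consume [l / 8] of the domain. Ten is the number of derivatives of [v] that a stage of
    order 8 demands. *)
Definition mesh (p : P) : R := / 160 * l p.
Definition mollify (p : P) (f : pt -> R) : pt -> R := mol 10 (mesh p) f.
Definition layer (j : nat) (p : P) : pt -> Prop := thick om (3 / 2 * l p + (20 - INR j) * mesh p).

Lemma mesh_pos p : 0 < mesh p.
Proof. unfold mesh; assert (T := Hl p); lra. Qed.

Lemma dilate_open r : openf (dilate r).
Proof. intros p x; apply thick_open. Qed.

Lemma shift_dist a s x : 0 <= s -> dist2 (shift a s x) x <= s.
Proof.
  intros Hs; apply Rle_trans with (1 := dist2_le_sum _ _).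
  destruct a; unfold shift; simpl; rewrite Rminus_diag, Rabs_R0;
  [ replace (fst x + s - fst x) with s by ring | replace (snd x + s - snd x) with s by ring ];
  rewrite Rabs_pos_eq; lra.
Qed.

Lemma layer_chain p : chain (mesh p) (fun j => layer j p).
Proof.
  assert (T := mesh_pos p); split; [ exact T | split ].
  - intros j x; apply thick_open.
  - intros j a x s Hx Hs; unfold layer in *; rewrite S_INR in Hx.
    assert (D := shift_dist a s x (proj1 Hs)).
    apply thick_mono with (2 := thick_near _ _ _ _ _ Hx D); lra.
Qed.

Lemma layer0 p x : layer 0 p x -> dilate 2 p x.
Proof. apply thick_mono; unfold mesh; simpl; assert (T := Hl p); lra. Qed.

Lemma layer20 p x : dilate (3 / 2) p x -> layer (dbl 10) p x.
Proof. apply thick_mono; simpl dbl; replace (INR 20) with 20 by (simpl; ring); lra. Qed.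

(** The map [q] and the chain are arbitrary so that the statement serves both the layers around the
    whole domain and the boxes around one point. The natural frequency [/ mesh] is relaxed to
    [rho / l]. *)
Lemma moll_symb_gen {Q : Type} (q : Q -> P) (V : nat -> Q -> pt -> Prop) (W : Q -> pt -> Prop) f A :
  (forall p, chain (mesh (q p)) (fun j => V j p)) -> (forall p x, W p x -> V (dbl 10) p x) ->
  (forall p, 0 <= A p) ->
  (forall p x, V 0%nat p x -> continuous (f p) x) ->
  (exists C, forall p x, V 0%nat p x -> Rabs (f p x) <= C * A p) ->
  symb W 10 (fun p => mollify (q p) (f p)) A (fun p => rho (q p) * / l (q p)).
Proof.
  intros HC HW HA Hc Hb.
  apply symb_incl with (1 := HW).
  apply symb_mono with (A := A) (L := fun p => / mesh (q p)) (c := 1) (d := 160).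
  - intros p; assert (T := HA p); lra.
  - intros p; assert (T := mesh_pos (q p)); split; [ left; apply Rinv_0_lt_compat, T | ].
    unfold mesh; assert (T1 := Hl (q p)); assert (T2 := Hrho (q p)).
    replace (/ (/ 160 * l (q p))) with (160 * (1 * / l (q p))) by (field; lra).
    apply Rmult_le_compat_l; [ lra | ]; apply Rmult_le_compat_r; trivial.
    left; apply Rinv_0_lt_compat, T1.
  - apply (mol_symb (fun p => mesh (q p)) V HC).
    split; [ exact Hc | split; [ exact Hb | exact I ] ].
Qed.

Lemma moll_symb f A : (forall p, 0 <= A p) ->
  (forall p x, dilate 2 p x -> continuous (f p) x) ->
  (exists C, forall p x, dilate 2 p x -> Rabs (f p x) <= C * A p) ->
  symb (dilate (3 / 2)) 10 (fun p => mollify p (f p)) A (fun p => rho p * / l p).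
Proof.
  intros HA Hc [C Hb]; apply (moll_symb_gen (fun p => p) layer); trivial.
  - apply layer_chain.
  - apply layer20.
  - intros p x Hx; apply Hc, layer0, Hx.
  - exists C; intros p x Hx; apply Hb, layer0, Hx.
Qed.

Lemma moll_pd p b f x :
  (forall y, dilate 2 p y -> continuous f y) -> (forall y, dilate 2 p y -> ex_pd b f y) ->
  (forall y, dilate 2 p y -> continuous (pd b f) y) -> dilate (3 / 2) p x ->
  is_pd b (mollify p f) x (mollify p (pd b f) x).
Proof.
  intros H1 H2 H3 Hx; apply (mol_is_pd _ _ (layer_chain p)); auto using layer0, layer20.
Qed.

Lemma moll_hpd p g B1 B2 a b x : C2bd (dilate 2 p) g B1 B2 -> dilate (3 / 2) p x ->
  is_pd b (pd a (mollify p g)) x (mollify p (hpd g a b) x).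
Proof.
  intros [Hc Hg] Hx; destruct (Hg a) as [H1 H2].
  eapply is_pd_ext_loc.
  - generalize (dilate_open (3 / 2) p x Hx); apply filter_imp; intros y Hy; symmetry.
    apply is_pd_unique, moll_pd; trivial; apply H1.
  - apply moll_pd; trivial; [ apply H1 | | ]; intros y Hy; destruct (H2 b y Hy) as [T1 [T2 _]]; trivial.
Qed.

Lemma dilate_box p d x y : 0 <= d -> d <= / 4 -> dilate (3 / 2) p x -> Rabs (fst y - fst x) <= d * l p -> Rabs (snd y - snd x) <= d * l p ->
  dilate 2 p y.
Proof.
  intros Hd0 Hd Hx H1 H2; apply thick_mono with (2 := thick_box _ _ _ _ _ Hx H1 H2).
  assert (T := Hl p); nra.
Qed.

Lemma moll_near p f c B x : (forall y, dilate 2 p y -> continuous f y) -> dilate (3 / 2) p x ->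
  (forall y, dilate 2 p y -> Rabs (fst y - fst x) <= / 16 * l p -> Rabs (snd y - snd x) <= / 16 * l p -> Rabs (f y - c) <= B) ->
  Rabs (mollify p f x - c) <= B.
Proof.
  intros Hf Hx H; apply (mol_bound _ _ (layer_chain p)); auto using layer0, layer20.
  replace (INR 10 * mesh p) with (/ 16 * l p) by (unfold mesh; simpl; field).
  auto using layer0.
Qed.

Lemma moll_approx p f B x : (forall y, dilate 2 p y -> continuous f y) ->
  (forall a y, dilate 2 p y -> ex_pd a f y /\ Rabs (pd a f y) <= B) -> dilate (3 / 2) p x ->
  Rabs (mollify p f x - f x) <= B * l p.
Proof.
  intros Hc Hf Hx; assert (T := Hl p).
  assert (B0 : 0 <= B).
  { destruct (Hf 0%nat x) as [_ T']; [ | apply Rle_trans with (2 := T'), Rabs_pos ].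
    apply thick_mono with (2 := Hx); lra. }
  apply Rle_trans with (B * (2 * (/ 16 * l p))); [ | apply Rmult_le_compat_l; lra ].
  apply moll_near; trivial; intros y Hy H1 H2.
  apply box_lipschitz with (W := dilate 2 p); trivial.
  intros z Z1 Z2; apply dilate_box with (/ 16) x; trivial; lra.
Qed.

(** Boxes around the marked point, of half-width [l / 4] at the start and [l / 8] after all
    averages; on them a function with gradient at most [M] deviates from its central value by at
    most [l M]. *)
Definition lay (j : nat) (q : {p : P & {x : pt | dilate (3 / 2) p x}}) (x : pt) : Prop :=
  Rabs (fst x - fst (proj1_sig (projT2 q))) < / 8 * l (projT1 q) + (20 - INR j) * mesh (projT1 q) /\
  Rabs (snd x - snd (proj1_sig (projT2 q))) < / 8 * l (projT1 q) + (20 - INR j) * mesh (projT1 q).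

Lemma lay_chain q : chain (mesh (projT1 q)) (fun j => lay j q).
Proof.
  assert (T := mesh_pos (projT1 q)); split; [ exact T | split ].
  - intros j x [H1 H2]; apply (proj2 (locally_box x _)).
    set (r := / 8 * l (projT1 q) + (20 - INR j) * mesh (projT1 q)) in *.
    set (x0 := proj1_sig (projT2 q)) in *.
    exists (Rmin (r - Rabs (fst x - fst x0)) (r - Rabs (snd x - snd x0))); split; [ apply Rmin_glb_lt; lra | ].
    intros y Y1 Y2; apply Rmin_Rgt_l in Y1; apply Rmin_Rgt_l in Y2; unfold lay; fold x0 r; split.
    + replace (fst y - fst x0) with ((fst y - fst x) + (fst x - fst x0)) by ring.
      apply Rle_lt_trans with (1 := Rabs_triang _ _); lra.
    + replace (snd y - snd x0) with ((snd y - snd x) + (snd x - snd x0)) by ring.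
      apply Rle_lt_trans with (1 := Rabs_triang _ _); lra.
  - intros j a x s [H1 H2] Hs; unfold lay in *; rewrite S_INR in H1, H2.
    apply Rabs_def2 in H1; apply Rabs_def2 in H2.
    destruct a; unfold shift; simpl; split; apply Rabs_def1; lra.
Qed.

Lemma lay0 q x : lay 0 q x -> Rabs (fst x - fst (proj1_sig (projT2 q))) <= / 4 * l (projT1 q)
  /\ Rabs (snd x - snd (proj1_sig (projT2 q))) <= / 4 * l (projT1 q) /\ dilate 2 (projT1 q) x.
Proof.
  intros [H1 H2]; destruct q as [p [x0 Hx0]]; simpl in *; unfold mesh in *.
  replace (/ 8 * l p + (20 - 0) * (/ 160 * l p)) with (/ 4 * l p) in * by field.
  split; [ lra | split; [ lra | ] ]; apply dilate_box with (/ 4) x0; trivial; lra.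
Qed.

(* The commutator does not change when constants are subtracted from [f] and [g], so near [x0]
   both may be taken of size [l * M]. *)
Lemma moll_commutator (f g : P -> pt -> R) (M : P -> R) :
  (forall p, 0 <= M p) ->
  (forall p y, dilate 2 p y -> continuous (f p) y /\ continuous (g p) y) ->
  (forall p a y, dilate 2 p y -> ex_pd a (f p) y /\ Rabs (pd a (f p) y) <= M p) ->
  (forall p a y, dilate 2 p y -> ex_pd a (g p) y /\ Rabs (pd a (g p) y) <= M p) ->
  symb (dilate (3 / 2)) 10 (fun p x => mollify p (fun y => f p y * g p y) x - mollify p (f p) x * mollify p (g p) x)
    (fun p => (l p * M p) ^ 2) (fun p => rho p * / l p).
Proof.
  intros HM Hc Hf Hg.
  assert (OW : openf (lay (dbl 10))) by (intros q x Hx; apply (lay_chain q), Hx).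
  assert (L0 : forall q : {p : P & {x : pt | dilate (3 / 2) p x}}, 0 <= rho (projT1 q) * / l (projT1 q)).
  { intros q; assert (T := Hl (projT1 q)); assert (T' := Hrho (projT1 q)).
    apply Rmult_le_pos; [ lra | left; apply Rinv_0_lt_compat, T ]. }
  apply (symb_local (dilate (3 / 2)) (lay (dbl 10))); trivial.
  { intros q; unfold lay; simpl dbl; replace (INR 20) with 20 by (simpl; ring).
    rewrite !Rminus_diag, Rabs_R0; assert (T := Hl (projT1 q)); lra. }
  set (c := fun (h : P -> pt -> R) (q : {p : P & {x : pt | dilate (3 / 2) p x}}) => h (projT1 q) (proj1_sig (projT2 q))).
  assert (Dev : forall h : P -> pt -> R, (forall p a y, dilate 2 p y -> ex_pd a (h p) y /\ Rabs (pd a (h p) y) <= M p) ->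
     forall q x, lay 0 q x -> Rabs (h (projT1 q) x - c h q) <= l (projT1 q) * M (projT1 q)).
  { intros h Hh q x Hx; destruct (lay0 q x Hx) as [H1 [H2 _]].
    assert (T := Hl (projT1 q)); assert (T' := HM (projT1 q)).
    apply Rle_trans with (M (projT1 q) * (2 * (/ 4 * l (projT1 q)))); [ | nra ].
    apply box_lipschitz with (W := dilate 2 (projT1 q)); auto.
    intros z Z1 Z2; destruct q as [p [x0 Hx0]]; simpl in *; apply dilate_box with (/ 4) x0; trivial; lra. }
  assert (CC : forall h q, (forall p y, dilate 2 p y -> continuous (h p) y) -> forall x, lay 0 q x -> continuous (fun y => h (projT1 q) y + - c h q) x).
  { intros h q Hh x Hx; apply @continuous_plus; [ apply Hh, lay0, Hx | apply continuous_const ]. }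
  assert (Cf : forall p y, dilate 2 p y -> continuous (f p) y) by (intros; apply Hc; trivial).
  assert (Cg : forall p y, dilate 2 p y -> continuous (g p) y) by (intros; apply Hc; trivial).
  assert (A1 : forall q : {p : P & {x : pt | dilate (3 / 2) p x}}, 0 <= l (projT1 q) * M (projT1 q))
    by (intros q; apply Rmult_le_pos; [ left; apply Hl | apply HM ]).
  assert (Sf : symb (lay (dbl 10)) 10 (fun q => mollify (projT1 q) (fun y => f (projT1 q) y + - c f q))
     (fun q => l (projT1 q) * M (projT1 q)) (fun q => rho (projT1 q) * / l (projT1 q))).
  { apply (moll_symb_gen (fun q => projT1 q) lay); auto using lay_chain.
    exists 1; intros q x Hx; rewrite Rmult_1_l; apply Dev; trivial. }
  assert (Sg : symb (lay (dbl 10)) 10 (fun q => mollify (projT1 q) (fun y => g (projT1 q) y + - c g q))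
     (fun q => l (projT1 q) * M (projT1 q)) (fun q => rho (projT1 q) * / l (projT1 q))).
  { apply (moll_symb_gen (fun q => projT1 q) lay); auto using lay_chain.
    exists 1; intros q x Hx; rewrite Rmult_1_l; apply Dev; trivial. }
  assert (Sfg : symb (lay (dbl 10)) 10 (fun q => mollify (projT1 q) (fun y => (f (projT1 q) y + - c f q) * (g (projT1 q) y + - c g q)))
     (fun q => (l (projT1 q) * M (projT1 q)) ^ 2) (fun q => rho (projT1 q) * / l (projT1 q))).
  { apply (moll_symb_gen (fun q => projT1 q) lay); auto using lay_chain.
    - intros q; apply pow2_ge_0.
    - intros q x Hx; apply @continuous_mult; apply CC; trivial.
    - exists 1; intros q x Hx; rewrite Rmult_1_l, Rabs_mult; simpl; rewrite Rmult_1_r.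
      apply Rmult_le_compat; try apply Rabs_pos; apply Dev; trivial. }
  eapply symb_ext; [ exact OW | | apply symb_minus; [ exact OW | exact L0 | exact Sfg | ] ].
  2: { eapply symb_amp; [ | apply symb_mult; [ exact OW | exact Sf | exact Sg ] ]; intros; simpl; ring. }
  intros q x Hx; cbv beta; unfold mollify.
  assert (HC := lay_chain q); set (p := projT1 q) in *.
  assert (cf : forall y, lay 0 q y -> continuous (f p) y) by (intros y Hy; apply Cf, lay0, Hy).
  assert (cg : forall y, lay 0 q y -> continuous (g p) y) by (intros y Hy; apply Cg, lay0, Hy).
  assert (cc : forall (t : R) (y : pt), lay 0 q y -> continuous (fun _ : pt => t) y) by (intros; apply continuous_const).
  assert (cfg : forall y, lay 0 q y -> continuous (fun y => f p y * g p y) y) by (intros; apply @continuous_mult; auto).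
  assert (cs : forall (t : R) (h : pt -> R), (forall y, lay 0 q y -> continuous h y) -> forall y, lay 0 q y -> continuous (fun y => t * h y) y)
    by (intros t h Hh y Hy; apply (continuous_scal_r t h); auto).
  assert (cp : forall (h k : pt -> R), (forall y, lay 0 q y -> continuous h y) -> (forall y, lay 0 q y -> continuous k y) ->
     forall y, lay 0 q y -> continuous (fun y => h y + k y) y)
    by (intros h k Hh Hk y Hy; apply @continuous_plus; auto).
  rewrite (mol_plus _ _ HC 10 (f p) (fun _ => - c f q)) by auto.
  rewrite (mol_plus _ _ HC 10 (g p) (fun _ => - c g q)) by auto.
  rewrite !(mol_const _ _ HC 10).
  assert (E : mol 10 (mesh p) (fun y => (f p y + - c f q) * (g p y + - c g q)) x =
     mol 10 (mesh p) (fun y => ((f p y * g p y) + (- c f q) * g p y) + ((- c g q) * f p y + c f q * c g q)) x)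
    by (f_equal; apply functional_extensionality; intros y; ring).
  rewrite E.
  rewrite (mol_plus _ _ HC 10 (fun y => (f p y * g p y) + (- c f q) * g p y) (fun y => (- c g q) * f p y + c f q * c g q)) by auto.
  rewrite (mol_plus _ _ HC 10 (fun y => f p y * g p y) (fun y => (- c f q) * g p y)) by auto.
  rewrite (mol_plus _ _ HC 10 (fun y => (- c g q) * f p y) (fun y => c f q * c g q)) by auto.
  rewrite !(mol_scal _ _ HC 10), (mol_const _ _ HC 10) by auto.
  match goal with |- ?a + _ + _ - _ = ?b - _ => change a with b end; ring.
Qed.
End Mollify.

(** Everything on which a constant must not depend is a field here. The quantities [lam] and [beta]
    and the exponents enter only through the ratio [drho] and through [dHo], the oscillation of [A]
    at distance [dl]. *)
Record datum (om : pt -> Prop) : Type := Datum {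
  dl : R; dM : R; drho : R; dD : R; dgv : R; dHo : R;
  dv : nat -> pt -> R; dw : nat -> pt -> R; dA : nat -> nat -> pt -> R;
  dl_pos : 0 < dl < 1; dM_pos : 0 < dM; drho_ge : 1 <= drho; dD_pos : 0 <= dD;
  dgv_bd : 0 <= dgv <= dM;
  dv_C2 : forall i, (i < 3)%nat -> C2bd (thick om (2 * dl)) (dv i) dgv dM;
  dv_bd : forall i, (i < 3)%nat -> exists B, forall x, thick om (2 * dl) x -> Rabs (dv i x) <= B;
  dw_C2 : forall b, (b < 2)%nat -> C2bd (thick om (2 * dl)) (dw b) dM dM;
  dw_bd : forall b, (b < 2)%nat -> exists B, forall x, thick om (2 * dl) x -> Rabs (dw b x) <= B;
  dA_cont : forall a b x, (a < 2)%nat -> (b < 2)%nat -> thick om (2 * dl) x -> continuous (dA a b) x;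
  dA_sym : forall x, thick om (2 * dl) x -> dA 0%nat 1%nat x = dA 1%nat 0%nat x;
  dA_osc : forall a b x y, (a < 2)%nat -> (b < 2)%nat -> thick om (2 * dl) x -> thick om (2 * dl) y ->
    dist2 y x <= dl -> Rabs (dA a b y - dA a b x) <= dHo;
  dA_def : forall a b x, (a < 2)%nat -> (b < 2)%nat -> thick om (2 * dl) x ->
    Rabs (defect dA dv dw a b x) <= dD }.

Arguments dl {om}. Arguments dM {om}. Arguments drho {om}. Arguments dD {om}. Arguments dgv {om}.
Arguments dHo {om}. Arguments dv {om}. Arguments dw {om}. Arguments dA {om}.

(* Otherwise unification unfolds twenty nested integrals. *)
Local Opaque mol.

(** * The mollified data form an initial stage *)

Section Core.
Context (om : pt -> Prop) (Hom : bounded2 om).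

Let P := datum om.
Let lp (p : P) : 0 < dl p. Proof. apply dl_pos. Qed.
Let rp (p : P) : 1 <= drho p. Proof. apply drho_ge. Qed.

Notation dom := (dilate (P := datum om) om dl).
Notation moll := (mollify (P := datum om) dl).

Definition de (p : datum om) : R := sqrt (dD p) + dl p * dM p.
Definition dG (p : datum om) : R := dgv p + de p.
(** The invariant [s L rho] at its initial values [s = e] and [L = rho / l]. *)
Definition dH (p : datum om) : R := de p * (drho p * / dl p) * drho p.

Lemma lM_pos (p : P) : 0 < dl p * dM p.
Proof. apply Rmult_lt_0_compat; [ apply lp | apply dM_pos ]. Qed.

Lemma lM_le (p : P) : dl p * dM p <= de p.
Proof. unfold de; assert (T := sqrt_pos (dD p)); lra. Qed.

Lemma de_pos (p : P) : 0 < de p.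
Proof. assert (T := lM_pos p); assert (T' := lM_le p); lra. Qed.

Lemma de_G (p : P) : de p <= dG p.
Proof. unfold dG; destruct (dgv_bd om p); lra. Qed.

Lemma dM_le (p : P) : dM p <= de p * / dl p.
Proof.
  apply Rmult_le_reg_r with (dl p); [ apply lp | ].
  rewrite Rmult_assoc, Rinv_l by (apply Rgt_not_eq, lp); assert (T := lM_le p); lra.
Qed.

Lemma freq0_ge1 (p : P) : 1 <= drho p * / dl p.
Proof.
  assert (T := drho_ge om p); destruct (dl_pos om p) as [T1 T2].
  apply Rmult_le_reg_r with (dl p); trivial; rewrite Rmult_assoc, Rinv_l by lra; lra.
Qed.

Lemma freq0_pos (p : P) : 0 <= drho p * / dl p.
Proof. assert (T := freq0_ge1 p); lra. Qed.

Lemma datum_v (p : P) i : (i < 3)%nat -> C2bd (dom 2 p) (dv p i) (dgv p) (dM p).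
Proof. apply dv_C2. Qed.

Lemma datum_w (p : P) b : (b < 2)%nat -> C2bd (dom 2 p) (dw p b) (dM p) (dM p).
Proof. apply dw_C2. Qed.

(** Collects the bounds of the individual data into one function of the datum, the form in which
    [symb] expects an amplitude; no uniformity is claimed. *)
Lemma sup_choice (f : P -> pt -> R) :
  (forall p, exists B, forall x, dom 2 p x -> Rabs (f p x) <= B) ->
  exists X : P -> R, (forall p, 0 <= X p) /\ exists C, forall p x, dom 2 p x -> Rabs (f p x) <= C * X p.
Proof.
  intros H; exists (fun p => Rabs (proj1_sig (constructive_indefinite_description _ (H p)))).
  split; [ intros; apply Rabs_pos | exists 1; intros p x Hx; rewrite Rmult_1_l ].
  apply Rle_trans with (2 := Rle_abs _).
  exact (proj2_sig (constructive_indefinite_description _ (H p)) x Hx).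
Qed.

Definition v0 (p : P) (i : nat) : pt -> R := moll p (dv p i).
Definition w0 (p : P) (b : nat) : pt -> R := moll p (dw p b).
Definition A0 (p : P) (a b : nat) : pt -> R := moll p (dA p a b).

Lemma is_pd_v0 p i a x : (i < 3)%nat -> dom (3 / 2) p x -> is_pd a (v0 p i) x (moll p (pd a (dv p i)) x).
Proof.
  intros Hi Hx; destruct (datum_v p i Hi) as [H1 H2]; destruct (H2 a) as [H3 _].
  unfold v0, w0; apply moll_pd with (om := om); trivial; intros y Hy; apply H3, Hy.
Qed.

Lemma is_pd_w0 p b a x : (b < 2)%nat -> dom (3 / 2) p x -> is_pd a (w0 p b) x (moll p (pd a (dw p b)) x).
Proof.
  intros Hi Hx; destruct (datum_w p b Hi) as [H1 H2]; destruct (H2 a) as [H3 _].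
  unfold v0, w0; apply moll_pd with (om := om); trivial; intros y Hy; apply H3, Hy.
Qed.

Lemma hpd_v0 p i a b x : (i < 3)%nat -> dom (3 / 2) p x -> hpd (v0 p i) a b x = moll p (hpd (dv p i) a b) x.
Proof. intros Hi Hx; apply is_pd_unique; eapply moll_hpd; [ exact lp | apply datum_v, Hi | exact Hx ]. Qed.

Lemma hpd_w0 p i a b x : (i < 2)%nat -> dom (3 / 2) p x -> hpd (w0 p i) a b x = moll p (hpd (dw p i) a b) x.
Proof. intros Hi Hx; apply is_pd_unique; eapply moll_hpd; [ exact lp | apply datum_w, Hi | exact Hx ]. Qed.

Lemma defect_eq A v w (gv gw : nat -> nat -> R) a b x : (a < 2)%nat -> (b < 2)%nat ->
  (forall i c, (i < 3)%nat -> pd c (v i) x = gv i c) -> (forall i c, (i < 2)%nat -> pd c (w i) x = gw i c) ->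
  defect A v w a b x = A a b x - (/ 2 * (gv 0%nat a * gv 0%nat b + gv 1%nat a * gv 1%nat b + gv 2%nat a * gv 2%nat b)
    + / 2 * (gw b a + gw a b)).
Proof.
  intros Ha Hb Hv Hw; unfold defect; rewrite !Hv, !Hw; trivial; lia.
Qed.

(** Mollification commutes with derivatives and sums, so the new defect differs from the mollified
    one only by the commutators of the quadratic terms. *)
Lemma defect_mollified p a b x : (a < 2)%nat -> (b < 2)%nat -> dom (3 / 2) p x ->
  defect (A0 p) (v0 p) (w0 p) a b x = moll p (defect (dA p) (dv p) (dw p) a b) x
   + / 2 * ((moll p (fun y => pd a (dv p 0%nat) y * pd b (dv p 0%nat) y) x - moll p (pd a (dv p 0%nat)) x * moll p (pd b (dv p 0%nat)) x)
     + (moll p (fun y => pd a (dv p 1%nat) y * pd b (dv p 1%nat) y) x - moll p (pd a (dv p 1%nat)) x * moll p (pd b (dv p 1%nat)) x)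
     + (moll p (fun y => pd a (dv p 2%nat) y * pd b (dv p 2%nat) y) x - moll p (pd a (dv p 2%nat)) x * moll p (pd b (dv p 2%nat)) x)).
Proof.
  intros Ha Hb Hx.
  rewrite (defect_eq (A0 p) (v0 p) (w0 p) (fun i c => moll p (pd c (dv p i)) x) (fun i c => moll p (pd c (dw p i)) x) a b x Ha Hb
    (fun i c Hi => is_pd_unique _ _ _ _ (is_pd_v0 p i c x Hi Hx)) (fun i c Hi => is_pd_unique _ _ _ _ (is_pd_w0 p i c x Hi Hx))).
  assert (HC := layer_chain om dl lp p).
  assert (HV : layer om dl (dbl 10) p x) by (apply layer20, Hx).
  assert (In : forall y, layer om dl 0 p y -> dom 2 p y) by (intros y; apply layer0, lp).
  assert (cA : forall y, layer om dl 0 p y -> continuous (dA p a b) y) by (intros y Hy; apply dA_cont; trivial; apply In, Hy).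
  assert (cv : forall i c, (i < 3)%nat -> forall y, layer om dl 0 p y -> continuous (pd c (dv p i)) y)
    by (intros i c Hi y Hy; exact (C2bd_continuous_pd _ _ _ _ (datum_v p i Hi) c y (In y Hy))).
  assert (cw : forall i c, (i < 2)%nat -> forall y, layer om dl 0 p y -> continuous (pd c (dw p i)) y)
    by (intros i c Hi y Hy; exact (C2bd_continuous_pd _ _ _ _ (datum_w p i Hi) c y (In y Hy))).
  assert (cvv : forall i, (i < 3)%nat -> forall y, layer om dl 0 p y -> continuous (fun y => pd a (dv p i) y * pd b (dv p i) y) y)
    by (intros i Hi y Hy; apply @continuous_mult; apply cv; trivial).
  assert (cs : forall (t : R) (h : pt -> R), (forall y, layer om dl 0 p y -> continuous h y) -> forall y, layer om dl 0 p y -> continuous (fun y => t * h y) y)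
    by (intros t h Hh y Hy; apply (continuous_scal_r t h); auto).
  assert (cp : forall (h k : pt -> R), (forall y, layer om dl 0 p y -> continuous h y) -> (forall y, layer om dl 0 p y -> continuous k y) ->
     forall y, layer om dl 0 p y -> continuous (fun y => h y + k y) y)
    by (intros h k Hh Hk y Hy; apply @continuous_plus; auto).
  assert (L3 : (0 < 3)%nat /\ (1 < 3)%nat /\ (2 < 3)%nat) by lia; destruct L3 as [l0 [l1 l2]].
  assert (E : forall h g : pt -> R, (forall y, layer om dl 0 p y -> continuous h y) -> (forall y, layer om dl 0 p y -> continuous g y) ->
     moll p (fun y => h y + - / 2 * g y) x = moll p h x + - / 2 * moll p g x).
  { intros h g Hh Hg; unfold mollify; rewrite (mol_plus _ _ HC) by auto; rewrite (mol_scal _ _ HC) by auto; reflexivity. }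
  assert (ED : defect (dA p) (dv p) (dw p) a b = (fun y => dA p a b y + - / 2 * (pd a (dv p 0%nat) y * pd b (dv p 0%nat) y)
     + - / 2 * (pd a (dv p 1%nat) y * pd b (dv p 1%nat) y) + - / 2 * (pd a (dv p 2%nat) y * pd b (dv p 2%nat) y)
     + - / 2 * pd a (dw p b) y + - / 2 * pd b (dw p a) y))
    by (apply functional_extensionality; intros y; unfold defect; ring).
  rewrite ED.
  set (g0 := fun y => pd a (dv p 0%nat) y * pd b (dv p 0%nat) y) in *.
  set (g1 := fun y => pd a (dv p 1%nat) y * pd b (dv p 1%nat) y) in *.
  set (g2 := fun y => pd a (dv p 2%nat) y * pd b (dv p 2%nat) y) in *.
  assert (c0 := cvv _ l0); assert (c1 := cvv _ l1); assert (c2 := cvv _ l2); fold g0 in c0; fold g1 in c1; fold g2 in c2.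
  assert (k1 := cp _ _ cA (cs (- / 2) _ c0)).
  assert (k2 := cp _ _ k1 (cs (- / 2) _ c1)).
  assert (k3 := cp _ _ k2 (cs (- / 2) _ c2)).
  assert (k4 := cp _ _ k3 (cs (- / 2) _ (cw b a Hb))).
  transitivity (moll p (dA p a b) x + - / 2 * moll p g0 x + - / 2 * moll p g1 x + - / 2 * moll p g2 x
    + - / 2 * moll p (pd a (dw p b)) x + - / 2 * moll p (pd b (dw p a)) x
    + / 2 * ((moll p g0 x - moll p (pd a (dv p 0%nat)) x * moll p (pd b (dv p 0%nat)) x)
     + (moll p g1 x - moll p (pd a (dv p 1%nat)) x * moll p (pd b (dv p 1%nat)) x)
     + (moll p g2 x - moll p (pd a (dv p 2%nat)) x * moll p (pd b (dv p 2%nat)) x))); [ unfold A0; ring | ].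
  f_equal.
  symmetry; etransitivity; [ exact (E _ _ k4 (cw a b Ha)) | apply f_equal2; [ | reflexivity ] ].
  etransitivity; [ exact (E _ _ k3 (cw b a Hb)) | apply f_equal2; [ | reflexivity ] ].
  etransitivity; [ exact (E _ _ k2 c2) | apply f_equal2; [ | reflexivity ] ].
  etransitivity; [ exact (E _ _ k1 c1) | apply f_equal2; [ | reflexivity ] ].
  exact (E _ _ cA c0).
Qed.

Lemma initial_stage :
  stage (dom (3 / 2)) 8 (fun p : datum om => drho p * / dl p) de dG drho A0 v0 w0.
Proof.
  assert (OU : openf (dom (3 / 2))) by apply dilate_open.
  assert (Mn : forall p : P, 0 <= dM p) by (intros p; left; apply dM_pos).
  assert (Sv : forall i a b, (i < 3)%nat -> symb (dom (3 / 2)) 10 (fun p : datum om => hpd (v0 p i) a b) dM (fun p : datum om => drho p * / dl p)).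
  { intros i a b Hi; apply (symb_ext _ OU _ (fun p => moll p (hpd (dv p i) a b))).
    - intros p x Hx; symmetry; apply hpd_v0; trivial.
    - apply (moll_symb om dl drho lp rp (fun p => hpd (dv p i) a b) dM Mn).
      + intros p x Hx; exact (C2bd_continuous_hpd _ _ _ _ (datum_v p i Hi) a b x Hx).
      + exists 1; intros p x Hx; rewrite Rmult_1_l; exact (C2bd_hpd_le _ _ _ _ (datum_v p i Hi) a b x Hx). }
  (* The strictest bound, that of the [k k] entry: at frequency [rho / l] it reads [M <= e / l]. *)
  assert (B1 : forall p : P, dM p <= 1 * (de p * (drho p * / dl p) * / drho p)).
  { intros p; assert (T := dM_le p); assert (T' := rp p).
    replace (1 * (de p * (drho p * / dl p) * / drho p)) with (de p * / dl p); trivial.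
    assert (T2 := lp p); field; lra. }
  assert (Up : forall p : P, 0 <= de p * (drho p * / dl p) * / drho p).
  { intros p; apply Rle_trans with (2 := Rle_trans _ _ _ (B1 p) (Req_le _ _ (Rmult_1_l _))); trivial. }
  assert (B2 : forall p : P, dM p <= 1 * (de p * (drho p * / dl p))).
  { intros p; apply Rle_trans with (1 := B1 p); rewrite !Rmult_1_l.
    assert (T' := rp p); assert (T := de_pos p); assert (T2 := freq0_pos p).
    assert (0 <= de p * (drho p * / dl p)) by (apply Rmult_le_pos; lra).
    assert (/ drho p <= 1) by (rewrite <- Rinv_1; apply Rinv_le_contravar; lra).
    apply Rle_trans with (de p * (drho p * / dl p) * 1); [ apply Rmult_le_compat_l; lra | lra ]. }
  assert (B3 : forall p : P, dM p <= 1 * (de p * (drho p * / dl p) * drho p)).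
  { intros p; apply Rle_trans with (1 := B2 p); rewrite !Rmult_1_l.
    assert (T' := rp p); assert (T := de_pos p); assert (T2 := freq0_pos p).
    assert (0 <= de p * (drho p * / dl p)) by (apply Rmult_le_pos; lra).
    apply Rle_trans with (de p * (drho p * / dl p) * 1); [ lra | apply Rmult_le_compat_l; lra ]. }
  assert (LL : forall p : P, 0 <= drho p * / dl p <= drho p * / dl p) by (intros p; assert (T := freq0_pos p); lra).
  assert (Sq : forall i u w, (i < 3)%nat -> symb (dom (3 / 2)) 8 (fun p : datum om => hquad (v0 p i) u w) dM (fun p : datum om => drho p * / dl p)).
  { intros i u w' Hi; apply symb_hquad; trivial; [ apply freq0_pos | ].
    intros a b; apply symb_le with 10%nat; [ lia | auto ]. }
  split.
  - intros i Hi; destruct (sup_choice (fun p => dv p i)) as [X [HX HX']]; [ intros p; apply dv_bd, Hi | ].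
    exists X; split; [ exact HX | ].
    apply (moll_symb om dl drho lp rp (fun p => dv p i) X HX); [ | exact HX' ].
    intros p x Hx; exact (C2bd_continuous _ _ _ _ (datum_v p i Hi) x Hx).
  - intros b Hb; destruct (sup_choice (fun p => dw p b)) as [X [HX HX']]; [ intros p; apply dw_bd, Hb | ].
    exists X; split; [ exact HX | ].
    apply symb_S, (moll_symb om dl drho lp rp (fun p => dw p b) X HX); [ | exact HX' ].
    intros p x Hx; exact (C2bd_continuous _ _ _ _ (datum_w p b Hb) x Hx).
  - intros i a Hi; apply (symb_ext _ OU _ (fun p => moll p (pd a (dv p i)))).
    { intros p x Hx; symmetry; apply is_pd_unique, is_pd_v0; trivial. }
    assert (Gn : forall p : P, 0 <= dG p) by (intros p; assert (T := de_pos p); assert (T' := de_G p); lra).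
    apply symb_S, (moll_symb om dl drho lp rp (fun p => pd a (dv p i)) dG Gn).
    + intros p x Hx; exact (C2bd_continuous_pd _ _ _ _ (datum_v p i Hi) a x Hx).
    + exists 1; intros p x Hx; rewrite Rmult_1_l.
      apply Rle_trans with (dgv p); [ exact (C2bd_pd_le _ _ _ _ (datum_v p i Hi) a x Hx) | unfold dG; assert (T := de_pos p); lra ].
  - intros i a b Hi; apply symb_wk with (A := dM) (L := fun p => drho p * / dl p) (c := 1); trivial.
    apply symb_le with 10%nat; [ lia | auto ].
  - intros i Hi; apply symb_wk with (A := dM) (L := fun p => drho p * / dl p) (c := 1); auto.
  - intros i Hi; apply symb_wk with (A := dM) (L := fun p => drho p * / dl p) (c := 1); auto.
  - intros a b Ha Hb; eapply symb_ext; [ exact OU | intros p x Hx; symmetry; apply defect_mollified; trivial | ].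
    apply symb_le with 10%nat; [ lia | ].
    assert (E1 : forall p : P, dD p <= 1 * de p ^ 2).
    { intros p; rewrite Rmult_1_l; unfold de; assert (T := sqrt_sqrt _ (dD_pos om p)).
      assert (T1 := sqrt_pos (dD p)); assert (T2 := lM_pos p); nra. }
    assert (E2 : forall p : P, (dl p * dM p) ^ 2 <= 1 * de p ^ 2).
    { intros p; rewrite Rmult_1_l; apply pow_incr; split; [ left; apply lM_pos | apply lM_le ]. }
    assert (Cm : forall i, (i < 3)%nat -> symb (dom (3 / 2)) 10 (fun p x => moll p (fun y => pd a (dv p i) y * pd b (dv p i) y) x
        - moll p (pd a (dv p i)) x * moll p (pd b (dv p i)) x) (fun p => de p ^ 2) (fun p : datum om => drho p * / dl p)).
    { intros i Hi; apply symb_wk with (A := fun p => (dl p * dM p) ^ 2) (L := fun p => drho p * / dl p) (c := 1); trivial.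
      { intros p; apply pow2_ge_0. }
      apply (moll_commutator om dl drho lp rp (fun p => pd a (dv p i)) (fun p => pd b (dv p i))); trivial.
      - intros p y Hy; split; exact (C2bd_continuous_pd _ _ _ _ (datum_v p i Hi) _ y Hy).
      - intros p c y Hy; split; [ exact (C2bd_ex_hpd _ _ _ _ (datum_v p i Hi) a c y Hy) | exact (C2bd_hpd_le _ _ _ _ (datum_v p i Hi) a c y Hy) ].
      - intros p c y Hy; split; [ exact (C2bd_ex_hpd _ _ _ _ (datum_v p i Hi) b c y Hy) | exact (C2bd_hpd_le _ _ _ _ (datum_v p i Hi) b c y Hy) ]. }
    apply symb_plus; trivial.
    + apply symb_wk with (A := dD) (L := fun p => drho p * / dl p) (c := 1); trivial.
      { intros p; apply dD_pos. }
      apply (moll_symb om dl drho lp rp (fun p => defect (dA p) (dv p) (dw p) a b) dD (dD_pos om)).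
      * intros p x Hx.
        assert (cv : forall i c, (i < 3)%nat -> continuous (pd c (dv p i)) x)
          by (intros i c Hi; exact (C2bd_continuous_pd _ _ _ _ (datum_v p i Hi) c x Hx)).
        assert (cw : forall i c, (i < 2)%nat -> continuous (pd c (dw p i)) x)
          by (intros i c Hi; exact (C2bd_continuous_pd _ _ _ _ (datum_w p i Hi) c x Hx)).
        unfold defect; apply @continuous_minus; [ apply dA_cont; trivial | ].
        apply @continuous_plus; (apply @continuous_mult; [ apply continuous_const | ]).
        -- repeat apply @continuous_plus; apply @continuous_mult; apply cv; lia.
        -- apply @continuous_plus; apply cw; trivial.
      * exists 1; intros p x Hx; rewrite Rmult_1_l; apply dA_def; trivial.
    + apply symb_scalR; trivial; [ apply freq0_pos | ].
      apply symb_plus; [ exact OU | apply symb_plus; [ exact OU | | ] | ]; apply Cm; lia.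
Qed.
End Core.

(** * Conclusion for admissible data *)
Lemma nbhd_thick om r r' x : r < r' -> nbhd om r x -> thick om r' x.
Proof.
  intros Hr [y [Hy Hd]]; destruct (Hy (r' - r) ltac:(lra)) as [z [Hz Hd']].
  exists z; split; trivial; assert (T := dist2_triangle x y z); lra.
Qed.

Lemma closure2_incl (U : pt -> Prop) x : U x -> closure2 U x.
Proof.
  intros Hx eps He; exists x; split; trivial; unfold dist2; rewrite !Rminus_diag.
  replace (0 ^ 2 + 0 ^ 2) with 0 by ring; rewrite sqrt_0; trivial.
Qed.

Lemma thick_nbhd om r x : thick om r x -> interior2 (nbhd om r) x.
Proof.
  intros [y [Hy Hd]]; exists (r - dist2 x y); split; [ lra | ]; intros z Hz.
  exists y; split; [ apply closure2_incl, Hy | ].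
  assert (T := dist2_triangle z x y); rewrite (dist2_sym z x) in T; lra.
Qed.

Lemma interior2_incl S x : interior2 S x -> S x.
Proof.
  intros [e [He H]]; apply H; unfold dist2; rewrite !Rminus_diag.
  replace (0 ^ 2 + 0 ^ 2) with 0 by ring; rewrite sqrt_0; trivial.
Qed.

Lemma interior2_open S : is_open2 (interior2 S).
Proof.
  intros x [e [He H]]; exists (e / 2); split; [ lra | ]; intros y Hy.
  exists (e / 2); split; [ lra | ]; intros z Hz; apply H.
  assert (T := dist2_triangle x y z); lra.
Qed.

Lemma Ck_open_incl k : forall (U W : pt -> Prop) g, (forall x, W x -> U x) -> Ck_open k U g -> Ck_open k W g.
Proof.
  induction k as [ | k IH]; intros U W g HI [H1 H2];
  (split; [ intros x Hx eps He; destruct (H1 x (HI x Hx) eps He) as [d [Hd H]]; exists d; split; auto | ]); trivial.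
  intros a Ha; destruct (H2 a Ha) as [H3 H4]; split; [ auto | apply (IH U); trivial ].
Qed.

(** * Regularity up to the closed neighbourhood *)

Section Regularity.
Context {P : Type} (om : pt -> Prop) (l : P -> R) (Hl : forall p, 0 < l p).
Notation U := (dilate om l (3 / 2)).

(** The neighbourhood need not be convex. Points closer than [l / 8] are therefore joined inside a
    box that stays in the larger set of radius [3/2 l], where the gradient is bounded. *)
Lemma symb_unif_cont g X L p : symb U 1 g X L -> unif_cont_on (interior2 (nbhd om (l p))) (g p).
Proof.
  intros Hg.
  destruct (symb_bound U _ _ _ _ (symb_pd _ _ _ _ _ 0%nat Hg)) as [C0 [HC0 B0]].
  destruct (symb_bound U _ _ _ _ (symb_pd _ _ _ _ _ 1%nat Hg)) as [C1 [HC1 B1]].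
  set (T := Rabs (X p * L p)).
  assert (HT : 0 <= T) by apply Rabs_pos.
  set (B := C0 * T + C1 * T).
  assert (HB0 : 0 <= C0 * T) by (apply Rmult_le_pos; trivial).
  assert (HB1 : 0 <= C1 * T) by (apply Rmult_le_pos; trivial).
  intros eps He; exists (Rmin (/ 8 * l p) (eps / (2 * (B + 1)))).
  assert (Hlp := Hl p); assert (HB : 0 < 2 * (B + 1)) by (unfold B; lra).
  split; [ apply Rmin_glb_lt; [ lra | apply Rdiv_lt_0_compat; lra ] | ].
  intros x y Hx _ Hd.
  apply Rmin_Rgt_l in Hd; destruct Hd as [Hd1 Hd2].
  destruct (dist2_coord x y) as [D1 D2].
  assert (NN : forall u w : R, Rabs (u - w) = Rabs (w - u)) by (intros; apply Rabs_minus_sym).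
  rewrite NN in D1, D2.
  assert (P0 : 0 <= dist2 x y) by apply sqrt_pos.
  apply Rle_lt_trans with (B * (2 * dist2 x y)).
  - apply box_lipschitz with (W := U p); trivial.
    + intros z Z1 Z2; apply interior2_incl in Hx.
      assert (Hx' := nbhd_thick om (l p) (5 / 4 * l p) x ltac:(lra) Hx).
      apply thick_mono with (2 := thick_box _ _ _ _ _ Hx' Z1 Z2); lra.
    + intros a z Hz; split; [ apply Hg, Hz | ].
      destruct a as [ | a]; [ assert (E := B0 p z Hz) | assert (E := B1 p z Hz) ]; fold T in E; unfold B; [ lra | ].
      change (pd (S a)) with (pd 1); lra.
  - apply Rmult_lt_compat_r with (r := 2 * (B + 1)) in Hd2; trivial.
    replace (eps / (2 * (B + 1)) * (2 * (B + 1))) with eps in Hd2 by (field; lra).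
    assert (0 <= 2 * dist2 x y) by lra; lra.
Qed.

Lemma symb_C2_closed g X L p : symb U 3 g X L -> C2_closed (nbhd om (l p)) (g p).
Proof.
  intros Hg.
  assert (In : forall x, nbhd om (l p) x -> U p x) by (intros x; apply nbhd_thick; assert (T := Hl p); lra).
  split; [ | split; [ | split; [ | split ] ] ].
  - apply continuous_cont_on; intros x Hx; eapply symb_cont; eauto.
  - apply (Ck_open_incl _ (U p)); [ intros x Hx; apply In, interior2_incl, Hx | ].
    eapply symb_Ck_open; [ apply dilate_open | apply symb_S, Hg ].
  - eapply symb_unif_cont; apply symb_S, symb_S, Hg.
  - intros a _; apply (symb_unif_cont (fun p => pd a (g p)) (fun p => X p * L p) L); apply symb_S, symb_pd, Hg.
  - intros a b _ _; apply (symb_unif_cont (fun p => pd b (pd a (g p))) (fun p => X p * L p * L p) L).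
    apply (symb_pd _ _ (fun p => pd a (g p))), symb_pd, Hg.
Qed.
End Regularity.

Section Conclusion.
Context (om : pt -> Prop) (Hom : bounded2 om).
Notation P := (datum om).
Notation dom := (dilate (P := datum om) om dl).

Lemma dom_bounded : exists B, 0 <= B /\ forall (p : P) x, dom (3 / 2) p x -> Rabs (fst x) <= B /\ Rabs (snd x) <= B.
Proof.
  destruct Hom as [B HB]; exists (Rabs B + 2); split; [ assert (T := Rabs_pos B); lra | ].
  intros p x [y [Hy Hd]]; destruct (HB y Hy) as [B1 B2]; destruct (dist2_coord x y) as [D1 D2].
  destruct (dl_pos om p) as [L1 L2]; assert (T := Rle_abs B).
  apply Rabs_le_between in B1; apply Rabs_le_between in B2; apply Rabs_le_between in D1; apply Rabs_le_between in D2.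
  split; apply Rabs_le; lra.
Qed.

(** The new maps are chosen as functions of the datum before [C], so one constant serves all
    data. *)
Lemma perturbation : exists vt wt : P -> nat -> pt -> R,
  (forall i, (i < 3)%nat -> exists X L, symb (dom (3 / 2)) 3 (fun p => vt p i) X L) /\
  (forall b, (b < 2)%nat -> exists X L, symb (dom (3 / 2)) 3 (fun p => wt p b) X L) /\
  exists C, 0 <= C /\ forall p x, dom (3 / 2) p x ->
    (forall i, (i < 3)%nat -> Rabs (vt p i x - dv p i x) <= C * de om p /\
       (forall a, Rabs (pd a (vt p i) x - pd a (dv p i) x) <= C * de om p) /\
       (forall a c, Rabs (hpd (vt p i) a c x) <= C * dH om p)) /\
    (forall b, (b < 2)%nat -> Rabs (wt p b x - dw p b x) <= C * (de om p * (1 + dG om p)) /\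
       (forall a, Rabs (pd a (wt p b) x - pd a (dw p b) x) <= C * (de om p * (1 + dG om p))) /\
       (forall a c, Rabs (hpd (wt p b) a c x) <= C * (dH om p * (1 + dG om p)))) /\
    (forall a b, (a < 2)%nat -> (b < 2)%nat ->
       Rabs (defect (dA p) (vt p) (wt p) a b x) <= C * (dHo p + (de om p * / drho p ^ 3) ^ 2)).
Proof.
  assert (OU : openf (dom (3 / 2))) by apply dilate_open.
  assert (lp : forall p : P, 0 < dl p) by (intros p; apply dl_pos).
  assert (St := initial_stage om).
  assert (ep := de_pos om); assert (eG := de_G om).
  assert (HA : forall p x, dom (3 / 2) p x -> A0 om p 0%nat 1%nat x = A0 om p 1%nat 0%nat x).
  { intros p x Hx; apply (mol_ext _ _ (layer_chain om dl lp p)); [ | apply layer20, Hx ].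
    intros y Hy; apply dA_sym, (layer0 om dl lp), Hy. }
  destruct (three_stages (dom (3 / 2)) OU (dG om) drho (dH om) (A0 om) (drho_ge om) HA dom_bounded
    _ _ _ _ (freq0_ge1 om) ep eG (fun p => eq_refl) St) as [vt [wt [St' [C [HC Cl]]]]].
  exists vt, wt.
  split; [ | split ].
  { intros i Hi; destruct (st_v _ _ _ _ _ _ _ _ _ St' i Hi) as [X [_ H]]; do 2 eexists; apply symb_S, H. }
  { intros b Hb; destruct (st_w _ _ _ _ _ _ _ _ _ St' b Hb) as [X [_ H]]; do 2 eexists; exact H. }
  assert (Hn : forall p : P, 0 < dH om p).
  { intros p; unfold dH; assert (T1 := ep p); assert (T2 := freq0_ge1 om p); assert (T3 := drho_ge om p).
    apply Rmult_lt_0_compat; [ apply Rmult_lt_0_compat | ]; lra. }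
  assert (Hh : exists C, 0 <= C /\ forall i a c (p : P) x, (i < 3)%nat -> dom (3 / 2) p x -> Rabs (hpd (vt p i) a c x) <= C * dH om p).
  { assert (H1 : forall i a c, (i < 3)%nat -> exists C, 0 <= C /\ forall (p : P) x, dom (3 / 2) p x -> Rabs (hpd (vt p i) a c x) <= C * dH om p).
    { intros i a c Hi; destruct (symb_bound _ _ _ _ _ (st_hess _ _ _ _ _ _ _ _ _ St' i a c Hi)) as [D [HD HB]].
      exists D; split; trivial; intros p x Hx; apply Rle_trans with (1 := HB p x Hx).
      apply Req_le; f_equal; rewrite Rabs_pos_eq.
      (* The factors [rho^3] gained by the frequency and lost by the amplitude cancel. *)
      - unfold dH; assert (T3 := drho_ge om p); assert (T := lp p); field; lra.
      - assert (T1 := ep p); assert (T2 := freq0_ge1 om p); assert (T3 := drho_ge om p).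
        assert (T4 : 0 < drho p ^ 3) by (apply pow_lt; lra).
        assert (T5 : 0 < / drho p ^ 3) by (apply Rinv_0_lt_compat, T4).
        assert (T6 : 0 < / dl p) by (apply Rinv_0_lt_compat, lp).
        repeat apply Rmult_le_pos; lra. }
    assert (H2 : forall i, (i < 3)%nat -> exists C, 0 <= C /\ forall a c (p : P) x, dom (3 / 2) p x -> Rabs (hpd (vt p i) a c x) <= C * dH om p).
    { intros i Hi.
      destruct (H1 i 0%nat 0%nat Hi) as [C1 [P1 Q1]]; destruct (H1 i 0%nat 1%nat Hi) as [C2 [P2 Q2]];
      destruct (H1 i 1%nat 0%nat Hi) as [C3 [P3 Q3]]; destruct (H1 i 1%nat 1%nat Hi) as [C4 [P4 Q4]].
      exists (C1 + C2 + C3 + C4); split; [ lra | ]; intros a c p x Hx; assert (T := Hn p).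
      assert (0 <= C1 * dH om p) by (apply Rmult_le_pos; lra). assert (0 <= C2 * dH om p) by (apply Rmult_le_pos; lra).
      assert (0 <= C3 * dH om p) by (apply Rmult_le_pos; lra). assert (0 <= C4 * dH om p) by (apply Rmult_le_pos; lra).
      rewrite !Rmult_plus_distr_r; destruct a as [ | a], c as [ | c];
      [ assert (E := Q1 p x Hx)
      | assert (E := Q2 p x Hx); change (hpd (vt p i) 0 (S c)) with (hpd (vt p i) 0 1)
      | assert (E := Q3 p x Hx); change (hpd (vt p i) (S a) 0) with (hpd (vt p i) 1 0)
      | assert (E := Q4 p x Hx); change (hpd (vt p i) (S a) (S c)) with (hpd (vt p i) 1 1) ]; lra. }
    destruct (H2 0%nat ltac:(lia)) as [C1 [P1 Q1]]; destruct (H2 1%nat ltac:(lia)) as [C2 [P2 Q2]];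
    destruct (H2 2%nat ltac:(lia)) as [C3 [P3 Q3]].
    exists (C1 + C2 + C3); split; [ lra | ]; intros i a c p x Hi Hx; assert (T := Hn p).
    assert (0 <= C1 * dH om p) by (apply Rmult_le_pos; lra). assert (0 <= C2 * dH om p) by (apply Rmult_le_pos; lra).
    assert (0 <= C3 * dH om p) by (apply Rmult_le_pos; lra).
    assert (E1 := Q1 a c p x Hx); assert (E2 := Q2 a c p x Hx); assert (E3 := Q3 a c p x Hx).
    rewrite !Rmult_plus_distr_r; destruct i as [ | [ | [ | i]]]; try lia; lra. }
  destruct Hh as [Ch [HCh Hh]].
  assert (Hd : exists C, 0 <= C /\ forall a b (p : P) x, (a < 2)%nat -> (b < 2)%nat -> dom (3 / 2) p x ->
     Rabs (defect (A0 om p) (vt p) (wt p) a b x) <= C * (de om p * / drho p ^ 3) ^ 2).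
  { assert (H1 : forall a b, (a < 2)%nat -> (b < 2)%nat -> exists C, 0 <= C /\ forall (p : P) x, dom (3 / 2) p x ->
       Rabs (defect (A0 om p) (vt p) (wt p) a b x) <= C * (de om p * / drho p ^ 3) ^ 2).
    { intros a b Ha Hb; destruct (symb_bound _ _ _ _ _ (st_defect _ _ _ _ _ _ _ _ _ St' a b Ha Hb)) as [D [HD HB]].
      exists D; split; trivial; intros p x Hx; apply Rle_trans with (1 := HB p x Hx).
      apply Req_le; f_equal; apply Rabs_pos_eq, pow2_ge_0. }
    destruct (H1 0%nat 0%nat ltac:(lia) ltac:(lia)) as [C1 [P1 Q1]]; destruct (H1 0%nat 1%nat ltac:(lia) ltac:(lia)) as [C2 [P2 Q2]];
    destruct (H1 1%nat 0%nat ltac:(lia) ltac:(lia)) as [C3 [P3 Q3]]; destruct (H1 1%nat 1%nat ltac:(lia) ltac:(lia)) as [C4 [P4 Q4]].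
    exists (C1 + C2 + C3 + C4); split; [ lra | ]; intros a b p x Ha Hb Hx; assert (T := pow2_ge_0 (de om p * / drho p ^ 3)).
    assert (Z1 := Rmult_le_pos _ _ P1 T); assert (Z2 := Rmult_le_pos _ _ P2 T); assert (Z3 := Rmult_le_pos _ _ P3 T); assert (Z4 := Rmult_le_pos _ _ P4 T).
    assert (E1 := Q1 p x Hx); assert (E2 := Q2 p x Hx); assert (E3 := Q3 p x Hx); assert (E4 := Q4 p x Hx).
    rewrite !Rmult_plus_distr_r; destruct a as [ | [ | a]], b as [ | [ | b]]; try lia; lra. }
  destruct Hd as [Cd [HCd Hd]].
  (* [C] accounts for the stages, [Ch] and [Cd] for the final Hessian and defect, and 1 for the
     mollification errors. *)
  exists (C + Ch + Cd + 1); split; [ lra | ]; intros p x Hx.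
  assert (In : dom 2 p x) by (apply thick_mono with (2 := Hx); assert (T := lp p); lra).
  assert (e0 := ep p); assert (g0 := eG p); assert (h0 := Hn p); assert (m0 := lM_le om p); assert (Mp := dM_pos om p).
  destruct (dgv_bd om p) as [_ Hgv].
  assert (Big : forall c t y, 0 <= c <= C + Ch + Cd + 1 -> 0 <= t -> y <= c * t -> y <= (C + Ch + Cd + 1) * t).
  { intros c t y Hc Ht Hy; apply Rle_trans with (1 := Hy), Rmult_le_compat_r; lra. }
  assert (Ml : dM p * dl p <= 1 * de om p) by lra.
  assert (Gp : 0 < 1 + dG om p) by lra.
  assert (eG1 : de om p <= de om p * (1 + dG om p)).
  { apply Rle_trans with (de om p * 1); [ lra | apply Rmult_le_compat_l; lra ]. }
  assert (eG0 : 0 <= de om p * (1 + dG om p)) by lra.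
  assert (HG0 : 0 <= dH om p * (1 + dG om p)) by (apply Rmult_le_pos; lra).
  destruct (Cl p x Hx) as [Cv Cw].
  split; [ | split ].
  - intros i Hi; destruct (Cv i Hi) as [E1 E2].
    assert (Dv := datum_v om p i Hi).
    split; [ | split ].
    + apply Big with (C + 1); try lra.
      replace ((C + 1) * de om p) with (1 * de om p + C * de om p) by ring.
      apply (Rabs_chain _ (v0 om p i x)); [ exact E1 | ].
      apply Rle_trans with (2 := Ml).
      apply (moll_approx om dl lp p (dv p i) (dM p) x).
      * exact (C2bd_continuous _ _ _ _ Dv).
      * intros a y Hy; split; [ exact (C2bd_ex_pd _ _ _ _ Dv a y Hy) | ].
        apply Rle_trans with (1 := C2bd_pd_le _ _ _ _ Dv a y Hy); trivial.
      * exact Hx.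
    + intros a; apply Big with (C + 1); try lra.
      replace ((C + 1) * de om p) with (1 * de om p + C * de om p) by ring.
      apply (Rabs_chain _ (pd a (v0 om p i) x)); [ exact (E2 a) | ].
      rewrite (is_pd_unique _ _ _ _ (is_pd_v0 om p i a x Hi Hx)).
      apply Rle_trans with (2 := Ml).
      apply (moll_approx om dl lp p (pd a (dv p i)) (dM p) x).
      * exact (C2bd_continuous_pd _ _ _ _ Dv a).
      * intros c y Hy; split; [ exact (C2bd_ex_hpd _ _ _ _ Dv a c y Hy) | exact (C2bd_hpd_le _ _ _ _ Dv a c y Hy) ].
      * exact Hx.
    + intros a c; apply Big with Ch; try lra; apply Hh; trivial.
  - intros b Hb; destruct (Cw b Hb) as [E1 [E2 E3]].
    assert (Dw := datum_w om p b Hb).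
    assert (Ml' : dM p * dl p <= 1 * (de om p * (1 + dG om p))) by lra.
    split; [ | split ].
    + apply Big with (C + 1); try lra.
      replace ((C + 1) * (de om p * (1 + dG om p))) with (1 * (de om p * (1 + dG om p)) + C * (de om p * (1 + dG om p))) by ring.
      apply (Rabs_chain _ (w0 om p b x)); [ exact E1 | ].
      apply Rle_trans with (2 := Ml').
      apply (moll_approx om dl lp p (dw p b) (dM p) x).
      * exact (C2bd_continuous _ _ _ _ Dw).
      * intros a y Hy; split; [ exact (C2bd_ex_pd _ _ _ _ Dw a y Hy) | exact (C2bd_pd_le _ _ _ _ Dw a y Hy) ].
      * exact Hx.
    + intros a; apply Big with (C + 1); try lra.
      replace ((C + 1) * (de om p * (1 + dG om p))) with (1 * (de om p * (1 + dG om p)) + C * (de om p * (1 + dG om p))) by ring.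
      apply (Rabs_chain _ (pd a (w0 om p b) x)); [ exact (E2 a) | ].
      rewrite (is_pd_unique _ _ _ _ (is_pd_w0 om p b a x Hb Hx)).
      apply Rle_trans with (2 := Ml').
      apply (moll_approx om dl lp p (pd a (dw p b)) (dM p) x).
      * exact (C2bd_continuous_pd _ _ _ _ Dw a).
      * intros c y Hy; split; [ exact (C2bd_ex_hpd _ _ _ _ Dw a c y Hy) | exact (C2bd_hpd_le _ _ _ _ Dw a c y Hy) ].
      * exact Hx.
    + intros a c; apply Big with (C + 1); try lra.
      replace ((C + 1) * (dH om p * (1 + dG om p))) with (1 * (dH om p * (1 + dG om p)) + C * (dH om p * (1 + dG om p))) by ring.
      rewrite <- (Rminus_0_r (hpd (wt p b) a c x)).
      apply (Rabs_chain _ (hpd (w0 om p b) a c x)); [ exact (E3 a c) | ].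
      rewrite hpd_w0 by trivial.
      apply (moll_near om dl lp p (hpd (dw p b) a c) 0 _ x).
      * exact (C2bd_continuous_hpd _ _ _ _ Dw a c).
      * exact Hx.
      * intros y Hy _ _; rewrite Rminus_0_r; apply Rle_trans with (1 := C2bd_hpd_le _ _ _ _ Dw a c y Hy).
        apply Rle_trans with (1 := dM_le om p).
        assert (T1 := drho_ge om p); assert (T2 := lp p); assert (T3 : 0 < / dl p) by (apply Rinv_0_lt_compat; trivial).
        assert (Q : 0 < de om p * / dl p) by (apply Rmult_lt_0_compat; trivial).
        replace (1 * (dH om p * (1 + dG om p))) with ((de om p * / dl p) * (drho p * drho p * (1 + dG om p))) by (unfold dH; ring).
        apply Rle_trans with ((de om p * / dl p) * 1); [ lra | ]; apply Rmult_le_compat_l; [ lra | ].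
        assert (1 <= drho p * drho p) by nra.
        apply Rle_trans with (1 * 1); [ lra | ]; apply Rmult_le_compat; lra.
  - intros a b Ha Hb.
    (* The stages ran with the mollified [A0]; returning to [A] costs its oscillation at distance
       [dl]. *)
    replace (defect (dA p) (vt p) (wt p) a b x) with (defect (A0 om p) (vt p) (wt p) a b x - (A0 om p a b x - dA p a b x))
      by (unfold defect; ring).
    unfold Rminus at 1; apply Rle_trans with (1 := Rabs_triang _ _); rewrite Rabs_Ropp.
    assert (T := pow2_ge_0 (de om p * / drho p ^ 3)).
    assert (E1 := Hd a b p x Ha Hb Hx).
    assert (E2 : Rabs (A0 om p a b x - dA p a b x) <= dHo p).
    { apply (moll_near om dl lp p (dA p a b) (dA p a b x) _ x); trivial.
      - intros y Hy; apply dA_cont; trivial.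
      - intros y Hy Y1 Y2; apply dA_osc; trivial.
        apply Rle_trans with (1 := dist2_le_sum y x); assert (T' := lp p); lra. }
    assert (E3 : 0 <= dHo p) by (apply Rle_trans with (2 := E2), Rabs_pos).
    rewrite Rmult_plus_distr_l, Rplus_comm; apply Rplus_le_compat.
    + apply Big with 1; lra.
    + apply Big with Cd; lra.
Qed.
End Conclusion.

(** * Sup norms and exponents *)
(** [real] sends an infinite supremum to 0, so a finite upper bound has to be known beforehand. *)
Lemma lub_ge (E : R -> Prop) y B : (forall z, E z -> z <= B) -> E y -> y <= real (Lub_Rbar E).
Proof.
  intros HB Hy; destruct (Lub_Rbar_correct E) as [H1 H2].
  assert (T1 := H1 y Hy); assert (T2 := H2 (Finite B) HB).
  destruct (Lub_Rbar E); simpl in *; trivial; contradiction.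
Qed.

(** The condition [0 <= B] covers the empty set, whose supremum [m_infty] is read as 0. *)
Lemma lub_le (E : R -> Prop) B : 0 <= B -> (forall z, E z -> z <= B) -> real (Lub_Rbar E) <= B.
Proof.
  intros H0 HB; destruct (Lub_Rbar_correct E) as [H1 H2].
  assert (T2 := H2 (Finite B) HB); destruct (Lub_Rbar E); simpl in *; trivial; contradiction.
Qed.

Lemma supn_ge (S : pt -> Prop) h B x : (forall y, S y -> Rabs (h y) <= B) -> S x -> Rabs (h x) <= supn S h.
Proof.
  intros HB Hx; apply lub_ge with B; [ intros z [y [Hy ->]]; auto | exists x; auto ].
Qed.

Lemma supn_le S h B : 0 <= B -> (forall y, S y -> Rabs (h y) <= B) -> supn S h <= B.
Proof. intros H0 HB; apply lub_le; trivial; intros z [y [Hy ->]]; auto. Qed.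

Lemma lub_nonneg (E : R -> Prop) : (forall z, E z -> 0 <= z) -> 0 <= real (Lub_Rbar E).
Proof.
  intros HE; destruct (Lub_Rbar_correct E) as [H1 H2].
  destruct (classic (exists z, E z)) as [[z Hz] | Hn].
  - assert (T := H1 z Hz); assert (T' := HE z Hz); destruct (Lub_Rbar E); simpl in *; lra.
  - assert (T : Rbar_le (Lub_Rbar E) m_infty) by (apply H2; intros z Hz; destruct Hn; eauto).
    destruct (Lub_Rbar E); simpl in *; try contradiction; lra.
Qed.

Lemma supn_nonneg S h : 0 <= supn S h.
Proof. apply lub_nonneg; intros z [x [_ ->]]; apply Rabs_pos. Qed.

Lemma holder_semi_nonneg beta S g : 0 <= holder_semi beta S g.
Proof.
  apply lub_nonneg; intros z [x [y [_ [_ [_ ->]]]]]; apply Rmult_le_pos; [ apply Rabs_pos | ].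
  left; apply Rinv_0_lt_compat, exp_pos.
Qed.

Lemma dist2_pos x y : x <> y -> 0 < dist2 x y.
Proof.
  intros Hxy; destruct (Rle_lt_or_eq_dec _ _ (sqrt_pos ((fst x - fst y) ^ 2 + (snd x - snd y) ^ 2))) as [L | E]; trivial.
  exfalso; apply Hxy; destruct (dist2_coord x y) as [D1 D2]; unfold dist2 in *; rewrite <- E in D1, D2.
  apply Rabs_le_between in D1; apply Rabs_le_between in D2; destruct x, y; simpl in *; f_equal; lra.
Qed.

Lemma maxR_ge n f i : (i < n)%nat -> f i <= maxR n f.
Proof.
  intros Hi; unfold maxR; assert (HI : In i (seq 0 n)) by (apply in_seq; lia).
  induction (seq 0 n) as [ | j s IH]; [ destruct HI | simpl ].
  destruct HI as [-> | HI]; [ apply Rmax_l | apply Rle_trans with (2 := Rmax_r _ _); auto ].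
Qed.

Lemma maxR_le n f B : 0 <= B -> (forall i, (i < n)%nat -> f i <= B) -> maxR n f <= B.
Proof.
  intros H0 HB; unfold maxR; assert (HI : forall i, In i (seq 0 n) -> f i <= B) by (intros i Hi; apply HB; apply in_seq in Hi; lia).
  induction (seq 0 n) as [ | j s IH]; simpl; trivial.
  apply Rmax_lub; [ apply HI; left; trivial | apply IH; intros i Hi; apply HI; right; trivial ].
Qed.

Lemma maxR_nonneg n f : 0 <= maxR n f.
Proof.
  unfold maxR; induction (seq 0 n) as [ | j s IH]; simpl; [ lra | apply Rle_trans with (2 := Rmax_r _ _); trivial ].
Qed.

(** Finitely many strips of width [s] cover the range of the coordinate [c]; the induction adds one
    strip at a time, starting below all values. *)
Lemma strips_bounded (T : pt -> Prop) (c g : pt -> R) R0 s : 0 < s -> (forall x, T x -> Rabs (c x) <= R0) ->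
  (forall t, exists B, forall x, T x -> t <= c x <= t + s -> Rabs (g x) <= B) ->
  exists B, forall x, T x -> Rabs (g x) <= B.
Proof.
  intros Hs Hc H.
  assert (HN : forall n, exists B, forall x, T x -> c x <= - R0 - 1 + INR n * s -> Rabs (g x) <= B).
  { induction n as [ | n [B HB]].
    - exists 0; intros x Hx Hcx; assert (E := Hc x Hx); apply Rabs_le_between in E; simpl in Hcx; lra.
    - destruct (H (- R0 - 1 + INR n * s)) as [B' HB'].
      exists (Rmax B B'); intros x Hx Hcx; rewrite S_INR in Hcx.
      destruct (Rle_lt_dec (c x) (- R0 - 1 + INR n * s)) as [L | L].
      + apply Rle_trans with (2 := Rmax_l _ _); auto.
      + apply Rle_trans with (2 := Rmax_r _ _); apply HB'; trivial; lra. }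
  destruct (INR_unbounded ((2 * R0 + 1) / s)) as [n Hn].
  destruct (HN n) as [B HB]; exists B; intros x Hx; apply HB; trivial.
  assert (E := Hc x Hx); apply Rabs_le_between in E.
  apply Rmult_lt_compat_r with (r := s) in Hn; trivial.
  replace ((2 * R0 + 1) / s * s) with (2 * R0 + 1) in Hn by (field; lra); lra.
Qed.

(** Squares of side [d / 3] have diameter below [d]. As [S] may be disconnected, each square gets a
    reference point of its own, found classically, or is disjoint from [S]. *)
Lemma unif_cont_bounded S g : bounded2 S -> unif_cont_on S g -> exists B, forall x, S x -> Rabs (g x) <= B.
Proof.
  intros [R0 HR] Hg; destruct (Hg 1 Rlt_0_1) as [d [Hd H]].
  apply (strips_bounded S fst g R0 (d / 3)); [ lra | intros x Hx; apply HR, Hx | ]; intros t.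
  destruct (strips_bounded (fun x => S x /\ t <= fst x <= t + d / 3) snd g R0 (d / 3)) as [B HB];
    [ lra | intros x [Hx _]; apply HR, Hx | | exists B; intros x Hx Ht; apply HB; auto ].
  intros u; destruct (classic (exists y, (S y /\ t <= fst y <= t + d / 3) /\ u <= snd y <= u + d / 3)) as [[y [[Hy Y1] Y2]] | Hn].
  - exists (Rabs (g y) + 1); intros x [Hx X1] X2.
    assert (E : Rabs (g x - g y) < 1).
    { apply H; trivial; assert (D := dist2_le_sum y x).
      assert (Rabs (fst y - fst x) <= d / 3) by (apply Rabs_le; lra).
      assert (Rabs (snd y - snd x) <= d / 3) by (apply Rabs_le; lra). lra. }
    replace (g x) with (g y + (g x - g y)) by ring.
    apply Rle_trans with (1 := Rabs_triang _ _); lra.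
  - exists 0; intros x Hx X2; destruct Hn; exists x; auto.
Qed.

Lemma nbhd_bounded om r : bounded2 om -> bounded2 (nbhd om r).
Proof.
  intros [B HB]; exists (Rabs B + Rabs r + 1); intros x Hx.
  apply (nbhd_thick om r (r + 1)) in Hx; [ | lra ].
  destruct Hx as [y [Hy Hd]]; destruct (HB y Hy) as [B1 B2]; destruct (dist2_coord x y) as [D1 D2].
  assert (T := Rle_abs B); assert (T' := Rle_abs r).
  apply Rabs_le_between in B1; apply Rabs_le_between in B2; apply Rabs_le_between in D1; apply Rabs_le_between in D2.
  split; apply Rabs_le; lra.
Qed.

Lemma holder_unif_cont beta S g : 0 < beta -> holder_on beta S g -> unif_cont_on S g.
Proof.
  intros Hb [H HH] eps He.
  (* The added 1 keeps the quotient defined and positive when the Hoelder constant is 0. *)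
  set (q := eps / (Rabs H + 1)).
  assert (TH := Rabs_pos H); assert (TH' := Rle_abs H).
  assert (Hq : 0 < q) by (apply Rdiv_lt_0_compat; lra).
  exists (Rpower q (/ beta)); split; [ apply exp_pos | ]; intros x y Hx Hy Hd.
  destruct (classic (x = y)) as [-> | Hxy]; [ rewrite Rminus_diag, Rabs_R0; trivial | ].
  assert (Hn := dist2_pos x y Hxy).
  assert (HP : 0 < Rpower (dist2 x y) beta) by apply exp_pos.
  assert (HL : Rpower (dist2 x y) beta < q).
  { replace q with (Rpower (Rpower q (/ beta)) beta).
    - apply Rlt_Rpower_l; trivial; split; trivial.
    - rewrite Rpower_mult, Rinv_l, Rpower_1; trivial; lra. }
  assert (E := HH x y Hx Hy Hxy).
  apply Rmult_le_compat_r with (r := Rpower (dist2 x y) beta) in E; [ | lra ].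
  unfold Rdiv in E; rewrite Rmult_assoc, Rinv_l, Rmult_1_r in E by lra.
  rewrite Rabs_minus_sym; apply Rle_lt_trans with (1 := E).
  apply Rle_lt_trans with (Rabs H * Rpower (dist2 x y) beta); [ apply Rmult_le_compat_r; lra | ].
  apply Rle_lt_trans with (Rabs H * q); [ apply Rmult_le_compat_l; lra | ].
  replace eps with ((Rabs H + 1) * q) by (unfold q; field; lra); lra.
Qed.

Lemma holder_le beta S g r x y : 0 < beta -> 0 < r -> holder_on beta S g -> S x -> S y -> dist2 x y <= r ->
  Rabs (g x - g y) <= Rpower r beta * (supn S g + holder_semi beta S g).
Proof.
  intros Hb Hr [H HH] Hx Hy Hd; assert (Hs := supn_nonneg S g).
  assert (HP : 0 < Rpower r beta) by apply exp_pos.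
  assert (Up : forall z, (exists x z0, S x /\ S z0 /\ x <> z0 /\ z = Rabs (g x - g z0) / Rpower (dist2 x z0) beta) -> z <= H)
    by (intros z [u [w [Hu [Hw [Huw ->]]]]]; auto).
  destruct (classic (x = y)) as [-> | Hxy].
  { rewrite Rminus_diag, Rabs_R0; assert (T := holder_semi_nonneg beta S g); apply Rmult_le_pos; lra. }
  assert (Hq : Rabs (g x - g y) / Rpower (dist2 x y) beta <= holder_semi beta S g)
    by (apply lub_ge with H; [ exact Up | exists x, y; auto ]).
  assert (HD : 0 < Rpower (dist2 x y) beta) by apply exp_pos.
  assert (Q0 : 0 <= Rabs (g x - g y) / Rpower (dist2 x y) beta)
    by (apply Rmult_le_pos; [ apply Rabs_pos | left; apply Rinv_0_lt_compat, HD ]).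
  replace (Rabs (g x - g y)) with (Rpower (dist2 x y) beta * (Rabs (g x - g y) / Rpower (dist2 x y) beta)) by (field; lra).
  apply Rmult_le_compat; try lra.
  assert (Hn := dist2_pos x y Hxy).
  apply Rle_Rpower_l; lra.
Qed.

Lemma fib_SS k : fib (S (S k)) = (fib k + fib (S k))%nat.
Proof. reflexivity. Qed.

Lemma fib_growth k : (1 <= fib k <= fib (S k))%nat /\ (fib (S k) <= 2 * fib k)%nat.
Proof.
  induction k as [ | k IH]; [ simpl; lia | rewrite fib_SS; lia ].
Qed.

(** Since [F_(K-1)] is at least half of [F_K], [F_(K+1)] is at least [3/2] of it. Hence [3 J] is at
    least [(9/4 F_K - 3/2) N], which exceeds [2 (F_K - 1) N]. *)
Lemma exponent_le N K : (4 <= K)%nat -> 0 <= Jexp N K /\ INR (2 * (fib K - 1) * N) <= 3 * Jexp N K.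
Proof.
  intros HK; destruct K as [ | K]; [ lia | ].
  destruct (fib_growth K) as [G1 G2]; destruct (fib_growth (S K)) as [G3 G4].
  assert (F5 : (5 <= fib (S K))%nat).
  { assert (M : forall j, (5 <= fib (j + 4))%nat).
    { induction j as [ | j IH]; [ simpl; lia | ]; destruct (fib_growth (j + 4)); change (S j + 4)%nat with (S (j + 4)); lia. }
    replace (S K) with ((K - 3) + 4)%nat by lia; apply M. }
  assert (E : (2 * fib (S K + 1) >= 3 * fib (S K))%nat)
    by (replace (S K + 1)%nat with (S (S K)) by lia; rewrite fib_SS; lia).
  unfold Jexp; rewrite !mult_INR, minus_INR by lia; simpl (INR 2); simpl (INR 1).
  apply le_INR in E; rewrite !mult_INR in E; simpl (INR 2) in E; simpl (INR 3) in E.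
  apply le_INR in F5; simpl (INR 5) in F5.
  assert (HN := pos_INR N).
  split; nra.
Qed.

Lemma interior2_bounded S : bounded2 S -> bounded2 (interior2 S).
Proof. intros [B HB]; exists B; intros x Hx; apply HB, interior2_incl, Hx. Qed.

(** All indices from 1 on mean the same derivative, so the bounds for 0 and 1 that the norms supply
    extend to every index. *)
Lemma pd_cases (Q : nat -> Prop) : (forall a, Q (S a) <-> Q 1%nat) -> (forall a, (a < 2)%nat -> Q a) -> forall a, Q a.
Proof. intros H1 H2 [ | a]; [ apply H2; lia | apply H1, H2; lia ]. Qed.

Section Norms.
Context (n : nat) (S : pt -> Prop) (v : nat -> pt -> R) (HS : bounded2 S).
Context (Hv : forall i, (i < n)%nat -> C2_closed S (v i)).

Lemma grad0_ge i a x : (i < n)%nat -> interior2 S x -> Rabs (pd a (v i) x) <= grad0 n S v.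
Proof.
  intros Hi Hx; revert a; apply pd_cases; [ intros; reflexivity | ]; intros a Ha.
  destruct (Hv i Hi) as [_ [_ [_ [H _]]]].
  destruct (unif_cont_bounded _ _ (interior2_bounded S HS) (H a Ha)) as [B HB].
  apply Rle_trans with (1 := supn_ge _ _ B x HB Hx); unfold grad0.
  apply Rle_trans with (2 := maxR_ge n _ i Hi).
  exact (maxR_ge 2 (fun a => supn (interior2 S) (pd a (v i))) a Ha).
Qed.

Lemma hess0_ge i a b x : (i < n)%nat -> interior2 S x -> Rabs (hpd (v i) a b x) <= hess0 n S v.
Proof.
  intros Hi Hx; revert a; apply pd_cases; [ intros; reflexivity | ]; intros a Ha.
  revert b; apply pd_cases; [ intros; reflexivity | ]; intros b Hb.
  destruct (Hv i Hi) as [_ [_ [_ [_ H]]]].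
  destruct (unif_cont_bounded _ _ (interior2_bounded S HS) (H a b Ha Hb)) as [B HB].
  apply Rle_trans with (1 := supn_ge _ _ B x HB Hx); unfold hess0.
  apply Rle_trans with (2 := maxR_ge n _ i Hi).
  apply Rle_trans with (2 := maxR_ge 2 (fun a => maxR 2 (fun b => supn (interior2 S) (pd b (pd a (v i))))) a Ha).
  exact (maxR_ge 2 (fun b => supn (interior2 S) (pd b (pd a (v i)))) b Hb).
Qed.

Lemma C2_closed_bound i : (i < n)%nat -> exists B, forall x, interior2 S x -> Rabs (v i x) <= B.
Proof.
  intros Hi; destruct (Hv i Hi) as [_ [_ [H _]]]; apply unif_cont_bounded; trivial.
  apply interior2_bounded, HS.
Qed.

Lemma C2_closed_C2bd i (W : pt -> Prop) B1 B2 : (i < n)%nat -> (forall x, W x -> interior2 S x) ->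
  grad0 n S v <= B1 -> hess0 n S v <= B2 -> C2bd W (v i) B1 B2.
Proof.
  intros Hi HW H1 H2; destruct (Hv i Hi) as [_ [[C0 CC] _]].
  assert (IO := interior2_open S).
  split; [ intros x Hx; apply (cont_on_continuous _ _ IO C0), HW, Hx | ].
  assert (R1 : forall a, (a < 2)%nat -> forall x, W x -> ex_pd a (v i) x /\ continuous (pd a (v i)) x).
  { intros a Ha x Hx; destruct (CC a Ha) as [E [C1 _]]; split; [ apply E, HW, Hx | ].
    apply (cont_on_continuous _ _ IO C1), HW, Hx. }
  assert (R2 : forall a, (a < 2)%nat -> forall b, (b < 2)%nat -> forall x, W x -> ex_pd b (pd a (v i)) x /\ continuous (hpd (v i) a b) x).
  { intros a Ha b Hb x Hx; destruct (CC a Ha) as [_ [_ C2]]; destruct (C2 b Hb) as [E [C3 _]]; split; [ apply E, HW, Hx | ].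
    apply (cont_on_continuous _ _ IO C3), HW, Hx. }
  intros a; split.
  - intros x Hx.
    assert (T := pd_cases (fun a => ex_pd a (v i) x /\ continuous (pd a (v i)) x) ltac:(intros; reflexivity) (fun a Ha => R1 a Ha x Hx) a).
    destruct T as [T1 T2]; split; [ exact T1 | split; [ exact T2 | ] ].
    apply Rle_trans with (2 := H1), grad0_ge; auto.
  - intros b x Hx.
    assert (T := pd_cases (fun a => ex_pd b (pd a (v i)) x /\ continuous (hpd (v i) a b) x) ltac:(intros; reflexivity)
      (fun a Ha => pd_cases (fun b => ex_pd b (pd a (v i)) x /\ continuous (hpd (v i) a b) x) ltac:(intros; reflexivity)
        (fun b Hb => R2 a Ha b Hb x Hx) b) a).
    destruct T as [T1 T2]; split; [ exact T1 | split; [ exact T2 | ] ].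
    apply Rle_trans with (2 := H2), hess0_ge; auto.
Qed.
End Norms.

Lemma norm1_diff_le n S v w B : 0 <= B ->
  (forall i, (i < n)%nat -> forall x, S x -> Rabs (v i x - w i x) <= B) ->
  (forall i, (i < n)%nat -> forall a x, interior2 S x -> ex_pd a (v i) x /\ ex_pd a (w i) x /\ Rabs (pd a (v i) x - pd a (w i) x) <= B) ->
  norm1 n S (vdiff v w) <= B.
Proof.
  intros HB H0 H1; apply Rmax_lub.
  - apply maxR_le; trivial; intros i Hi; apply supn_le; trivial; intros x Hx; apply H0; trivial.
  - apply maxR_le; trivial; intros i Hi; apply maxR_le; trivial; intros a Ha; apply supn_le; trivial; intros x Hx.
    destruct (H1 i Hi a x Hx) as [E1 [E2 E3]].
    rewrite (is_pd_unique a (vdiff v w i) x (pd a (v i) x - pd a (w i) x)); trivial.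
    apply is_pd_minus; apply pd_correct; trivial.
Qed.

Lemma hess0_le n S v B : 0 <= B ->
  (forall i, (i < n)%nat -> forall a b x, interior2 S x -> Rabs (hpd (v i) a b x) <= B) -> hess0 n S v <= B.
Proof.
  intros HB H; apply maxR_le; trivial; intros i Hi; apply maxR_le; trivial; intros a Ha; apply maxR_le; trivial; intros b Hb.
  apply supn_le; trivial; intros x Hx; apply H; trivial.
Qed.

Lemma mnorm0_le S D B : 0 <= B ->
  (forall a b, (a < 2)%nat -> (b < 2)%nat -> forall x, S x -> Rabs (D a b x) <= B) -> mnorm0 S D <= B.
Proof.
  intros HB H; apply maxR_le; trivial; intros a Ha; apply maxR_le; trivial; intros b Hb.
  apply supn_le; trivial; intros x Hx; apply H; trivial.
Qed.

Lemma mnorm0_ge S D a b B x : (a < 2)%nat -> (b < 2)%nat -> (forall y, S y -> Rabs (D a b y) <= B) -> S x ->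
  Rabs (D a b x) <= mnorm0 S D.
Proof.
  intros Ha Hb HB Hx; apply Rle_trans with (1 := supn_ge _ _ B x HB Hx); unfold mnorm0.
  apply Rle_trans with (2 := maxR_ge 2 _ a Ha).
  exact (maxR_ge 2 (fun b => supn S (D a b)) b Hb).
Qed.

Lemma Rabs_mult_le x y X Y : Rabs x <= X -> Rabs y <= Y -> Rabs (x * y) <= X * Y.
Proof. intros; rewrite Rabs_mult; apply Rmult_le_compat; auto using Rabs_pos. Qed.

Lemma defect_bounded (W : pt -> Prop) A v w BA Bv Bw a b : (a < 2)%nat -> (b < 2)%nat ->
  (forall x, W x -> Rabs (A a b x) <= BA) ->
  (forall i c x, (i < 3)%nat -> W x -> Rabs (pd c (v i) x) <= Bv) ->
  (forall i c x, (i < 2)%nat -> W x -> Rabs (pd c (w i) x) <= Bw) ->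
  forall x, W x -> Rabs (defect A v w a b x) <= BA + (3 * (Bv * Bv) + Bw).
Proof.
  intros Ha Hb HA Hv Hw x Hx; unfold defect.
  assert (E := HA x Hx).
  assert (E0 := Rabs_mult_le _ _ _ _ (Hv 0%nat a x ltac:(lia) Hx) (Hv 0%nat b x ltac:(lia) Hx)).
  assert (E1 := Rabs_mult_le _ _ _ _ (Hv 1%nat a x ltac:(lia) Hx) (Hv 1%nat b x ltac:(lia) Hx)).
  assert (E2 := Rabs_mult_le _ _ _ _ (Hv 2%nat a x ltac:(lia) Hx) (Hv 2%nat b x ltac:(lia) Hx)).
  assert (E3 := Hw b a x Hb Hx); assert (E4 := Hw a b x Ha Hx).
  assert (Q := Rle_trans _ _ _ (Rabs_pos _) E0).
  apply Rabs_le_between in E; apply Rabs_le_between in E0; apply Rabs_le_between in E1;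
  apply Rabs_le_between in E2; apply Rabs_le_between in E3; apply Rabs_le_between in E4.
  apply Rabs_le; lra.
Qed.

Lemma Rpower_ge1 x y : 1 <= x -> 0 <= y -> 1 <= Rpower x y.
Proof.
  intros Hx Hy; rewrite <- (Rpower_O x) by lra.
  destruct (Rle_lt_or_eq_dec _ _ Hx) as [H | <-]; [ apply Rle_Rpower; lra | ].
  unfold Rpower; rewrite ln_1, !Rmult_0_r; lra.
Qed.

Lemma Rpower_mono x y z : 1 <= x -> y <= z -> Rpower x y <= Rpower x z.
Proof.
  intros Hx Hy; destruct (Rle_lt_or_eq_dec _ _ Hx) as [H | <-]; [ apply Rle_Rpower; lra | ].
  unfold Rpower; rewrite ln_1, !Rmult_0_r; lra.
Qed.

(** As [l < 1], a frequency below 1 would make the product smaller than 1. Once [lam >= 1], the full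
    power dominates the power [1 - gam]. *)
Lemma frequency_ge1 lam l gam : 0 < lam -> 0 < l < 1 -> 0 < gam < 1 -> 1 <= Rpower lam (1 - gam) * l ->
  1 <= lam /\ 1 <= lam * l.
Proof.
  intros Hlam Hl Hg H.
  assert (H1 : 1 <= lam).
  { destruct (Rle_lt_dec 1 lam) as [L | L]; trivial; exfalso.
    assert (E : Rpower lam (1 - gam) < 1).
    { unfold Rpower; apply Rlt_le_trans with (exp 0); [ apply exp_increasing | rewrite exp_0; lra ].
      assert (ln lam < 0) by (rewrite <- ln_1; apply ln_increasing; trivial).
      assert (0 < (1 - gam) * - ln lam) by (apply Rmult_lt_0_compat; lra); lra. }
    assert (T : 0 < Rpower lam (1 - gam)) by apply exp_pos.
    assert (Rpower lam (1 - gam) * l <= Rpower lam (1 - gam) * 1) by (apply Rmult_le_compat_l; lra); lra. }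
  split; trivial; apply Rle_trans with (1 := H), Rmult_le_compat_r; [ lra | ].
  rewrite <- (Rpower_1 lam) at 2 by trivial; apply Rpower_mono; lra.
Qed.

(** * From the norms of the statement to an admissible datum and back *)

Theorem theorem1p3 :
  forall om : pt -> Prop, smooth_domain om ->
  exists l0 : R, 0 < l0 < 1 /\
  forall (N K : nat) (gam : R), (4 <= N)%nat -> (4 <= K)%nat -> 0 < gam < 1 ->
  exists sig0 : R, 1 <= sig0 /\
  exists C : R,
  forall (beta l lam M : R) (v w : nat -> pt -> R) (A : nat -> nat -> pt -> R),
    0 < beta -> 0 < l -> 0 < lam -> 0 < M ->
    (forall i, (i < 3)%nat -> C2_closed (nbhd om (2 * l)) (v i)) ->
    (forall i, (i < 2)%nat -> C2_closed (nbhd om (2 * l)) (w i)) ->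
    (forall a b, (a < 2)%nat -> (b < 2)%nat -> holder_on beta (nbhd om (2 * l)) (A a b)) ->
    (forall x, nbhd om (2 * l) x -> A 0%nat 1%nat x = A 1%nat 0%nat x) ->
    l <= l0 ->
    sig0 <= Rpower lam (1 - gam) * l ->
    Rmax (Rmax (norm2 3 (nbhd om (2 * l)) v) (norm2 2 (nbhd om (2 * l)) w)) 1 <= M ->
    let S2 := nbhd om (2 * l) in
    let S1 := nbhd om l in
    let D0 := mnorm0 (interior2 S2) (defect A v w) in
    let e := sqrt D0 + l * M in
    let gv := grad0 3 S2 v in
    exists vt wt : nat -> pt -> R,
      (forall i, (i < 3)%nat -> C2_closed S1 (vt i)) /\
      (forall i, (i < 2)%nat -> C2_closed S1 (wt i)) /\
      norm1 3 S1 (vdiff vt v) <= C * Rpower lam (gam / 2) * e /\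
      norm1 2 S1 (vdiff wt w) <= C * Rpower lam gam * e * (1 + e + gv) /\
      hess0 3 S1 vt <= C * Rpower (lam * l) (Jexp N K) * Rpower lam (gam / 2) / l * e /\
      hess0 2 S1 wt <=
        C * Rpower (lam * l) (Jexp N K) * Rpower lam gam / l * e * (1 + e + gv) /\
      mnorm0 (interior2 S1) (defect A vt wt) <=
        C * (Rpower l beta * mholder beta S2 A
             + Rpower lam gam / (lam * l) ^ (2 * (fib K - 1) * N) * (D0 + (l * M) ^ 2)).
Proof.
  (* A value below 1 makes [l < 1], hence [rho / l >= 1]. *)
  intros om [_ [Hom _]]; exists (/ 2); split; [ lra | ].
  (* The threshold 1 gives [lam >= 1] and [lam * l >= 1], hence [rho >= 1]. *)
  intros N K gam _ HK Hgam; exists 1; split; [ lra | ].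
  destruct (perturbation om Hom) as [vt [wt [Rv [Rw [C [HC Est]]]]]].
  (* The factor 2 comes from expanding the square of [e] in the last estimate. *)
  exists (2 * C); intros beta l lam M v w A Hbeta Hl Hlam HM Hv Hw HA HAs Hl0 Hsig HnM S2 S1 D0 e gv.
  destruct (frequency_ge1 lam l gam Hlam ltac:(lra) Hgam Hsig) as [Hlam1 Hmu].
  destruct (exponent_le N K HK) as [HJ HJn].
  set (mu := lam * l) in *; set (J := Jexp N K) in *.
  assert (BS : bounded2 S2) by (apply nbhd_bounded, Hom).
  assert (Thick : forall x, thick om (2 * l) x -> interior2 S2 x) by (intros x; apply thick_nbhd).
  assert (NM : norm2 3 S2 v <= M /\ norm2 2 S2 w <= M).
  { split; (eapply Rle_trans; [ | exact HnM ]); (eapply Rle_trans; [ | apply Rmax_l ]); [ apply Rmax_l | apply Rmax_r ]. }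
  destruct NM as [NMv NMw].
  assert (HMv : hess0 3 S2 v <= M) by (eapply Rle_trans; [ apply Rmax_r | exact NMv ]).
  assert (HMw : hess0 2 S2 w <= M) by (eapply Rle_trans; [ apply Rmax_r | exact NMw ]).
  assert (GMv : gv <= M) by (eapply Rle_trans; [ apply Rmax_r | eapply Rle_trans; [ apply Rmax_l | exact NMv ] ]).
  assert (GMw : grad0 2 S2 w <= M) by (eapply Rle_trans; [ apply Rmax_r | eapply Rle_trans; [ apply Rmax_l | exact NMw ] ]).
  assert (Gv0 : 0 <= gv) by apply maxR_nonneg.
  assert (D0p : 0 <= D0) by apply maxR_nonneg.
  assert (In2 : forall x, interior2 S2 x -> S2 x) by (intros x; apply interior2_incl).
  assert (Bd : forall a b, (a < 2)%nat -> (b < 2)%nat -> forall x, interior2 S2 x -> Rabs (defect A v w a b x) <= D0).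
  { intros a b Ha Hb x Hx.
    (* The norm dominates the values of the defect only once the defect is known to be bounded. *)
    destruct (unif_cont_bounded S2 (A a b) BS (holder_unif_cont _ _ _ Hbeta (HA a b Ha Hb))) as [BA HBA].
    eapply mnorm0_ge; trivial.
    apply (defect_bounded (interior2 S2) A v w BA gv (grad0 2 S2 w) a b Ha Hb); [ auto | | ];
      intros i c y Hi Hy; apply grad0_ge; trivial. }
  assert (DL : 0 < l < 1) by lra.
  assert (Hrho : 1 <= Rpower mu (J / 2)) by (apply Rpower_ge1; lra).
  assert (Osc : forall a b x y, (a < 2)%nat -> (b < 2)%nat -> thick om (2 * l) x -> thick om (2 * l) y ->
    dist2 y x <= l -> Rabs (A a b y - A a b x) <= Rpower l beta * mholder beta S2 A).
  { intros a b x y Ha Hb Hx Hy Hd.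
    apply Rle_trans with (Rpower l beta * (supn S2 (A a b) + holder_semi beta S2 (A a b))).
    - apply holder_le; auto.
    - apply Rmult_le_compat_l; [ left; apply exp_pos | unfold mholder ].
      apply Rle_trans with (2 := maxR_ge 2 _ a Ha).
      exact (maxR_ge 2 (fun b => supn S2 (A a b) + holder_semi beta S2 (A a b)) b Hb). }
  assert (Ac : forall a b x, (a < 2)%nat -> (b < 2)%nat -> thick om (2 * l) x -> continuous (A a b) x).
  { intros a b x Ha Hb Hx; apply (cont_on_continuous (interior2 S2) _ (interior2_open S2)); [ | apply Thick, Hx ].
    intros y Hy eps He; destruct (holder_unif_cont _ _ _ Hbeta (HA a b Ha Hb) eps He) as [d [Hd H]].
    exists d; split; trivial; intros z Hz Hyz; exact (H y z (In2 y Hy) (In2 z Hz) Hyz). }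
  assert (Bv : forall i, (i < 3)%nat -> exists B, forall x, thick om (2 * l) x -> Rabs (v i x) <= B).
  { intros i Hi; destruct (C2_closed_bound 3 S2 v BS Hv i Hi) as [B HB]; exists B; auto. }
  assert (Bw : forall i, (i < 2)%nat -> exists B, forall x, thick om (2 * l) x -> Rabs (w i x) <= B).
  { intros i Hi; destruct (C2_closed_bound 2 S2 w BS Hw i Hi) as [B HB]; exists B; auto. }
  set (p := Datum om l M (Rpower mu (J / 2)) D0 gv (Rpower l beta * mholder beta S2 A) v w A
    DL HM Hrho D0p (conj Gv0 GMv)
    (fun i Hi => C2_closed_C2bd 3 S2 v BS Hv i _ gv M Hi Thick (Rle_refl _) HMv)
    Bv
    (fun i Hi => C2_closed_C2bd 2 S2 w BS Hw i _ M M Hi Thick GMw HMw)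
    Bw
    Ac (fun x Hx => HAs x (In2 x (Thick x Hx))) Osc (fun a b x Ha Hb Hx => Bd a b Ha Hb x (Thick x Hx))).
  exists (vt p), (wt p).
  (* The closed [l]-neighbourhood lies in the open set of radius [3/2 l] on which the estimates
     hold. *)
  assert (InU : forall x, S1 x -> dilate om dl (3 / 2) p x) by (intros x Hx; apply (nbhd_thick om l); [ simpl; lra | exact Hx ]).
  assert (lp : forall q : datum om, 0 < dl q) by (intros q; apply dl_pos).
  assert (ep : 0 < e) by exact (de_pos om p).
  assert (EG : dG om p = gv + e) by reflexivity.
  assert (Rp : 1 <= Rpower lam (gam / 2)) by (apply Rpower_ge1; lra).
  assert (Rp' : 1 <= Rpower lam gam) by (apply Rpower_ge1; lra).
  assert (HP : 0 < Rpower mu J) by apply exp_pos.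
  assert (Hr2 : Rpower mu (J / 2) * Rpower mu (J / 2) = Rpower mu J) by (rewrite <- Rpower_plus; f_equal; field).
  assert (Li : 0 < / l) by (apply Rinv_0_lt_compat, Hl).
  assert (EH : dH om p = Rpower mu J * / l * e).
  { rewrite <- Hr2; change (e * (Rpower mu (J / 2) * / l) * Rpower mu (J / 2) = Rpower mu (J / 2) * Rpower mu (J / 2) * / l * e); ring. }
  assert (Q1 : 0 < Rpower mu J * / l * e) by (repeat apply Rmult_lt_0_compat; trivial).
  (* The powers of [lam] in the first four bounds are at least 1 and are inserted as slack, like the
     factor 2. *)
  assert (Up : forall r t, 1 <= r -> 0 <= t -> C * t <= 2 * C * (r * t)).
  { intros r t Hr Ht; assert (H1 := Rmult_le_pos _ _ HC Ht); assert (H2 : C * t * 1 <= C * t * r) by (apply Rmult_le_compat_l; lra); lra. }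
  assert (Pos : forall t, 0 <= t -> 0 <= C * t) by (intros t Ht; apply Rmult_le_pos; trivial).
  assert (T1 : 0 <= e * (1 + (gv + e))) by (apply Rmult_le_pos; lra).
  assert (T2 : 0 <= Rpower mu J * / l * e * (1 + (gv + e))) by (apply Rmult_le_pos; lra).
  split; [ | split; [ | split; [ | split; [ | split; [ | split ] ] ] ] ].
  - intros i Hi; destruct (Rv i Hi) as [X [L HS]]; exact (symb_C2_closed om dl lp _ X L p HS).
  - intros i Hi; destruct (Rw i Hi) as [X [L HS]]; exact (symb_C2_closed om dl lp _ X L p HS).
  - apply Rle_trans with (C * e); [ | replace (2 * C * Rpower lam (gam / 2) * e) with (2 * C * (Rpower lam (gam / 2) * e)) by ring; apply Up; lra ].
    apply norm1_diff_le; [ apply Pos; lra | | ].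
    + intros i Hi x Hx; exact (proj1 (proj1 (Est p x (InU x Hx)) i Hi)).
    + intros i Hi a x Hx; assert (Hx1 := InU x (interior2_incl _ _ Hx)).
      split; [ | split ].
      * destruct (Rv i Hi) as [X [L HS]]; apply (proj1 (proj2 (proj2 HS) a)); exact Hx1.
      * apply (C2bd_ex_pd _ _ _ _ (datum_v om p i Hi)); apply thick_mono with (2 := Hx1); simpl; lra.
      * exact (proj1 (proj2 (proj1 (Est p x Hx1) i Hi)) a).
  - apply Rle_trans with (C * (e * (1 + (gv + e)))); [ |
      replace (2 * C * Rpower lam gam * e * (1 + e + gv)) with (2 * C * (Rpower lam gam * (e * (1 + (gv + e))))) by ring; apply Up; trivial ].
    apply norm1_diff_le; [ apply Pos; trivial | | ].
    + intros i Hi x Hx; exact (proj1 (proj1 (proj2 (Est p x (InU x Hx))) i Hi)).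
    + intros i Hi a x Hx; assert (Hx1 := InU x (interior2_incl _ _ Hx)).
      split; [ | split ].
      * destruct (Rw i Hi) as [X [L HS]]; apply (proj1 (proj2 (proj2 HS) a)); exact Hx1.
      * apply (C2bd_ex_pd _ _ _ _ (datum_w om p i Hi)); apply thick_mono with (2 := Hx1); simpl; lra.
      * exact (proj1 (proj2 (proj1 (proj2 (Est p x Hx1)) i Hi)) a).
  - apply Rle_trans with (C * (Rpower mu J * / l * e)); [ |
      replace (2 * C * Rpower mu J * Rpower lam (gam / 2) / l * e) with (2 * C * (Rpower lam (gam / 2) * (Rpower mu J * / l * e))) by (unfold Rdiv; ring); apply Up; lra ].
    apply hess0_le; [ apply Pos; lra | ]; intros i Hi a b x Hx; rewrite <- EH.
    exact (proj2 (proj2 (proj1 (Est p x (InU x (interior2_incl _ _ Hx))) i Hi)) a b).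
  - apply Rle_trans with (C * (Rpower mu J * / l * e * (1 + (gv + e)))); [ |
      replace (2 * C * Rpower mu J * Rpower lam gam / l * e * (1 + e + gv)) with (2 * C * (Rpower lam gam * (Rpower mu J * / l * e * (1 + (gv + e))))) by (unfold Rdiv; ring); apply Up; trivial ].
    apply hess0_le; [ apply Pos; trivial | ]; intros i Hi a b x Hx; rewrite <- EH.
    exact (proj2 (proj2 (proj1 (proj2 (Est p x (InU x (interior2_incl _ _ Hx)))) i Hi)) a b).
  - set (n := (2 * (fib K - 1) * N)%nat) in *.
    set (h := Rpower l beta * mholder beta S2 A).
    assert (Hh : 0 <= h) by (apply Rmult_le_pos; [ left; apply exp_pos | apply maxR_nonneg ]).
    assert (Hmn : 0 < mu ^ n) by (apply pow_lt; lra).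
    (* The sixth power of [rho] is [mu^(3 J)], the gain of three stages, to be compared with the
       required exponent. *)
    assert (E6 : mu ^ n <= Rpower mu (J / 2) ^ 6).
    { rewrite <- Rpower_pow by lra; rewrite <- (Rpower_pow 6 (Rpower mu (J / 2))) by apply exp_pos.
      rewrite Rpower_mult; apply Rpower_mono; trivial; simpl (INR 6); lra. }
    assert (E2 : e ^ 2 <= 2 * (D0 + (l * M) ^ 2)).
    { unfold e; assert (T := sqrt_sqrt _ D0p); assert (T' := pow2_ge_0 (sqrt D0 - l * M)); nra. }
    assert (E7 : (e * / Rpower mu (J / 2) ^ 3) ^ 2 <= 2 * (Rpower lam gam / mu ^ n * (D0 + (l * M) ^ 2))).
    { replace ((e * / Rpower mu (J / 2) ^ 3) ^ 2) with (e ^ 2 * / Rpower mu (J / 2) ^ 6)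
        by (assert (0 < Rpower mu (J / 2)) by lra; field; lra).
      assert (I6 : / Rpower mu (J / 2) ^ 6 <= / mu ^ n) by (apply Rinv_le_contravar; trivial).
      assert (I0 : 0 < / mu ^ n) by (apply Rinv_0_lt_compat, Hmn).
      assert (P2 := pow2_ge_0 e); assert (P3 := pow2_ge_0 (l * M)).
      apply Rle_trans with (e ^ 2 * / mu ^ n); [ apply Rmult_le_compat_l; trivial | ].
      apply Rle_trans with (2 * (D0 + (l * M) ^ 2) * / mu ^ n); [ apply Rmult_le_compat_r; lra | ].
      replace (2 * (Rpower lam gam / mu ^ n * (D0 + (l * M) ^ 2))) with (2 * (D0 + (l * M) ^ 2) * / mu ^ n * Rpower lam gam) by (unfold Rdiv; ring).
      rewrite <- (Rmult_1_r (2 * (D0 + (l * M) ^ 2) * / mu ^ n)) at 1; apply Rmult_le_compat_l; trivial.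
      apply Rmult_le_pos; lra. }
    assert (F0 := pow2_ge_0 (e * / Rpower mu (J / 2) ^ 3)).
    apply Rle_trans with (C * (h + (e * / Rpower mu (J / 2) ^ 3) ^ 2)).
    + apply mnorm0_le; [ apply Pos; lra | ]; intros a b Ha Hb x Hx.
      exact (proj2 (proj2 (Est p x (InU x (interior2_incl _ _ Hx)))) a b Ha Hb).
    + rewrite (Rmult_comm 2 C), (Rmult_assoc C 2).
      apply Rmult_le_compat_l; trivial; lra.
Qed.
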